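(* Let $R$ be an $\mathbb F_p$-algebra with $2$ invertible, $H$ a split torus with Lie algebra $\mathfrak h$ (with $\mathbb F_p$-form $\mathfrak h_{\mathbb F_p}$ spanned by the cocharacters), $W$ a representation of $H$ whose trace form $\beta_W$ is nondegenerate on $\mathfrak h_{\mathbb F_p}$, and $\kappa\in R$ invertible. Then for all $x\in\mathfrak h_{\mathbb F_p}$ and $j\in\mathbb Z$ the element $$(xt^j)^p-\kappa^{p-1}(xt^{jp})$$ lies in $\widehat U_\kappa(\hat{\mathfrak h})^{\mathcal LH}$. Moreover, every element of the PBW filtration term $\widehat U_\kappa(\hat{\mathfrak h})^{\mathcal LH}_{\le j}$ can be written uniquely as a converging sum of polynomials of degree $\le j/p$ in the elements $(xt^i)^p-\kappa^{p-1}(xt^{ip})$, $i\in\mathbb Z$ ($x$ running over a basis of $\mathfrak h_{\mathbb F_p}$).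
   Context: $\hat{\mathfrak h}=\mathfrak h(\!(t)\!)\oplus R\mathbf 1$ with $\mathbf 1$ central and $[xf,yg]=-\kappa\,\mathrm{Res}_{t=0}(f\,dg)\,\beta_W(x,y)\mathbf 1$; $U_\kappa(\hat{\mathfrak h})=U(\hat{\mathfrak h})/(\mathbf 1-1)$; $\widetilde U_\kappa(\hat{\mathfrak h})=\varprojlim_mU_\kappa(\hat{\mathfrak h})/U_\kappa(\hat{\mathfrak h})t^m\mathfrak h[[t]]$; $\widetilde U_\kappa(\hat{\mathfrak h})_{\le i}$ is the closure of the image of the $i$-th PBW filtered piece, and $\widehat U_\kappa(\hat{\mathfrak h})=\bigcup_i\widetilde U_\kappa(\hat{\mathfrak h})_{\le i}$. $\mathcal LH(S)=H(S(\!(t)\!))$ acts by algebra automorphisms with $g.x=x+\kappa\,\mathrm{Res}_{t=0}\beta_W(g^{-1}dg,x)\mathbf 1$ for $x\in\mathfrak h(\!(t)\!)$; invariants are scheme-theoretic. A possibly infinite sum of monomials of bounded degree is converging if for every $N$ only finitely many of its monomials involve no generator with index $i>N$. *)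

(* Defs.v *)
From HB Require Import structures.
From mathcomp Require Import all_boot all_order all_algebra.
From mathcomp Require Import finmap.
From mathcomp Require Import boolp classical_sets functions cardinality fsbigop.
From mathcomp Require Import zify.

Set Implicit Arguments.
Unset Strict Implicit.
Unset Printing Implicit Defensive.

Import Order.TTheory GRing.Theory Num.Theory.

Local Open Scope quotient_scope.
Local Open Scope ring_scope.

Definition vanish_below (A : nmodType) (N : int) (f : int -> A) :=
  forall i, i < N -> f i = 0.

Record laurent (A : nmodType) := Laurent {
  lcoef :> int -> A;
  _ : `[< exists N, vanish_below N lcoef >] }.

HB.instance Definition _ (A : nmodType) := [isSub for @lcoef A].
HB.instance Definition _ (A : nmodType) := [Choice of laurent A by <:].

Section LaurentZmodule.
Variable A : zmodType.
Implicit Types f g h : laurent A.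

Lemma laurentP f : exists N, vanish_below N f.
Proof. by case: f => f /= /asboolP. Qed.

Lemma laurent_eq f g : (forall i, f i = g i) -> f = g.
Proof. by move=> e; apply: val_inj; apply: funext. Qed.

Definition mkL (f : int -> A) (H : exists N, vanish_below N f) : laurent A :=
  Laurent (introT (asboolP _) H).

Lemma lzero_subproof : exists N, vanish_below N (fun=> 0 : A).
Proof. by exists 0. Qed.

Lemma lopp_subproof f : exists N, vanish_below N (fun i => - f i).
Proof. by have [N fN] := laurentP f; exists N => i /fN ->; rewrite oppr0. Qed.

Lemma ladd_subproof f g : exists N, vanish_below N (fun i => f i + g i).
Proof.
have [[M fM] [N gN]] := (laurentP f, laurentP g).
by exists (Order.min M N) => i; rewrite lt_min => /andP[/fM -> /gN ->]; rewrite addr0.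
Qed.

Definition lzero := mkL lzero_subproof.
Definition lopp f := mkL (lopp_subproof f).
Definition ladd f g := mkL (ladd_subproof f g).

Lemma laddA : associative ladd.
Proof. by move=> f g h; apply: laurent_eq => i; rewrite /= addrA. Qed.
Lemma laddC : commutative ladd.
Proof. by move=> f g; apply: laurent_eq => i; rewrite /= addrC. Qed.
Lemma ladd0 : left_id lzero ladd.
Proof. by move=> f; apply: laurent_eq => i; rewrite /= add0r. Qed.
Lemma laddN : left_inverse lzero lopp ladd.
Proof. by move=> f; apply: laurent_eq => i; rewrite /= addNr. Qed.

HB.instance Definition _ :=
  GRing.isZmodule.Build (laurent A) laddA laddC ladd0 laddN.

Lemma lcoef0 i : (0 : laurent A) i = 0. Proof. by []. Qed.
Lemma lcoefD f g i : (f + g) i = f i + g i. Proof. by []. Qed.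
Lemma lcoefN f i : (- f) i = - f i. Proof. by []. Qed.

Lemma lmon_subproof (c : A) (j : int) :
  exists N, vanish_below N (fun i => if i == j then c else 0).
Proof. by exists j => i; case: eqP => // ->; rewrite ltxx. Qed.

(* c t^j *)
Definition lmon (c : A) (j : int) := mkL (lmon_subproof c j).

End LaurentZmodule.

Section LaurentRing.
Variable A : comNzRingType.
Implicit Types f g h : laurent A.

Lemma le_natP (i k : int) : i <= k -> exists m : nat, k = i + m%:Z.
Proof. by move=> ik; exists (absz (k - i)%R); lia. Qed.

(* For fixed k only finitely many terms are nonzero. *)
Definition conv (f g : int -> A) (k : int) : A :=
  \sum_(i \in [set: int]%classic) f i * g (k - i).

Lemma convE (f g : int -> A) (a b : int) (k : nat) :
    vanish_below a f -> vanish_below b g ->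
  conv f g (a + b + k%:Z) = \sum_(i < k.+1) f (a + i%:Z) * g (b + (k - i)%N%:Z).
Proof.
move=> fa gb; rewrite /conv.
pose r := [seq a + i%:Z | i <- iota 0 k.+1].
have rP i : reflect (a <= i <= a + k%:Z) (i \in r).
  apply: (iffP mapP) => [[j]|/andP[ai ik]].
    by rewrite mem_iota => /andP[_ ?] ->; lia.
  by have [j ij] := le_natP ai; exists j => //; rewrite mem_iota; lia.
rewrite (fsbigE r) => [||//|i _ /rP ir].
- rewrite (eq_bigl xpredT) => [|i]; last by rewrite in_setT.
  rewrite big_map -[iota 0 k.+1]/(index_iota 0 k.+1) big_mkord.
  apply: eq_bigr => i _; congr (_ * g _).
  by have := ltn_ord i; lia.
- by rewrite map_inj_uniq ?iota_uniq// => i j; lia.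
have [ia|ai] := ltP i a; first by rewrite fa ?mul0r.
by rewrite gb ?mulr0//; lia.
Qed.

Lemma conv_vanish (f g : int -> A) (a b : int) :
  vanish_below a f -> vanish_below b g -> vanish_below (a + b) (conv f g).
Proof.
move=> fa gb k kab; rewrite /conv fsbig1// => i _.
have [ia|ai] := ltP i a; first by rewrite fa ?mul0r.
by rewrite gb ?mulr0//; lia.
Qed.

Lemma lmul_subproof f g : exists N, vanish_below N (conv f g).
Proof.
have [[M fM] [N gN]] := (laurentP f, laurentP g).
by exists (M + N); apply: conv_vanish.
Qed.

Definition lmul f g := mkL (lmul_subproof f g).

Lemma lmulC : commutative lmul.
Proof.
move=> f g; have [[a fa] [b gb]] := (laurentP f, laurentP g).
apply: laurent_eq => k; rewrite /=.
have [kab|abk] := ltP k (a + b).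
  by rewrite (conv_vanish fa gb)// (conv_vanish gb fa)// addrC.
have [m ->] := le_natP abk.
rewrite (convE _ fa gb) [a + b]addrC (convE _ gb fa).
rewrite (reindex_inj rev_ord_inj)/=; apply: eq_bigr => i _.
by rewrite mulrC !subSS subKn// -ltnS.
Qed.

Lemma lmulA : associative lmul.
Proof.
move=> f g h; have [[a fa] [b gb] [c hc]] := And3 (laurentP f) (laurentP g) (laurentP h).
have fg := conv_vanish fa gb; have gh := conv_vanish gb hc.
apply: laurent_eq => k; rewrite /=.
have [kabc|abck] := ltP k (a + b + c).
  by rewrite (conv_vanish fg hc)// (conv_vanish fa gh) ?addrA.
have [m ->] := le_natP abck.
pose P u (d : int) := \poly_(i < m.+1) (u (d + i%:Z) : A).
have PE u d i : (i <= m)%N -> (P u d)`_i = u (d + i%:Z).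
  by move=> im; rewrite coef_poly ltnS im.
rewrite (convE _ fg hc) -(addrA a b c) (convE _ fa gh).
transitivity (P f a * (P g b * P h c))`_m; last rewrite mulrA.
- rewrite coefM; apply: eq_bigr => i _; have im : (i <= m)%N by rewrite -ltnS.
  rewrite PE//; congr (_ * _); rewrite (convE _ gb hc) coefM.
  by apply: eq_bigr => j _; have := ltn_ord j; rewrite ltnS => ji; rewrite !PE//; lia.
- rewrite coefM; apply: eq_bigr => i _; have im : (i <= m)%N by rewrite -ltnS.
  rewrite [(P h c)`__]PE ?leq_subr//; congr (_ * _); rewrite (convE _ fa gb) coefM.
  by apply: eq_bigr => j _; have := ltn_ord j; rewrite ltnS => ji; rewrite !PE//; lia.
Qed.

Lemma conv_lmon (c : A) j f k : conv (lmon c j) f k = c * f (k - j).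
Proof.
rewrite /conv (fsbigE [:: j])//= => [|i _]; last first.
  by rewrite inE => /negPf ->; rewrite mul0r.
by rewrite big_cons big_nil in_setT eqxx addr0.
Qed.

Lemma lmul1 : left_id (lmon 1 0) lmul.
Proof. by move=> f; apply: laurent_eq => k; rewrite /= conv_lmon mul1r subr0. Qed.

Lemma lmulDl : left_distributive lmul +%R.
Proof.
move=> f g h; have [[a fa] [b gb] [c hc]] := And3 (laurentP f) (laurentP g) (laurentP h).
pose d := Order.min a b.
have fd : vanish_below d f by move=> i; rewrite lt_min => /andP[/fa].
have gd : vanish_below d g by move=> i; rewrite lt_min => /andP[_ /gb].
have fgd : vanish_below d (f + g).
  by move=> i id; rewrite lcoefD fd// gd// addr0.
apply: laurent_eq => k; rewrite lcoefD /=.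
have [kdc|dck] := ltP k (d + c).
  by rewrite (conv_vanish fgd hc)// (conv_vanish fd hc)// (conv_vanish gd hc)// addr0.
have [m ->] := le_natP dck.
rewrite (convE _ fgd hc) (convE _ fd hc) (convE _ gd hc) -big_split/=.
by apply: eq_bigr => i _; rewrite mulrDl.
Qed.

Lemma lone_neq0 : lmon 1 0 != 0 :> laurent A.
Proof.
by apply/eqP => /(congr1 (fun f : laurent A => f 0))/= /eqP; rewrite oner_eq0.
Qed.

HB.instance Definition _ := GRing.Zmodule_isComNzRing.Build (laurent A)
  lmulA lmulC lmul1 lmulDl lone_neq0.

Lemma lderiv_subproof f :
  exists N, vanish_below N (fun i => f (i + 1) *~ (i + 1)).
Proof.
have [N fN] := laurentP f; exists (N - 1) => i iN.
by rewrite fN ?mul0rz//; lia.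
Qed.

(* df = (lderiv f) dt *)
Definition lderiv f := mkL (lderiv_subproof f).

(* The residue at t = 0 of the differential f dt *)
Definition lres f : A := f (-1).

End LaurentRing.

Section LaurentMap.
Variables (A B : comNzRingType) (phi : {rmorphism A -> B}).

Lemma vanish_below_map N (f : int -> A) :
  vanish_below N f -> vanish_below N (phi \o f).
Proof. by move=> fN i /fN /= ->; rewrite rmorph0. Qed.

Lemma laurent_map_subproof (f : laurent A) : exists N, vanish_below N (phi \o f).
Proof. by have [N /vanish_below_map] := laurentP f; exists N. Qed.

Definition laurent_map (f : laurent A) : laurent B := mkL (laurent_map_subproof f).

Lemma laurent_map_lmon c j : laurent_map (lmon c j) = lmon (phi c) j.
Proof. by apply: laurent_eq => i /=; case: eqP; rewrite ?rmorph0. Qed.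

Lemma laurent_map_lderiv f : laurent_map (lderiv f) = lderiv (laurent_map f).
Proof. by apply: laurent_eq => i; rewrite /= rmorphMz. Qed.

Lemma laurent_map_is_zmod_morphism : zmod_morphism laurent_map.
Proof. by move=> f g; apply: laurent_eq => i; rewrite /= rmorphB. Qed.

Lemma laurent_map_is_monoid_morphism : monoid_morphism laurent_map.
Proof.
split=> [|f g]; first by rewrite laurent_map_lmon rmorph1.
have [[a fa] [b gb]] := (laurentP f, laurentP g).
have [fa' gb'] := (vanish_below_map fa, vanish_below_map gb).
apply: laurent_eq => k; rewrite [LHS]/=.
have [kab|abk] := ltP k (a + b).
  rewrite [RHS](conv_vanish fa' gb')// [X in phi X](conv_vanish fa gb)//.
  by rewrite rmorph0.
have [m ->] := le_natP abk.
rewrite [RHS](convE _ fa' gb') [X in phi X](convE _ fa gb) rmorph_sum.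
by apply: eq_bigr => i _; rewrite rmorphM.
Qed.

HB.instance Definition _ := GRing.isZmodMorphism.Build (laurent A) (laurent B)
  laurent_map laurent_map_is_zmod_morphism.
HB.instance Definition _ := GRing.isMonoidMorphism.Build (laurent A) (laurent B)
  laurent_map laurent_map_is_monoid_morphism.

End LaurentMap.

Definition dual (A : Type) : Type := (A * A)%type.

Section DualNumbers.
Variable A : comNzRingType.

HB.instance Definition _ := GRing.Zmodule.on (dual A).

Definition dmul (x y : dual A) : dual A := (x.1 * y.1, x.1 * y.2 + x.2 * y.1).

Lemma dmulA : associative dmul.
Proof.
move=> [a b] [c d] [e f]; rewrite /dmul/=; congr pair; first by rewrite mulrA.
by rewrite mulrDr mulrDl !mulrA addrA.
Qed.
Lemma dmulC : commutative dmul.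
Proof.
move=> [a b] [c d]; rewrite /dmul/=; congr pair; first by rewrite mulrC.
by rewrite addrC mulrC [a * d]mulrC.
Qed.
Lemma dmul1 : left_id ((1, 0) : dual A) dmul.
Proof. by move=> [a b]; rewrite /dmul/= !mul1r mul0r addr0. Qed.
Lemma dmulDl : left_distributive dmul +%R.
Proof.
move=> [a b] [c d] [e f]; rewrite /dmul; congr pair => /=; first by rewrite mulrDl.
by rewrite !mulrDl addrACA.
Qed.
Lemma done_neq0 : ((1, 0) : dual A) != 0.
Proof. by apply/eqP => -[] /eqP; rewrite oner_eq0. Qed.

HB.instance Definition _ := GRing.Zmodule_isComNzRing.Build (dual A)
  dmulA dmulC dmul1 dmulDl done_neq0.

Definition dual_inj (a : A) : dual A := (a, 0).

Lemma dual_inj_is_zmod_morphism : zmod_morphism dual_inj.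
Proof. by move=> a b; congr pair; rewrite /= subr0. Qed.
Lemma dual_inj_is_monoid_morphism : monoid_morphism dual_inj.
Proof.
by split=> // a b; rewrite /dual_inj; congr pair; rewrite /= mulr0 mul0r addr0.
Qed.

HB.instance Definition _ :=
  GRing.isZmodMorphism.Build A (dual A) dual_inj dual_inj_is_zmod_morphism.
HB.instance Definition _ :=
  GRing.isMonoidMorphism.Build A (dual A) dual_inj dual_inj_is_monoid_morphism.

End DualNumbers.

(* The split torus H of rank n is G_m^n, given by its functor of points.  Its
   Lie algebra is R^n, the standard basis vectors being the differentials of the
   standard basis of cocharacters, and its F_p-form is F_p^n. *)

Record Gm (A : comNzRingType) := MkGm {
  gval : A;
  ginv : A;
  gmulV : gval * ginv = 1 }.

Lemma gm_mul_subproof (A : comNzRingType) (x y : Gm A) :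
  (gval x * gval y) * (ginv x * ginv y) = 1.
Proof. by rewrite mulrACA !gmulV mulr1. Qed.

Definition gm_mul (A : comNzRingType) (x y : Gm A) : Gm A :=
  MkGm (gm_mul_subproof x y).

Lemma gm_map_subproof (A B : comNzRingType) (phi : {rmorphism A -> B}) (x : Gm A) :
  phi (gval x) * phi (ginv x) = 1.
Proof. by rewrite -rmorphM gmulV rmorph1. Qed.

Definition gm_map (A B : comNzRingType) (phi : {rmorphism A -> B}) (x : Gm A) :
  Gm B := MkGm (gm_map_subproof phi x).

Definition torus (n : nat) (A : comNzRingType) := 'I_n -> Gm A.

Definition torus_mul n (A : comNzRingType) (g h : torus n A) : torus n A :=
  fun a => gm_mul (g a) (h a).

Definition torus_map n (A B : comNzRingType) (phi : {rmorphism A -> B})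
  (g : torus n A) : torus n B := fun a => gm_map phi (g a).

(* A representation of H over R on a finitely generated projective module W,
   embedded as a direct summand of R^d: the action is extended by 0 to a
   complement of W, so that W is the image of the idempotent rep_act 1, which
   need not be the identity matrix.  Taking it to be the identity gives W = R^d. *)
Record torus_rep (R : comNzRingType) (n : nat) := TorusRep {
  rep_dim : nat;
  rep_act : forall A : comNzRingType, {rmorphism R -> A} ->
    torus n A -> 'M[A]_rep_dim;
  rep_actM : forall (A : comNzRingType) (phi : {rmorphism R -> A}) (g h : torus n A),
    rep_act phi (torus_mul g h) = rep_act phi g *m rep_act phi h;
  rep_act_nat : forall (A B : comNzRingType) (phi : {rmorphism R -> A})
      (chi : {rmorphism R -> B}) (psi : {rmorphism A -> B}) (g : torus n A),
    chi =1 psi \o phi ->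
    rep_act chi (torus_map psi g) = map_mx psi (rep_act phi g) }.

Section TraceForm.
Variables (R : comNzRingType) (n : nat) (W : torus_rep R n).

Lemma tangent_subproof (c : R) : ((1, c) : dual R) * ((1, - c) : dual R) = 1.
Proof.
by congr pair; rewrite /= ?mul1r// mulr1 addNr.
Qed.

(* The point 1 + eps x of H with values in the dual numbers *)
Definition tangent (x : 'rV[R]_n) : torus n (dual R) :=
  fun a => MkGm (tangent_subproof (x 0 a)).

Definition lie_act (x : 'rV[R]_n) : 'M[R]_(rep_dim W) :=
  map_mx snd (rep_act W (@dual_inj R) (tangent x)).

Definition trace_form (x y : 'rV[R]_n) : R := \tr (lie_act x *m lie_act y).

Definition gram : 'M[R]_n :=
  \matrix_(a, b) trace_form (delta_mx 0 a) (delta_mx 0 b).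

End TraceForm.

(* The trace form restricted to the F_p-form of the Lie algebra takes
   Frobenius-invariant values (values in F_p if Spec R is connected), and is
   nondegenerate when its Gram matrix on a basis of cocharacters is invertible
   over R; for values in F_p this is nondegeneracy over F_p. *)
Definition nondegenerate_trace_form (R : comUnitRingType) n (W : torus_rep R n) :=
  gram W \in unitmx.

(* For a Lie algebra L over R with bracket br and an element c of L, [env br c]
   is the quotient U(L) / (c - 1), presented by generators and relations. *)

Inductive expr (R L : Type) :=
  | Gen of L
  | Cst of R
  | Add of expr R L & expr R L
  | Mul of expr R L & expr R L.

Arguments Gen {R L}.
Arguments Cst {R L}.

Section EnvelopingAlgebra.
Variables (R : comNzRingType) (L : lmodType R) (br : L -> L -> L) (c : L).

Inductive expr_rel : expr R L -> expr R L -> Prop :=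
  | rel_refl u : expr_rel u u
  | rel_sym u v : expr_rel u v -> expr_rel v u
  | rel_trans u v w : expr_rel u v -> expr_rel v w -> expr_rel u w
  | rel_add u u' v v' : expr_rel u u' -> expr_rel v v' ->
      expr_rel (Add u v) (Add u' v')
  | rel_mul u u' v v' : expr_rel u u' -> expr_rel v v' ->
      expr_rel (Mul u v) (Mul u' v')
  | rel_addA u v w : expr_rel (Add u (Add v w)) (Add (Add u v) w)
  | rel_addC u v : expr_rel (Add u v) (Add v u)
  | rel_add0 u : expr_rel (Add (Cst 0) u) u
  | rel_addN u : expr_rel (Add (Mul (Cst (-1)) u) u) (Cst 0)
  | rel_mulA u v w : expr_rel (Mul u (Mul v w)) (Mul (Mul u v) w)
  | rel_mul1 u : expr_rel (Mul (Cst 1) u) u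
  | rel_mulDl u v w : expr_rel (Mul (Add u v) w) (Add (Mul u w) (Mul v w))
  | rel_mulDr u v w : expr_rel (Mul u (Add v w)) (Add (Mul u v) (Mul u w))
  | rel_cstD r s : expr_rel (Cst (r + s)) (Add (Cst r) (Cst s))
  | rel_cstM r s : expr_rel (Cst (r * s)) (Mul (Cst r) (Cst s))
  | rel_cstC r u : expr_rel (Mul (Cst r) u) (Mul u (Cst r))
  | rel_genD x y : expr_rel (Gen (x + y)) (Add (Gen x) (Gen y))
  | rel_genZ r x : expr_rel (Gen (r *: x)) (Mul (Cst r) (Gen x))
  | rel_bracket x y :
      expr_rel (Add (Gen (br x y)) (Mul (Gen y) (Gen x))) (Mul (Gen x) (Gen y))
  | rel_central : expr_rel (Gen c) (Cst 1).

Definition expr_relb (u v : {classic expr R L}) : bool := `[< expr_rel u v >].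

Lemma expr_relb_refl : reflexive expr_relb.
Proof. by move=> u; apply/asboolP/rel_refl. Qed.
Lemma expr_relb_sym : symmetric expr_relb.
Proof. by move=> u v; apply/asboolP/asboolP; apply: rel_sym. Qed.
Lemma expr_relb_trans : transitive expr_relb.
Proof. by move=> v u w /asboolP uv /asboolP vw; apply/asboolP/(rel_trans uv vw). Qed.

Canonical expr_equiv :=
  EquivRel expr_relb expr_relb_refl expr_relb_sym expr_relb_trans.

Definition env : Type := {eq_quot expr_equiv}.
HB.instance Definition _ := Choice.on env.

Definition env_pi (u : expr R L) : env := \pi_{eq_quot expr_equiv} u.
Definition env_repr (u : env) : expr R L := repr (u : {eq_quot expr_equiv}).

Lemma env_reprK u : env_pi (env_repr u) = u.
Proof. exact: reprK. Qed.

Lemma env_eqP u v : env_pi u = env_pi v <-> expr_rel u v.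
Proof.
split=> [/eqquotP/asboolP//|uv].
by apply/eqquotP; apply/asboolP.
Qed.

Definition env_add (u v : env) := env_pi (Add (env_repr u) (env_repr v)).
Definition env_mul (u v : env) := env_pi (Mul (env_repr u) (env_repr v)).
Definition env_opp (u : env) := env_mul (env_pi (Cst (-1))) u.
Definition env_scale (r : R) (u : env) := env_mul (env_pi (Cst r)) u.

Lemma env_repr_pi u : expr_rel (env_repr (env_pi u)) u.
Proof. by apply/env_eqP; rewrite env_reprK. Qed.

Lemma env_addE u v : env_add (env_pi u) (env_pi v) = env_pi (Add u v).
Proof. by apply/env_eqP/rel_add; exact: env_repr_pi. Qed.
Lemma env_mulE u v : env_mul (env_pi u) (env_pi v) = env_pi (Mul u v).
Proof. by apply/env_eqP/rel_mul; exact: env_repr_pi. Qed.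

Lemma env_ind (P : env -> Prop) : (forall u, P (env_pi u)) -> forall u, P u.
Proof. by move=> Pu u; rewrite -[u]env_reprK. Qed.

Lemma env_addA : associative env_add.
Proof.
elim/env_ind=> u; elim/env_ind=> v; elim/env_ind=> w.
by rewrite !env_addE; apply/env_eqP/rel_addA.
Qed.
Lemma env_addC : commutative env_add.
Proof.
by elim/env_ind=> u; elim/env_ind=> v; rewrite !env_addE; apply/env_eqP/rel_addC.
Qed.
Lemma env_add0 : left_id (env_pi (Cst 0)) env_add.
Proof. by elim/env_ind=> u; rewrite env_addE; apply/env_eqP/rel_add0. Qed.
Lemma env_addN : left_inverse (env_pi (Cst 0)) env_opp env_add.
Proof.
by elim/env_ind=> u; rewrite /env_opp env_mulE env_addE; apply/env_eqP/rel_addN.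
Qed.

HB.instance Definition _ :=
  GRing.isZmodule.Build env env_addA env_addC env_add0 env_addN.

Lemma env_mulA : associative env_mul.
Proof.
elim/env_ind=> u; elim/env_ind=> v; elim/env_ind=> w.
by rewrite !env_mulE; apply/env_eqP/rel_mulA.
Qed.
Lemma env_mul1r : left_id (env_pi (Cst 1)) env_mul.
Proof. by elim/env_ind=> u; rewrite env_mulE; apply/env_eqP/rel_mul1. Qed.
Lemma env_mulr1 : right_id (env_pi (Cst 1)) env_mul.
Proof.
elim/env_ind=> u; rewrite env_mulE; apply/env_eqP.
exact: rel_trans (rel_sym (rel_cstC _ _)) (rel_mul1 _).
Qed.
Lemma env_mulDl : left_distributive env_mul env_add.
Proof.
elim/env_ind=> u; elim/env_ind=> v; elim/env_ind=> w.
by rewrite !(env_addE, env_mulE); apply/env_eqP/rel_mulDl.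
Qed.
Lemma env_mulDr : right_distributive env_mul env_add.
Proof.
elim/env_ind=> u; elim/env_ind=> v; elim/env_ind=> w.
by rewrite !(env_addE, env_mulE); apply/env_eqP/rel_mulDr.
Qed.

HB.instance Definition _ := GRing.Zmodule_isPzRing.Build env
  env_mulA env_mul1r env_mulr1 env_mulDl env_mulDr.

Lemma env_scalerA r s u : env_scale r (env_scale s u) = env_scale (r * s) u.
Proof.
rewrite /env_scale env_mulA env_mulE; congr env_mul.
exact/env_eqP/rel_sym/rel_cstM.
Qed.
Lemma env_scaler1 : left_id 1 env_scale.
Proof. exact: env_mul1r. Qed.
Lemma env_scalerDr : right_distributive env_scale +%R.
Proof. by move=> r u v; apply: env_mulDr. Qed.
Lemma env_scalerDl u : {morph env_scale^~ u : r s / r + s}.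
Proof.
move=> r s; rewrite /env_scale -[RHS]env_mulDl env_addE; congr env_mul.
exact/env_eqP/rel_cstD.
Qed.

HB.instance Definition _ := GRing.Zmodule_isLmodule.Build R env
  env_scalerA env_scaler1 env_scalerDr env_scalerDl.

Definition gen (x : L) : env := env_pi (Gen x).

End EnvelopingAlgebra.

(* The ring morphism of enveloping algebras induced by a morphism f of Lie
   algebras that preserves the chosen elements and is semilinear along phi. *)
Fixpoint expr_map (R S L M : Type) (phi : R -> S) (f : L -> M) (u : expr R L) :=
  match u with
  | Gen x => Gen (f x)
  | Cst r => Cst (phi r)
  | Add v w => Add (expr_map phi f v) (expr_map phi f w)
  | Mul v w => Mul (expr_map phi f v) (expr_map phi f w)
  end.

Section EnvMap.
Variables (R S : comNzRingType) (phi : {rmorphism R -> S}).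
Variables (L : lmodType R) (br : L -> L -> L) (c : L).
Variables (M : lmodType S) (br' : M -> M -> M) (c' : M).
Variable f : L -> M.

Definition env_map (u : env br c) : env br' c' :=
  env_pi br' c' (expr_map phi f (env_repr u)).

Hypothesis fD : {morph f : x y / x + y}.
Hypothesis fZ : forall r x, f (r *: x) = phi r *: f x.
Hypothesis fbr : forall x y, f (br x y) = br' (f x) (f y).
Hypothesis fc : f c = c'.

Lemma env_map_pi u : env_map (env_pi br c u) = env_pi br' c' (expr_map phi f u).
Proof.
suff H v w : expr_rel br c v w ->
    expr_rel br' c' (expr_map phi f v) (expr_map phi f w).
  by apply/env_eqP/H; exact: env_repr_pi.
elim=> /= [{}v|{}v {}w _|{}v x {}w _ xv _|v1 v2 w1 w2 _ + _|v1 v2 w1 w2 _ + _|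
  {}v {}w x|{}v {}w|{}v|{}v|{}v {}w x|{}v|{}v {}w x|{}v {}w x|r s|r s|r {}v|x y|r x|x y|].
- exact: rel_refl.
- exact: rel_sym.
- exact: rel_trans.
- exact: rel_add.
- exact: rel_mul.
- exact: rel_addA.
- exact: rel_addC.
- by rewrite rmorph0; apply: rel_add0.
- by rewrite rmorphN1 rmorph0; apply: rel_addN.
- exact: rel_mulA.
- by rewrite rmorph1; apply: rel_mul1.
- exact: rel_mulDl.
- exact: rel_mulDr.
- by rewrite rmorphD; apply: rel_cstD.
- by rewrite rmorphM; apply: rel_cstM.
- exact: rel_cstC.
- by rewrite fD; apply: rel_genD.
- by rewrite fZ; apply: rel_genZ.
- by rewrite fbr; apply: rel_bracket.
- by rewrite fc rmorph1; apply: rel_central.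
Qed.

End EnvMap.

(* h((t)) + R 1, the second component being the coefficient of the central
   element 1; h((t)) is the space of row vectors of Laurent series. *)
Definition hhat (R : comNzRingType) (n : nat) : Type :=
  ('rV[laurent R]_n * R)%type.

Section Heisenberg.
Variables (R : comNzRingType) (n : nat).

HB.instance Definition _ := GRing.Zmodule.on (hhat R n).

Definition hscale (r : R) (x : hhat R n) : hhat R n :=
  (lmon r 0 *: x.1, r * x.2).

Lemma lmonM (r s : R) : lmon r 0 * lmon s 0 = lmon (r * s) 0.
Proof.
apply: laurent_eq => i; rewrite [LHS]conv_lmon subr0 /=.
by case: eqP; rewrite ?mulr0.
Qed.
Lemma lmonD (r s : R) j : lmon (r + s) j = lmon r j + lmon s j.
Proof. by apply: laurent_eq => i /=; case: eqP; rewrite ?addr0. Qed.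

Lemma hscalerA r s x : hscale r (hscale s x) = hscale (r * s) x.
Proof. by rewrite /hscale/= scalerA lmonM mulrA. Qed.
Lemma hscale1r : left_id 1 hscale.
Proof. by move=> [x a]; rewrite /hscale/= mul1r scale1r. Qed.
Lemma hscalerDr : right_distributive hscale +%R.
Proof. by move=> r [x a] [y b]; congr pair; rewrite /= ?scalerDr ?mulrDr. Qed.
Lemma hscalerDl x : {morph hscale^~ x : r s / r + s}.
Proof. by move=> r s; congr pair; rewrite /= ?lmonD ?scalerDl ?mulrDl. Qed.

HB.instance Definition _ := GRing.Zmodule_isLmodule.Build R (hhat R n)
  hscalerA hscale1r hscalerDr hscalerDl.

Variables (kappa : R) (B : 'M[R]_n).

(* The R((t))-bilinear extension to h((t)) of the form on h with matrix B *)
Definition lform (x y : 'rV[laurent R]_n) : laurent R :=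
  (x *m map_mx (fun r => lmon r 0) B *m y^T) 0 0.

Definition hcentral : hhat R n := (0, 1).

Definition hbracket (x y : hhat R n) : hhat R n :=
  (0, - (kappa * lres (lform x.1 (map_mx (@lderiv R) y.1)))).

Definition Ukappa : Type := env hbracket hcentral.
HB.instance Definition _ := GRing.PzRing.on Ukappa.
HB.instance Definition _ := GRing.Lmodule.on Ukappa.

Definition Ugen (x : 'rV[laurent R]_n) : Ukappa := gen hbracket hcentral (x, 0).

(* The left ideal U t^m h[[t]] *)
Definition tail_ideal (m : nat) (u : Ukappa) : Prop :=
  exists N (a : 'I_N -> Ukappa) (x : 'I_N -> 'rV[laurent R]_n),
    (forall k b, vanish_below m%:Z (x k 0 b)) /\
    u = \sum_(k < N) a k * Ugen (x k).

Definition pbw_le (i : nat) (u : Ukappa) : Prop :=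
  exists N (r : 'I_N -> R) (w : 'I_N -> seq (hhat R n)),
    (forall k, (size (w k) <= i)%N) /\
    u = \sum_(k < N) r k *: \prod_(x <- w k) (gen hbracket hcentral x : Ukappa).

(* An element of the inverse limit of the U / U t^m h[[t]] is given by a
   sequence of representatives in U; two such sequences define the same element
   when their m-th terms are congruent modulo U t^m h[[t]] for all m, and every
   notion below is invariant under this equivalence. *)
Record completion := Completion {
  cseq :> nat -> Ukappa;
  cseqP : forall m, tail_ideal m (cseq m.+1 - cseq m) }.

Lemma completion_of_subproof (u : Ukappa) m : tail_ideal m (u - u).
Proof.
exists 0%N, (fun=> 0), (fun=> 0); split=> [[]//|].
by rewrite subrr big_ord0.
Qed.

Definition completion_of (u : Ukappa) : completion :=
  Completion (completion_of_subproof u).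

(* The closure in the completion of the i-th filtered piece of U *)
Definition Utilde_le (i : nat) (u : completion) : Prop :=
  forall m, exists v, pbw_le i v /\ tail_ideal m (u m - v).

Definition Uhat (u : completion) : Prop := exists i, Utilde_le i u.

(* The sequence v of elements of U converges in the completion to the element
   represented by the sequence u. *)
Definition converges_to (v u : nat -> Ukappa) : Prop :=
  forall m, exists M, forall k, (M <= k)%N -> tail_ideal m (v k - u m).

Definition dlog (g : torus n (laurent R)) : 'rV[laurent R]_n :=
  \row_a (ginv (g a) * lderiv (gval (g a))).

Definition LH_lie (g : torus n (laurent R)) (x : hhat R n) : hhat R n :=
  (x.1, x.2 + kappa * lres (lform (dlog g) x.1)).

Definition LH_act (g : torus n (laurent R)) : Ukappa -> Ukappa :=
  @env_map R R idfun _ hbracket hcentral _ hbracket hcentral (LH_lie g).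

End Heisenberg.

Definition hhat_map (R A : comNzRingType) (n : nat) (phi : {rmorphism R -> A})
  (x : hhat R n) : hhat A n := (map_mx (laurent_map phi) x.1, phi x.2).

Definition base_change (R A : comNzRingType) (n : nat) (phi : {rmorphism R -> A})
    (kappa : R) (B : 'M[R]_n) :
    Ukappa kappa B -> Ukappa (phi kappa) (map_mx phi B) :=
  @env_map R A phi _ _ _ _ _ _ (hhat_map phi).

Lemma LH_act_pi (R : comNzRingType) (n : nat) (kappa : R) (B : 'M[R]_n)
    (g : torus n (laurent R)) u :
  LH_act g (env_pi (hbracket kappa B) (hcentral R n) u) =
  env_pi (hbracket kappa B) (hcentral R n) (expr_map idfun (LH_lie kappa B g) u).
Proof.
apply: env_map_pi => [[x r] [y s]|r [x s]|[x r] [y s]|].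
- congr pair; rewrite /= /lform linearD mulmxDr mxE {1}/lres lcoefD mulrDr.
  by rewrite addrACA.
- congr pair; rewrite /= /lform linearZ -scalemxAr mxE mulrDr [r * (_ * _)]mulrCA.
  by rewrite [lres (_ * _)]conv_lmon subr0.
- by congr pair; rewrite /= (_ : lres (lform _ _ 0) = 0) ?mulr0 ?addr0// /lform trmx0 mulmx0 mxE.
- by congr pair; rewrite /= (_ : lres (lform _ _ 0) = 0) ?mulr0 ?addr0// /lform trmx0 mulmx0 mxE.
Qed.

Lemma base_change_pi (R A : comNzRingType) (n : nat) (phi : {rmorphism R -> A})
    (kappa : R) (B : 'M[R]_n) u :
  base_change phi (env_pi (hbracket kappa B) (hcentral R n) u) =
  env_pi (hbracket (phi kappa) (map_mx phi B)) (hcentral A n)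
    (expr_map phi (hhat_map phi) u).
Proof.
apply: env_map_pi => [[x r] [y s]|r [x s]|[x r] [y s]|].
- by congr pair; rewrite /= (map_mxD, rmorphD).
- by congr pair; rewrite /= ?map_mxZ ?rmorphM//= laurent_map_lmon.
- congr pair; rewrite /= ?map_mx0// rmorphN rmorphM; congr (- (_ * _)).
  rewrite -[phi (lres _)]/(lres (laurent_map phi _)) /lform; congr lres.
  have eB : map_mx (laurent_map phi) (map_mx (fun r => lmon r 0) B) =
      map_mx (fun r => lmon r 0) (map_mx phi B).
    by apply/matrixP => i j; rewrite !mxE; exact: laurent_map_lmon.
  have ey : map_mx (laurent_map phi) (map_mx (@lderiv R) y) =
      map_mx (@lderiv A) (map_mx (laurent_map phi) y).
    by apply/matrixP => i j; rewrite !mxE; exact: laurent_map_lderiv.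
  by rewrite -ey -eB map_trmx -!map_mxM [RHS]mxE.
- by congr pair; rewrite /= ?map_mx0 ?rmorph1.
Qed.

(* Scheme-theoretic invariance: for every R-algebra A and every g in H(A((t)))
   the image of u in the completed enveloping algebra over A is fixed by g.  The
   action of g on U maps U t^k h[[t]] into U t^m h[[t]] for k large, hence
   extends by continuity to the completion, g.u being the limit of the g.(u k). *)
Definition LH_invariant (R : comNzRingType) (n : nat) (kappa : R) (B : 'M[R]_n)
    (u : completion kappa B) : Prop :=
  forall (A : comNzRingType) (phi : {rmorphism R -> A}) (g : torus n (laurent A)),
    converges_to (fun k => LH_act g (base_change phi (u k)))
                 (fun k => base_change phi (u k)).

Section CentralElements.
Variables (p : nat) (R : comNzRingType) (n : nat) (kappa : R) (B : 'M[R]_n).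

(* The element x t^j of h((t)) for x in the F_p-form of h; the map 'F_p -> R
   sends the class of a natural number k to k%:R. *)
Definition xt (x : 'rV['F_p]_n) (j : int) : 'rV[laurent R]_n :=
  \row_a lmon (x 0 a : nat)%:R j.

Definition pcenter_elt (x : 'rV['F_p]_n) (j : int) : Ukappa kappa B :=
  Ugen kappa B (xt x j) ^+ p - kappa ^+ p.-1 *: Ugen kappa B (xt x (j * p%:Z)).

(* The variable (a, i) stands for pcenter_elt (b_a) i, b being a basis of the
   F_p-form of h; a monomial is its family of exponents. *)
Definition monomial := {fsfun 'I_n * int -> nat with 0%N}.

Definition mdegree (M : monomial) : nat := (\sum_(s <- finsupp M) M s)%N.

(* The elements pcenter_elt x i commute with one another, hence the order of the
   factors is irrelevant. *)
Definition meval (b : n.-tuple 'rV['F_p]_n) (M : monomial) : Ukappa kappa B :=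
  \prod_(s <- finsupp M) pcenter_elt (tnth b s.1) s.2 ^+ M s.

Definition converging (c : monomial -> R) : Prop :=
  forall N : int, finite_set
    [set M : monomial | c M != 0 /\ forall s, s \in finsupp M -> s.2 <= N]%classic.

(* u is the sum of the family of the c M (meval b M), with respect to the
   topology of the completion. *)
Definition has_sum (b : n.-tuple 'rV['F_p]_n) (c : monomial -> R)
    (u : completion kappa B) : Prop :=
  forall m, exists F0 : {fset monomial}, forall F : {fset monomial},
    (F0 `<=` F)%fset ->
    tail_ideal m (u m - \sum_(M <- F) c M *: meval b M).

(* u is the converging sum with coefficients c of monomials of degree <= j/p in
   the elements attached to b. *)
Definition expansion (b : n.-tuple 'rV['F_p]_n) (j : nat) (c : monomial -> R)
    (u : completion kappa B) : Prop :=
  [/\ forall M, c M != 0 -> (mdegree M * p <= j)%N,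
      converging c
    & has_sum b c u].

End CentralElements.

(* Main.v *)
Require Import Defs.
From HB Require Import structures.
From mathcomp Require Import all_boot all_order all_algebra qpoly.
From mathcomp Require Import finmap.
From mathcomp Require Import boolp classical_sets cardinality fsbigop.
From mathcomp Require Import zify ring.

Set Implicit Arguments.
Unset Strict Implicit.
Unset Printing Implicit Defensive.

Import Order.TTheory GRing.Theory Num.Theory.

Local Open Scope ring_scope.

(* Fix a basis b of the F_p-form.  U acts on polynomials in variables X_(a, i)
   with i < m, b_a t^i acting by X_(a, i) plus, for i > 0, a multiple of a
   derivative in the variables of index -i; the vector 1 generates a module
   isomorphic to U / U t^m h[[t]].  We use the transposed action on functionals,
   where the infinite sums of derivatives become finite.

   In characteristic p the element (x t^i)^p - kappa^(p-1) x t^(ip) is central,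
   and g in LH adds to it l^p - kappa^(p-1) l', where l and l' are kappa times
   the residues of beta(dlog g, x t^i) and of beta(dlog g, x t^(ip)); this
   vanishes because dlog g is fixed by the Cartier operator and the trace form
   takes Frobenius-invariant values.

   Conversely let u be invariant with leading part f, of degree d.  The part of
   degree d - 1 of g.u - u is the derivative of f along the translation vector
   of g.  Taking g = t and g = 1 - z t^(+-1) with z nilpotent, in each coordinate
   of the torus, all the partial derivatives of f vanish, so f is a series in the
   X_(a, i)^p, which are the leading terms of the central elements: subtract the
   corresponding series in these elements and induct on d.  Uniqueness follows
   from the same computation of leading terms. *)

(** * Laurent series and logarithmic derivatives *)

(** No PBW theorem is taken for granted. Spanning by ordered monomials modulo U t^m h[[t]] comes
    from reordering words, commutators being scalars; independence comes from evaluating on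
    functionals of the Fock module, which read off top coefficients. An element of the completion is
    known only through representatives modulo U t^m h[[t]], one for each m, so a leading coefficient
    is read at a level m that sees its monomial and is then shown not to depend on m. The trace form
    takes Frobenius-invariant values because, restricted to mu_p, a cocharacter grades W by weights
    in Z/p; this gives X^p = X for the Lie algebra action X, and in characteristic p the trace of a
    p-th power is the p-th power of the trace. A vanishing partial derivative says that e c = 0,
    where c is the coefficient of a monomial and e the exponent of the variable in it; e is
    invertible unless p divides it, which leaves exactly the p-th powers. Scheme-theoretic
    invariance is what provides points with nilpotent z. *)

Lemma mulrn_int (i : int) n : i *+ n = i * n%:Z.
Proof. by rewrite -mulr_natr natz. Qed.

Section LaurentSeries.
Variable A : comNzRingType.
Implicit Types f g w : laurent A.

(** The length of the window is only bounded below, not forced as in [convE], so that the three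
    convolutions in the Leibniz rule, whose series start at different orders, have sums of the same
    length. *)
Lemma conv_window (f g : int -> A) (a b k : int) (N : nat) :
    vanish_below a f -> vanish_below b g -> k < a + b + N%:Z ->
  conv f g k = \sum_(i < N) f (a + i%:Z) * g (k - (a + i%:Z)).
Proof.
move=> fa gb kN; rewrite /conv (fsbigE [seq a + i%:Z | i <- iota 0 N]) => [||//|i _].
- rewrite (eq_bigl xpredT) => [|i]; last by rewrite in_setT.
  by rewrite big_map -[N in iota 0 N]subn0 -/(index_iota 0 N) big_mkord.
- by rewrite map_inj_uniq ?iota_uniq// => i j; lia.
move=> /negP iN; have [ia|ai] := ltP i a; first by rewrite fa ?mul0r.
rewrite gb ?mulr0//; have [//|bki] := ltP (k - i) b; case: iN.
have [j ij] := le_natP ai; apply/mapP; exists j => //.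
by rewrite mem_iota; lia.
Qed.

Lemma vanish_le (a b : int) (f : int -> A) :
  b <= a -> vanish_below a f -> vanish_below b f.
Proof. by move=> ba fa i ib; apply: fa; apply: lt_le_trans ba. Qed.

Lemma coef_lmonM c j f k : (lmon c j * f) k = c * f (k - j).
Proof. exact: conv_lmon. Qed.

Lemma lmon_mul (c d : A) i j : lmon c i * lmon d j = lmon (c * d) (i + j).
Proof.
apply: laurent_eq => k; rewrite coef_lmonM /=.
by rewrite subr_eq [j + i]addrC; case: eqP; rewrite ?mulr0.
Qed.

Lemma lmon_exp (c : A) i n : lmon c i ^+ n = lmon (c ^+ n) (i *+ n).
Proof.
elim: n => [|n IH]; first by rewrite !expr0 mulr0n.
by rewrite exprS IH lmon_mul -exprS -mulrS.
Qed.

Lemma lmon0 i : lmon 0 i = 0 :> laurent A.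
Proof. by apply: laurent_eq => k /=; case: eqP. Qed.

Lemma lmonMn (c : A) i n : lmon (c *+ n) i = lmon c i *+ n.
Proof. by elim: n => [|n IH]; rewrite ?mulr0n ?lmon0// !mulrSr lmonD IH. Qed.

Lemma lcoef_sum I (r : seq I) (P : pred I) (F : I -> laurent A) k :
  (\sum_(i <- r | P i) F i) k = \sum_(i <- r | P i) F i k.
Proof. by elim/big_rec2: _ => // i x y _ <-. Qed.

Lemma lderivD f g : lderiv (f + g) = lderiv f + lderiv g.
Proof. by apply: laurent_eq => k; rewrite lcoefD /= mulrzDl. Qed.

Lemma lderivN f : lderiv (- f) = - lderiv f.
Proof. by apply: laurent_eq => k; rewrite lcoefN /= mulNrz. Qed.

Lemma lderiv0 : lderiv 0 = 0 :> laurent A.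
Proof. by apply: laurent_eq => k; rewrite /= mul0rz. Qed.

Lemma lderiv_lmon (c : A) i : lderiv (lmon c i) = lmon (c *~ i) (i - 1).
Proof.
apply: laurent_eq => k /=; rewrite -[k == i - 1]subr_eq opprK.
by case: eqP => [->//|_]; rewrite mul0rz.
Qed.

Lemma lderivM f g : lderiv (f * g) = lderiv f * g + f * lderiv g.
Proof.
have [[a fa] [b gb]] := (laurentP f, laurentP g).
have f'a : vanish_below (a - 1) (lderiv f).
  by move=> i ia /=; rewrite fa ?mul0rz//; lia.
have g'b : vanish_below (b - 1) (lderiv g).
  by move=> i ib /=; rewrite gb ?mul0rz//; lia.
apply: laurent_eq => k; rewrite lcoefD.
have [N kN] : exists N : nat, k + 2 < a + b + N%:Z.
  by exists (absz (k + 3 - a - b)%R); lia.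
rewrite [LHS]/= (@conv_window _ _ a b (k + 1) N)//; last by lia.
rewrite [X in _ = X + _](@conv_window _ _ (a - 1) b k N)//; last by lia.
rewrite [X in _ = _ + X](@conv_window _ _ a (b - 1) k N)//; last by lia.
rewrite -big_split/= mulrz_suml; apply: eq_bigr => i _.
rewrite (_ : a - 1 + i%:Z + 1 = a + i%:Z); last by lia.
rewrite (_ : k - (a + i%:Z) + 1 = k + 1 - (a + i%:Z)); last by lia.
rewrite (_ : k - (a - 1 + i%:Z) = k + 1 - (a + i%:Z)); last by lia.
by rewrite mulrzAl mulrzAr -mulrzDr; congr (_ *~ _); lia.
Qed.

Lemma vanish_exp (a : int) f n : vanish_below a f -> vanish_below (a *+ n) (f ^+ n).
Proof.
move=> fa; elim: n => [|n IH]; first by move=> i i0 /=; case: eqP => // ii; lia.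
by rewrite exprS mulrS; apply: conv_vanish.
Qed.

Lemma vanish_lderiv (a : int) f : vanish_below a f -> vanish_below (a - 1) (lderiv f).
Proof. by move=> fa i ia /=; rewrite fa ?mul0rz//; lia. Qed.

(** One coefficient of an additive expression sees only finitely many terms of the series: leading
    monomials are split off one at a time until the order reaches N, and what remains is settled by
    its order alone. *)
Lemma laurent_ind_trunc (N : int) (P : laurent A -> Prop) :
    (forall f g, P f -> P g -> P (f + g)) ->
    (forall c i, P (lmon c i)) ->
    (forall f, vanish_below N f -> P f) ->
  forall f, P f.
Proof.
move=> PD Pm Pt f; have [a fa] := laurentP f.
have [m] : exists m : nat, N <= a + m%:Z by exists (absz (N - a)%R); lia.
elim: m a f fa => [|m IH] a f fa Nam; first by apply: Pt; apply: vanish_le fa; lia.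
rewrite -[f](subrK (lmon (f a) a)); apply: PD (Pm _ _).
apply: (IH (a + 1)); last by lia.
move=> i ia; rewrite lcoefD lcoefN /=; case: eqP => [->|ni]; first by rewrite subrr.
by rewrite subr0 fa//; lia.
Qed.

End LaurentSeries.

(** * Derivations and the Cartier operator *)

Section Derivation.
Variables (K : comNzRingType) (D : K -> K).
Hypothesis DD : forall a b, D (a + b) = D a + D b.
Hypothesis DM : forall a b, D (a * b) = D a * b + a * D b.

Lemma derivation0 : D 0 = 0.
Proof. by apply: (addrI (D 0)); rewrite -DD !addr0. Qed.

Lemma derivation_sum I (r : seq I) (P : pred I) (F : I -> K) :
  D (\sum_(i <- r | P i) F i) = \sum_(i <- r | P i) D (F i).
Proof. exact: (big_morph D DD derivation0). Qed.

Lemma derivation1 : D 1 = 0.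
Proof. by have := DM 1 1; rewrite !mul1r mulr1 => e; apply: (addrI (D 1)); rewrite addr0 -e. Qed.

Lemma derivationX a n : D (a ^+ n) = a ^+ n.-1 * D a *+ n.
Proof.
elim: n => [|n IH]; first by rewrite expr0 derivation1 mulr0n.
rewrite exprS DM IH mulrnAr mulrA -exprS mulrC /=.
by case: n IH => [|n] IH; rewrite ?mulr0n ?addr0 ?mulr1n// [in RHS]mulrS.
Qed.

Lemma derivationMn a n : D (a *+ n) = D a *+ n.
Proof. by elim: n => [|n IH]; rewrite ?mulr0n ?derivation0// !mulrS DD IH. Qed.

(* The exact term is the derivative of ((a + b)^p - a^p - b^p) / p. *)
Lemma derivation_exp_pred p (a b : K) : prime p ->
  exists h, (a + b) ^+ p.-1 * D (a + b) =
            a ^+ p.-1 * D a + b ^+ p.-1 * D b + D h.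
Proof.
move=> pp; have p0 := prime_gt0 pp.
pose c i := ('C(p, i) %/ p)%N.
have ci i : (0 < i < p)%N -> (c i * p = 'C(p, i))%N.
  by move=> ip; rewrite divnK// prime_dvd_bin.
exists (\sum_(1 <= i < p) a ^+ (p - i) * b ^+ i *+ c i).
have E x : (a + b) ^+ p.-1 * x = \sum_(0 <= i < p) a ^+ (p.-1 - i) * b ^+ i * x *+ 'C(p.-1, i).
  rewrite exprDn mulr_suml prednK// big_mkord; apply: eq_bigr => i _.
  by rewrite mulrnAl.
have eA : (a + b) ^+ p.-1 * D a = a ^+ p.-1 * D a +
    \sum_(1 <= i < p) a ^+ (p.-1 - i) * b ^+ i * D a *+ 'C(p.-1, i).
  by rewrite E big_ltn// subn0 expr0 mulr1 bin0 mulr1n.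
have eB : (a + b) ^+ p.-1 * D b =
    \sum_(1 <= i < p) a ^+ (p - i) * b ^+ i.-1 * D b *+ 'C(p.-1, i.-1) + b ^+ p.-1 * D b.
  rewrite E -[X in \sum_(0 <= i < X) _](prednK p0) big_nat_recr//= subnn expr0 mul1r.
  rewrite binn mulr1n; congr (_ + _); rewrite -[in RHS](prednK p0) big_add1/=.
  by apply: eq_bigr => i _; rewrite -[in RHS](prednK p0) subSS.
have eh : D (\sum_(1 <= i < p) a ^+ (p - i) * b ^+ i *+ c i) =
    \sum_(1 <= i < p) a ^+ (p.-1 - i) * b ^+ i * D a *+ 'C(p.-1, i) +
    \sum_(1 <= i < p) a ^+ (p - i) * b ^+ i.-1 * D b *+ 'C(p.-1, i.-1).
  rewrite derivation_sum -big_split/=; apply: eq_big_nat => i ip.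
  (* The binomials agree after multiplication by p: (p - i) C(p, i) = p C(p-1, i) for the derivative
     of a, and i C(p, i) = p C(p-1, i-1) for that of b. *)
  rewrite derivationMn DM !derivationX mulrnDl; congr (_ + _).
    rewrite mulrnAl -mulrnA mulrAC (_ : (p - i).-1 = (p.-1 - i)%N); last by lia.
    congr (_ *+ _); apply/eqP; rewrite -(eqn_pmul2l p0) mul_bin_down -ci//.
    by rewrite mulnCA [(p * _)%N]mulnC.
  rewrite mulrnAr -mulrnA mulrA; congr (_ *+ _); apply/eqP; rewrite -(eqn_pmul2l p0).
  by rewrite mul_bin_diag prednK ?ci// -?ci// 1?[(c i * p)%N]mulnC; lia.
by rewrite DD mulrDr eA eB eh -!addrA; congr (_ + _); rewrite addrC -addrA addrC -!addrA addrCA.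
Qed.

End Derivation.

Section CartierDlog.
Variables (p : nat) (A : comNzRingType).
Hypothesis hp : p \in [pchar A].
Implicit Types f g w : laurent A.

Let pp : prime p. Proof. exact: pcharf_prime hp. Qed.

Lemma laurent_pchar : p \in [pchar (laurent A)].
Proof.
rewrite inE pp/=; apply/eqP/laurent_eq => i.
by rewrite -[1]/(lmon 1 0) -lmonMn (pcharf0 hp) lmon0.
Qed.

Lemma cartier_subproof f : exists N, vanish_below N (fun k => f (p%:Z * k - 1)).
Proof.
have [N fN] := laurentP f; exists (- `|N|) => i iN; apply: fN.
by have := prime_gt0 pp; nia.
Qed.

(* The Cartier operator f dt |-> C(f) dt/t, without its inverse Frobenius twist. *)
Definition cartier f := mkL (cartier_subproof f).

Lemma cartierD f g : cartier (f + g) = cartier f + cartier g.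
Proof. exact: laurent_eq. Qed.

Let frob : {rmorphism laurent A -> laurent A} := laurent_map (pFrobenius_aut hp).

(** This is the p^(-1)-linearity of the Cartier operator. As [cartier] extracts no p-th root, g
    comes out with the same exponents and with its coefficients raised to the power p. *)
Lemma cartier_mulXp w g : cartier (w * g ^+ p) = cartier w * frob g.
Proof.
apply: laurent_eq => k; have [b wb] := laurentP w.
have [b' wb'] := laurentP (cartier w).
(* Large enough that both sides have no coefficient at k once g has order at least N. *)
pose N : int := `|p%:Z * k - b| + `|k - b'| + 1.
elim/(@laurent_ind_trunc A N): g => [f g If Ig|c i|f fN].
- rewrite (rmorphD frob) -(pFrobenius_autE laurent_pchar).
  by rewrite (rmorphD (pFrobenius_aut _)) !mulrDr [RHS]lcoefD -If -Ig.
- rewrite lmon_exp [frob _]laurent_map_lmon ![_ * lmon _ _]mulrC [RHS]coef_lmonM /=.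
  rewrite [LHS]conv_lmon pFrobenius_autE; congr (_ * w _).
  by rewrite mulrn_int; lia.
rewrite [LHS](conv_vanish wb (vanish_exp (n := p) fN)).
  rewrite [RHS](conv_vanish wb' (vanish_below_map (pFrobenius_aut hp) fN))//.
  by rewrite /N; lia.
by have := prime_gt0 pp; rewrite mulrn_int /N; nia.
Qed.

(** The classical C(g^(p-1) dg) = dg. Both sides are additive in g: the failure on the left is an
    exact differential, whose coefficient at index p k - 1 carries the factor p k. The shift
    [lmon 1 1] rewrites g' dt as t g' dt/t. *)
Lemma cartier_exp_pred g : cartier (g ^+ p.-1 * lderiv g) = lmon 1 1 * frob (lderiv g).
Proof.
apply: laurent_eq => k.
elim/(@laurent_ind_trunc A (`|k| + 2)): g => [f g If Ig|c i|f fN].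
- have [h ->] := derivation_exp_pred (@lderivD A) (@lderivM A) f g pp.
  rewrite [in RHS]lderivD (rmorphD frob) mulrDr !cartierD !lcoefD If Ig.
  rewrite (_ : cartier (lderiv h) k = 0) ?addr0// -[LHS]/(h _ *~ _) subrK.
  by rewrite -mulrzr intrM -pmulrn (pcharf0 hp) mul0r mulr0.
- rewrite lderiv_lmon lmon_exp lmon_mul.
  rewrite [frob _]laurent_map_lmon lmon_mul.
  rewrite mul1r /=.
  have -> : (p%:Z * k - 1 == i *+ p.-1 + (i - 1)) = (k == 1 + (i - 1)).
    rewrite mulrn_int; have := prime_gt0 pp; have : (p.-1%:Z = p%:Z - 1) by have := prime_gt0 pp; lia.
    by move=> -> p0; apply/eqP/eqP; nia.
  case: eqP => // _; rewrite mulrzAr -exprSr prednK ?prime_gt0//.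
  by rewrite pFrobenius_autMz pFrobenius_autE.
rewrite [RHS]coef_lmonM [LHS](conv_vanish (vanish_exp (n := p.-1) fN) (vanish_lderiv fN)).
  rewrite [X in _ * X](_ : _ = 0) ?mulr0//.
  by apply: (vanish_below_map _ (vanish_lderiv fN)); lia.
have : (p.-1%:Z = p%:Z - 1) by have := prime_gt0 pp; lia.
by rewrite mulrn_int => ->; have := prime_gt0 pp; nia.
Qed.

(* Apply the Cartier operator to w g^p = g^(p-1) g', where w = g'/g. *)
Lemma dlog_cartier g ginv k : g * ginv = 1 ->
  (ginv * lderiv g) (p%:Z * k - 1) = (ginv * lderiv g) (k - 1) ^+ p.
Proof.
move=> gV; set w := ginv * lderiv g.
have wg : w * g = lderiv g by rewrite /w mulrAC [ginv * g]mulrC gV mul1r.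
suff e : cartier w = lmon 1 1 * frob w.
  have /(congr1 (fun f : laurent A => f k)) := e.
  by rewrite coef_lmonM mul1r /= pFrobenius_autE.
have gV' : frob g * frob ginv = 1 by rewrite -rmorphM gV rmorph1.
rewrite -[LHS]mulr1 -gV' mulrA -cartier_mulXp -[in g ^+ p](prednK (prime_gt0 pp)).
by rewrite exprS mulrA wg [lderiv g * _]mulrC cartier_exp_pred -wg rmorphM -!mulrA gV' mulr1.
Qed.

End CartierDlog.

(** * The trace form of a representation of the torus *)

Section QpolyEval.
Variables (A C : comNzRingType) (h : {poly A}) (phi : {rmorphism A -> C}) (c : C).
Hypothesis hc : (map_poly phi (mk_monic h)).[c] = 0.

(** The proof that c is a root appears as an argument so that the ring morphism instances, which
    depend on it, can be found from the term. *)
Definition qeval of (map_poly phi (mk_monic h)).[c] = 0 :=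
  fun q : {poly %/ h} => (map_poly phi q).[c].

Lemma qeval_in_qpoly q : qeval hc (in_qpoly h q) = (map_poly phi q).[c].
Proof.
rewrite [in RHS](Pdiv.RingMonic.rdivp_eq (monic_mk_monic h) q).
by rewrite rmorphD rmorphM hornerD hornerM hc mulr0 add0r.
Qed.

Lemma qeval_is_zmod_morphism : zmod_morphism (qeval hc).
Proof. by move=> q r; rewrite /qeval rmorphB hornerD hornerN. Qed.

Lemma qeval_is_monoid_morphism : monoid_morphism (qeval hc).
Proof.
split=> [|q r]; first by rewrite -in_qpoly1 qeval_in_qpoly rmorph1 hornerC.
by rewrite [LHS]qeval_in_qpoly rmorphM hornerM.
Qed.

HB.instance Definition _ := GRing.isZmodMorphism.Build {poly %/ h} C
  (qeval hc) qeval_is_zmod_morphism.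
HB.instance Definition _ := GRing.isMonoidMorphism.Build {poly %/ h} C
  (qeval hc) qeval_is_monoid_morphism.

Lemma qevalX : qeval hc 'qX = c.
Proof. by rewrite qeval_in_qpoly map_polyX hornerX. Qed.

Lemma qevalC a : qeval hc (qpolyC h a) = phi a.
Proof. by rewrite /qeval /= map_polyC hornerC. Qed.

Lemma qeval_coef (n : nat) (q : {poly %/ h}) : (size (q : {poly A}) <= n)%N ->
  qeval hc q = \sum_(k < n) phi (q : {poly A})`_k * c ^+ k.
Proof.
move=> qn; rewrite /qeval (@horner_coef_wide _ n) ?(leq_trans (size_poly _ _))//.
by apply: eq_bigr => k _; rewrite coef_map.
Qed.

End QpolyEval.

Lemma mul_qpolyC (A : comNzRingType) (h : {poly A}) a (q : {poly %/ h}) :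
  qpolyC h a * q = a *: q.
Proof.
rewrite -[q in RHS]mul1r scalerAl; congr (_ * _); apply: val_inj.
by rewrite /= alg_polyC.
Qed.

Lemma coef_qXn (A : comNzRingType) (h : {poly A}) k :
    (k < (size (mk_monic h)).-1)%N ->
  ('qX ^+ k : {poly %/ h}) = 'X^k :> {poly A}.
Proof.
move=> kh; rewrite -rmorphXn /= Pdiv.Ring.rmodp_small// size_polyXn.
by rewrite -ltn_predRL.
Qed.

Section DualMap.
Variables (A B : comNzRingType) (f : {rmorphism A -> B}).

Definition dual_map (x : dual A) : dual B := (f x.1, f x.2).

Lemma dual_map_is_zmod_morphism : zmod_morphism dual_map.
Proof. by move=> x y; congr pair; rewrite /= rmorphB. Qed.

Lemma dual_map_is_monoid_morphism : monoid_morphism dual_map.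
Proof.
split=> [|x y]; first by congr pair; rewrite /= ?rmorph1 ?rmorph0.
by congr pair; rewrite /= ?rmorphD !rmorphM.
Qed.

HB.instance Definition _ := GRing.isZmodMorphism.Build (dual A) (dual B)
  dual_map dual_map_is_zmod_morphism.
HB.instance Definition _ := GRing.isMonoidMorphism.Build (dual A) (dual B)
  dual_map dual_map_is_monoid_morphism.

End DualMap.

Section DualTheory.
Variable A : comNzRingType.

Lemma dual_snd_sum I (r : seq I) (F : I -> dual A) :
  (\sum_(i <- r) F i).2 = \sum_(i <- r) (F i).2.
Proof. by elim/big_rec2: _ => // i x y _ <-. Qed.

Lemma dual_exp (a b : A) k :
  ((a, b) : dual A) ^+ k = (a ^+ k, b * a ^+ k.-1 *+ k).
Proof.
elim: k => [|k IH]; first by rewrite !expr0 mulr0n.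
rewrite exprS IH; congr pair; rewrite /= ?exprS//.
rewrite mulrSr mulrnAr; congr (_ + _).
by case: k {IH} => [|k]; rewrite ?mulr0n// mulrCA -exprS.
Qed.

End DualTheory.

Lemma gm_eq (A : comNzRingType) (x y : Gm A) : gval x = gval y -> x = y.
Proof.
case: x y => [x x' ex] [y y' ey] /= exy; move: ex ey; rewrite -exy => ex ey.
have e : x' = y' by rewrite -[x']mulr1 -ey mulrA [x' * x]mulrC ex mul1r.
by move: ex ey; rewrite -e => ex ey; rewrite (Prop_irrelevance ex ey).
Qed.

Lemma torus_eq n (A : comNzRingType) (g h : torus n A) :
  (forall a, gval (g a) = gval (h a)) -> g = h.
Proof. by move=> e; apply: funext => a; apply/gm_eq/e. Qed.

Lemma torus_mulC n (A : comNzRingType) (g h : torus n A) :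
  torus_mul g h = torus_mul h g.
Proof. by apply: torus_eq => a /=; rewrite mulrC. Qed.

Section PChar.
Variables (p : nat) (R : comNzRingType).
Hypothesis hp : p \in [pchar R].

Let pp : prime p. Proof. exact: pcharf_prime hp. Qed.

Lemma poly_expp (q : {poly R}) :
  q ^+ p = map_poly (pFrobenius_aut hp) q \Po 'X^p.
Proof.
have hP : p \in [pchar {poly R}] by apply: (rmorph_pchar (polyC : {rmorphism R -> {poly R}})).
rewrite -(pFrobenius_autE hP).
elim/poly_ind: q => [|q c IH]; first by rewrite rmorph0 map_poly0 comp_poly0.
rewrite !rmorphD !rmorphM /= IH map_polyX map_polyC !pFrobenius_autE -polyC_exp.
by rewrite comp_polyX comp_polyC.
Qed.

(* Compare the coefficients of X^(p(d-1)) in det(X - M)^p = det(X^p - M^p). *)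
Lemma mxtrace_pchar d (M : 'M[R]_d) : \tr (M ^+ p) = \tr M ^+ p.
Proof.
case: d M => [|d] M; first by rewrite /mxtrace !big_ord0 expr0n eqn0Ngt prime_gt0.
have hM : p \in [pchar 'M[{poly R}]_d.+1].
  by apply: (rmorph_pchar (scalar_mx \o polyC : {rmorphism R -> 'M[{poly R}]_d.+1})).
have e : char_poly M ^+ p = char_poly (M ^+ p) \Po 'X^p.
  have detX (N : 'M[{poly R}]_d.+1) k : \det (N ^+ k) = \det N ^+ k.
    by elim: k => [|k IH]; rewrite ?expr0 ?det1// !exprS det_mulmx IH.
  (* The scalar matrix X commutes with M, so Frobenius distributes over X - M in a matrix ring of
     characteristic p. *)
  rewrite /char_poly -detX -(pFrobenius_autE hM) /char_poly_mx.
  rewrite pFrobenius_autB_comm; last by apply: comm_scalar_mx.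
  rewrite !pFrobenius_autE -[_ \Po _]/(comp_poly 'X^p _) -det_map_mx; congr (\det _).
  rewrite raddfB /= map_scalar_mx /= comp_polyX; congr (_ - _).
    by rewrite -rmorphXn.
  rewrite -rmorphXn -map_mx_comp; apply/matrixP => i j; rewrite !mxE.
  by rewrite /= comp_polyC.
have := congr1 (fun q : {poly R} => q`_(d * p)) e.
rewrite poly_expp !coef_comp_poly_Xn ?prime_gt0// dvdn_mull// mulnK ?prime_gt0//.
rewrite coef_map /= -[d in X in X -> _]/(d.+1.-1) !char_poly_trace//.
by rewrite pFrobenius_autN pFrobenius_autE => /oppr_inj.
Qed.

End PChar.

Section TorusRep.
Variables (p : nat) (R : comNzRingType) (n : nat) (W : torus_rep R n).
Hypothesis hp : p \in [pchar R].
Local Notation d := (rep_dim W).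

Let pp : prime p. Proof. exact: pcharf_prime hp. Qed.

(** The torus is commutative, so the points 1 + eps1 x and 1 + eps2 y over R[eps1, eps2], realized
    as iterated dual numbers, commute; the coefficient of eps1 eps2 in the product of their actions
    is the product of the Lie algebra actions. *)
Lemma lie_act_comm (x y : 'rV[R]_n) :
  lie_act W x *m lie_act W y = lie_act W y *m lie_act W x.
Proof.
pose i1 : {rmorphism dual R -> dual (dual R)} := dual_map (@dual_inj R).
pose i2 : {rmorphism dual R -> dual (dual R)} := @dual_inj (dual R).
pose iR : {rmorphism R -> dual (dual R)} := i2 \o @dual_inj R.
have e1 z : rep_act W iR (torus_map i1 (tangent z)) = map_mx i1 (rep_act W (@dual_inj R) (tangent z)).
  by apply: rep_act_nat => r; apply/eqP.
have e2 z : rep_act W iR (torus_map i2 (tangent z)) = map_mx i2 (rep_act W (@dual_inj R) (tangent z)).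
  by apply: rep_act_nat.
have := rep_actM W iR (torus_map i1 (tangent x)) (torus_map i2 (tangent y)).
rewrite torus_mulC rep_actM !e1 !e2 => e.
have m12 (u v : dual R) : (i1 u * i2 v).2.2 = u.2 * v.2.
  by rewrite /= !(mulr0, mul0r) !(add0r, addr0).
have c12 (M N : 'M[dual R]_d) i j :
    ((map_mx i1 M *m map_mx i2 N) i j).2.2 = (map_mx snd M *m map_mx snd N) i j.
  rewrite !mxE !dual_snd_sum; apply: eq_bigr => k _.
  by rewrite ![map_mx _ _ _ _]mxE m12.
have c21 (M N : 'M[dual R]_d) i j :
    ((map_mx i2 M *m map_mx i1 N) i j).2.2 = (map_mx snd M *m map_mx snd N) i j.
  rewrite !mxE !dual_snd_sum; apply: eq_bigr => k _.
  by rewrite ![map_mx _ _ _ _]mxE mulrC m12 mulrC.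
by apply/matrixP => i j; rewrite -c12 -c21 -e.
Qed.

(* Let sum_k z^k Q_k be the action of the point z of the a-th factor G_m with
   values in R[z]/(z^p - 1), and X that of the Lie algebra.  Moving z in the
   direction X gives Q_k X = k Q_k, whereas X = sum_k k Q_k. *)
Lemma lie_act_pchar (a : 'I_n) : lie_act W (delta_mx 0 a) ^+ p = lie_act W (delta_mx 0 a).
Proof.
set X := lie_act _ _.
pose h : {poly R} := 'X^p - 1.
have p0 := prime_gt0 pp; have p1 := prime_gt1 pp.
have sh : size h = p.+1 by rewrite size_XnsubC.
have eh : mk_monic h = h by rewrite /mk_monic sh ltnS p0 monicXnsubC.
have esh : size (mk_monic h) = p.+1 by rewrite eh.
pose z : {poly %/ h} := 'qX.
have zp : z ^+ p = 1.
  have h0 : in_qpoly h h = 0.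
    by apply: val_inj; rewrite /= eh Pdiv.RingMonic.rmodpp ?monicXnsubC.
  by apply/eqP; rewrite -subr_eq0 -[1](rmorph1 (in_qpoly h)) -rmorphXn -rmorphB; apply/eqP; exact: h0.
have zV : z * z ^+ p.-1 = 1 by rewrite -exprS prednK.
pose zeta : torus n {poly %/ h} :=
  fun a' => if a' == a then MkGm zV else MkGm (mulr1 1).
pose F := rep_act W (qpolyC h : {rmorphism R -> {poly %/ h}}) zeta.
pose Q k : 'M[R]_d := \matrix_(i, j) (F i j : {poly R})`_k.
have sF i j : (size (F i j : {poly R}) <= p)%N.
  by rewrite -ltnS -esh; apply: size_mk_monic.
have hroot (C : comNzRingType) (f : {rmorphism R -> C}) c : c ^+ p = 1 ->
    (map_poly f (mk_monic h)).[c] = 0.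
  by move=> cp; rewrite eh rmorphB /= map_polyXn rmorph1 hornerD hornerN hornerXn hornerC cp subrr.
(* Both 1 + eps over R and z + eps z over R[z]/(z^p - 1) are p-th roots of unity, because eps^2 = 0
   and p = 0. Sending z to the first gives [XE], to the second [QX]. *)
have r1 : (map_poly (@dual_inj R) (mk_monic h)).[(1, 1) : dual R] = 0.
  apply: (hroot _ (@dual_inj R : {rmorphism R -> dual R})).
  by rewrite dual_exp expr1n mul1r expr1n (pcharf0 hp).
have r2 : (map_poly (@dual_inj {poly %/ h} \o qpolyC h) (mk_monic h)).[(z, z) : dual {poly %/ h}] = 0.
  apply: (hroot _ (@dual_inj {poly %/ h} \o qpolyC h : {rmorphism R -> dual {poly %/ h}})).
  rewrite dual_exp zp; congr pair.
  by rewrite -mulr_natr -(rmorph_nat (qpolyC h)) (pcharf0 hp) rmorph0 mulr0.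
have XE : X = \sum_(k < p) Q k *+ k.
  pose f1 : {rmorphism {poly %/ h} -> dual R} := qeval r1.
  rewrite /X /lie_act (_ : tangent _ = torus_map f1 zeta); last first.
    apply: torus_eq => a' /=; rewrite mxE eqxx /= /zeta; case: eqP => _ /=.
      by rewrite /f1/= qevalX.
    by rewrite rmorph1.
  rewrite (@rep_act_nat _ _ W _ _ (qpolyC h : {rmorphism R -> {poly %/ h}}) (@dual_inj R : {rmorphism R -> dual R}) f1) => [|r]; last by rewrite /f1 /= qevalC.
  apply/matrixP => i j; rewrite summxE !mxE [f1 _](qeval_coef r1 (sF i j)) dual_snd_sum.
  apply: eq_bigr => k _; rewrite mulmxnE mxE dual_exp !expr1n mulr1 /=.
  by rewrite mul0r addr0 mulr_natr.
have QX (k : 'I_p) : Q k *m X = Q k *+ k.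
  pose f2 : {rmorphism {poly %/ h} -> dual {poly %/ h}} := qeval r2.
  pose i1 : {rmorphism dual R -> dual {poly %/ h}} := dual_map (qpolyC h).
  pose iR : {rmorphism R -> dual {poly %/ h}} := @dual_inj {poly %/ h} \o qpolyC h.
  pose t : torus n (dual R) := tangent (delta_mx 0 a).
  have e : torus_map f2 zeta = torus_mul (torus_map (@dual_inj {poly %/ h}) zeta) (torus_map i1 t).
    apply: torus_eq => a' /=; rewrite mxE eqxx /= /zeta; case: eqP => _ /=.
      by rewrite /f2/= qevalX; congr pair; rewrite /= rmorph1 mulr1 ?mul0r ?addr0.
    by rewrite rmorph1; apply: injective_projections; rewrite /= ?rmorph1 ?rmorph0 ?mulr1 ?mulr0 ?mul0r ?addr0.
  have := congr1 (rep_act W iR) e.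
  rewrite rep_actM (@rep_act_nat _ _ W _ _ (qpolyC h : {rmorphism R -> {poly %/ h}}) iR f2); last first.
    by move=> r; rewrite /f2 /= qevalC.
  rewrite (@rep_act_nat _ _ W _ _ (qpolyC h : {rmorphism R -> {poly %/ h}}) iR
    (@dual_inj {poly %/ h} : {rmorphism {poly %/ h} -> dual {poly %/ h}}))//.
  rewrite (@rep_act_nat _ _ W _ _ (@dual_inj R : {rmorphism R -> dual R}) iR i1); last first.
    by move=> r; congr pair; rewrite /= rmorph0.
  move=> {}e; apply/matrixP => i j.
  have /(congr1 (fun M : 'M_d => (M i j).2)) := e.
  have T1 c m : ((@dual_inj {poly %/ h} \o qpolyC h) c * ((z, z) : dual {poly %/ h}) ^+ m).2 = c *: z ^+ m *+ m.
    rewrite dual_exp -[LHS]/(qpolyC h c * (z * z ^+ m.-1 *+ m) + 0 * _) mul0r addr0 mul_qpolyC.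
    by case: m => [|m]; rewrite ?mulr0n ?scaler0// -exprS scalerMnr.
  have T2 (f : {poly %/ h}) y : (@dual_inj {poly %/ h} f * i1 y).2 = y.2 *: f.
    by rewrite -[LHS]/(f * qpolyC h y.2 + 0 * _) mul0r addr0 mulrC mul_qpolyC.
  have cMn (q : {poly %/ h}) m : (q *+ m : {poly %/ h}) = (q : {poly R}) *+ m :> {poly R}.
    by elim: m => [|m IH]; rewrite ?mulr0n// !mulrSr poly_of_qpolyD IH.
  rewrite !mxE dual_snd_sum [f2 _](qeval_coef r2 (sF i j)) dual_snd_sum.
  under eq_bigr do rewrite T1.
  under [in RHS]eq_bigr do rewrite ![map_mx _ _ _ _]mxE T2.
  move=> /(congr1 (fun q : {poly %/ h} => (q : {poly R})`_k)); rewrite !poly_of_qpoly_sum !coef_sum.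
  under eq_bigr => k' _.
    rewrite cMn coefMn poly_of_qpolyZ coefZ coef_qXn ?esh// coefXn.
  over.
  rewrite (bigD1 k)//= big1 ?addr0 => [|k' k'k]; last first.
    by rewrite eq_sym -val_eqE /= in k'k; rewrite (negPf k'k) mulr0 mul0rn.
  rewrite eqxx mulr1 => ekk; rewrite mulmxnE !mxE ekk; apply: eq_bigr => l _.
  by rewrite [RHS](coefZ _ (F i l : {poly R}) k) mulrC !mxE.
(* Iterating Q_k X = k Q_k from X = sum_k k Q_k. At the power p, Fermat's k^p = k in R concludes. *)
have Xm m : X ^+ m.+1 = \sum_(k < p) Q k *+ k ^ m.+1.
  elim: m => [|m IH]; first by rewrite expr1 XE; under [RHS]eq_bigr do rewrite expn1.
  rewrite exprSr IH mulr_suml; apply: eq_bigr => k _.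
  by rewrite mulrnAl [_ * X]QX -mulrnA -expnS.
rewrite -(prednK p0) Xm {1}XE (prednK p0); apply: eq_bigr => k _.
rewrite -[in LHS]scaler_nat -[in RHS]scaler_nat.
by rewrite natrX -(pFrobenius_autE hp) pFrobenius_aut_nat.
Qed.

Lemma gramE a b : gram W a b = \tr (lie_act W (delta_mx 0 a) *m lie_act W (delta_mx 0 b)).
Proof. by rewrite mxE. Qed.

Lemma gram_sym : (gram W)^T = gram W.
Proof. by apply/matrixP => a b; rewrite mxE !gramE mxtrace_mulC. Qed.

(** The two commuting actions X and Y satisfy X^p = X and Y^p = Y, hence (X Y)^p = X Y, and the
    trace commutes with p-th powers. *)
Lemma gram_pchar a b : gram W a b ^+ p = gram W a b.
Proof.
rewrite gramE -(mxtrace_pchar hp) exprMn_comm ?lie_act_pchar//.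
exact: lie_act_comm.
Qed.

End TorusRep.

(** * Enveloping algebras *)

Section EnvMapMorphism.
Variables (R S : comNzRingType) (phi : {rmorphism R -> S}).
Variables (L : lmodType R) (br : L -> L -> L) (c : L).
Variables (M : lmodType S) (br' : M -> M -> M) (c' : M).
Variables (f : L -> M) (T : env br c -> env br' c').
Hypothesis T_pi : forall u, T (env_pi br c u) = env_pi br' c' (expr_map phi f u).

Lemma env_morphD : {morph T : u v / u + v}.
Proof.
elim/env_ind=> u; elim/env_ind=> v; rewrite [_ + _]env_addE !T_pi.
by rewrite [RHS]env_addE.
Qed.

Lemma env_morphM : {morph T : u v / u * v}.
Proof.
elim/env_ind=> u; elim/env_ind=> v; rewrite [_ * _]env_mulE !T_pi.
by rewrite [RHS]env_mulE.
Qed.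

Lemma env_morphZ r u : T (r *: u) = phi r *: T u.
Proof.
elim/env_ind: u => u; rewrite [_ *: _]env_mulE !T_pi.
by rewrite [RHS]env_mulE.
Qed.

Lemma env_morph1 : T 1 = 1.
Proof. by rewrite [LHS]T_pi /= rmorph1. Qed.

Lemma env_morph_gen x : T (gen br c x) = gen br' c' (f x).
Proof. exact: T_pi. Qed.

Lemma env_morph0 : T 0 = 0.
Proof. by apply: (addrI (T 0)); rewrite -env_morphD !addr0. Qed.

Lemma env_morphN u : T (- u) = - T u.
Proof. by apply: (addrI (T u)); rewrite -env_morphD !subrr env_morph0. Qed.

Lemma env_morphB u v : T (u - v) = T u - T v.
Proof. by rewrite env_morphD env_morphN. Qed.

Lemma env_morphX u k : T (u ^+ k) = T u ^+ k.
Proof. by elim: k => [|k IH]; rewrite ?env_morph1// !exprS env_morphM IH. Qed.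

Lemma env_morph_sum I (r : seq I) (P : pred I) (F : I -> env br c) :
  T (\sum_(i <- r | P i) F i) = \sum_(i <- r | P i) T (F i).
Proof. exact: (big_morph T env_morphD env_morph0). Qed.

Lemma env_morph_prod I (r : seq I) (P : pred I) (F : I -> env br c) :
  T (\prod_(i <- r | P i) F i) = \prod_(i <- r | P i) T (F i).
Proof. exact: (big_morph T env_morphM env_morph1). Qed.

End EnvMapMorphism.

Section Enveloping.
Variables (A : comNzRingType) (n : nat) (kappa : A) (B : 'M[A]_n).
Local Notation U := (Ukappa kappa B).
Implicit Types (u v : U) (x y : hhat A n) (r : A).

Definition ugen x : U := gen (hbracket kappa B) (hcentral A n) x.

Lemma ugenD x y : ugen (x + y) = ugen x + ugen y.
Proof. by rewrite [RHS]env_addE; apply/env_eqP/rel_genD. Qed.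

Lemma ugenZ r x : ugen (r *: x) = r *: ugen x.
Proof. by rewrite [RHS]env_mulE; apply/env_eqP/rel_genZ. Qed.

Lemma ugen_scalar r : ugen (0, r) = r *: (1 : U).
Proof.
have -> : (0, r) = r *: hcentral A n by congr pair; rewrite /= ?scaler0 ?mulr1.
by rewrite ugenZ; congr (_ *: _); apply/env_eqP/rel_central.
Qed.

Lemma ugen0 : ugen 0 = 0.
Proof. by rewrite -(scale0r (0 : hhat A n)) ugenZ scale0r. Qed.

Lemma ugen_sum I (s : seq I) (F : I -> hhat A n) :
  ugen (\sum_(i <- s) F i) = \sum_(i <- s) ugen (F i).
Proof. exact: (big_morph ugen ugenD ugen0). Qed.

Lemma ugen_split x : ugen x = Ugen kappa B x.1 + x.2 *: (1 : U).
Proof.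
rewrite -ugen_scalar -[Ugen _ _ _]/(ugen (x.1, 0)) -ugenD; congr ugen.
by case: x => x r; congr pair; rewrite /= ?addr0 ?add0r.
Qed.

Lemma uscaleAl r u v : r *: (u * v) = (r *: u) * v.
Proof. exact: (mulrA (env_pi _ _ (Cst r) : U)). Qed.

Lemma uscaleAr r u v : r *: (u * v) = u * (r *: v).
Proof.
rewrite uscaleAl [RHS](mulrA u (env_pi _ _ (Cst r) : U)); congr (_ * _).
elim/env_ind: u => u; rewrite [LHS]env_mulE [RHS]env_mulE.
by apply/env_eqP/rel_cstC.
Qed.

Lemma ucommE x y : ugen x * ugen y = (hbracket kappa B x y).2 *: (1 : U) + ugen y * ugen x.
Proof.
have e := iffRL (env_eqP _ _ _ _) (rel_bracket (hbracket kappa B) (hcentral A n) x y).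
by rewrite -ugen_scalar [LHS]env_mulE -e -env_addE -env_mulE.
Qed.

Lemma uscale1M r u : (r *: (1 : U)) * u = r *: u.
Proof. by rewrite -uscaleAl mul1r. Qed.

Lemma uscaleM1 r u : u * (r *: (1 : U)) = r *: u.
Proof. by rewrite -uscaleAr mulr1. Qed.

Lemma umulrn u k : u *+ k = (k%:R : A) *: u.
Proof. by rewrite scaler_nat. Qed.

Lemma ugen_ind (P : U -> Prop) :
    (forall x, P (ugen x)) -> (forall r, P (r *: (1 : U))) ->
    (forall u v, P u -> P v -> P (u + v)) -> (forall u v, P u -> P v -> P (u * v)) ->
  forall u, P u.
Proof.
move=> Pg Pc PD PM; elim/env_ind; elim=> [x|r|u Pu v Pv|u Pu v Pv].
- exact: Pg.
- by have := Pc r; rewrite [_ *: _]env_mulE (iffRL (env_eqP _ _ _ _) (rel_trans (rel_cstC _ _ _ _) (rel_mul1 _ _ _))).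
- by rewrite -env_addE; apply: PD.
- by rewrite -env_mulE; apply: PM.
Qed.

Definition uprod (w : seq (hhat A n)) : U := \prod_(x <- w) ugen x.

Lemma uprod_cons x w : uprod (x :: w) = ugen x * uprod w.
Proof. exact: big_cons. Qed.

Lemma uprod_nil : uprod [::] = 1.
Proof. exact: big_nil. Qed.

Lemma uprod_cat w1 w2 : uprod (w1 ++ w2) = uprod w1 * uprod w2.
Proof. exact: big_cat. Qed.

(** The strict bound makes [pbw_lt 0] the zero space, the base case for induction on the degree;
    [pbw_le i] is [pbw_lt i.+1]. *)
Definition pbw_lt (j : nat) u :=
  exists2 s : seq (A * seq (hhat A n)), all (fun t => size t.2 < j)%N s &
    u = \sum_(t <- s) t.1 *: uprod t.2.

Lemma pbw_lt0 j : pbw_lt j 0.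
Proof. by exists [::]; rewrite ?big_nil. Qed.

Lemma pbw_ltD j u v : pbw_lt j u -> pbw_lt j v -> pbw_lt j (u + v).
Proof.
move=> [s hs ->] [t ht ->]; exists (s ++ t); first by rewrite all_cat hs.
by rewrite big_cat.
Qed.

Lemma pbw_ltZ j r u : pbw_lt j u -> pbw_lt j (r *: u).
Proof.
move=> [s hs ->]; exists [seq (r * t.1, t.2) | t <- s]; first by rewrite all_map.
by rewrite scaler_sumr big_map; apply: eq_bigr => t _; rewrite scalerA.
Qed.

Lemma pbw_ltN j u : pbw_lt j u -> pbw_lt j (- u).
Proof. by rewrite -scaleN1r; apply: pbw_ltZ. Qed.

Lemma pbw_ltB j u v : pbw_lt j u -> pbw_lt j v -> pbw_lt j (u - v).
Proof. by move=> ju jv; apply: pbw_ltD => //; apply: pbw_ltN. Qed.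

Lemma pbw_lt_sum j I (s : seq I) (P : pred I) (F : I -> U) :
  (forall i, P i -> pbw_lt j (F i)) -> pbw_lt j (\sum_(i <- s | P i) F i).
Proof.
by move=> jF; elim/big_ind: _ => //; [apply: pbw_lt0 | apply: pbw_ltD].
Qed.

Lemma pbw_lt_uprod j w : (size w < j)%N -> pbw_lt j (uprod w).
Proof. by move=> jw; exists [:: (1, w)]; rewrite ?big_seq1 ?scale1r//= jw. Qed.

Lemma pbw_lt_le i j u : (i <= j)%N -> pbw_lt i u -> pbw_lt j u.
Proof.
move=> ij [s hs ->]; exists s => //; apply: sub_all hs => t /= ti.
exact: leq_trans ti ij.
Qed.

Lemma pbw_ltM i j u v : pbw_lt i.+1 u -> pbw_lt j v -> pbw_lt (i + j) (u * v).
Proof.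
move=> [s /allP hs ->] [t /allP ht ->]; rewrite mulr_suml big_seq.
apply: pbw_lt_sum => x /hs xi; rewrite mulr_sumr big_seq.
apply: pbw_lt_sum => y /ht yj; rewrite -uscaleAl -uscaleAr -uprod_cat.
do 2!apply: pbw_ltZ; apply: pbw_lt_uprod; rewrite size_cat.
by move: xi yj; rewrite /= ltnS => xi yj; rewrite -addnS leq_add.
Qed.

Lemma pbw_ltX i u k : pbw_lt i.+1 u -> pbw_lt (i * k).+1 (u ^+ k).
Proof.
move=> iu; elim: k => [|k IH].
  by rewrite muln0 expr0 -uprod_nil; apply: pbw_lt_uprod.
by rewrite exprS mulnS -addnS; apply: pbw_ltM.
Qed.

Lemma pbw_lt_ugen j x : (1 < j)%N -> pbw_lt j (ugen x).
Proof.
by move=> j1; have := @pbw_lt_uprod j [:: x] j1; rewrite uprod_cons uprod_nil mulr1.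
Qed.

Lemma pbw_leP i u : pbw_le i u <-> pbw_lt i.+1 u.
Proof.
split=> [[N [r [w [hw ->]]]]|[s hs ->]].
  exists [seq (r k, w k) | k <- index_enum 'I_N]; last by rewrite big_map.
  by rewrite all_map; apply/allP => k _; rewrite /= ltnS.
exists (size s), (fun k => (tnth (in_tuple s) k).1), (fun k => (tnth (in_tuple s) k).2).
split; last by rewrite big_tnth.
by move=> k; have /allP/(_ _ (mem_tnth k (in_tuple s))) := hs.
Qed.

(** Brackets are central, so exchanging two neighbouring letters costs a scalar times a word shorter
    by two; only a loss of one is recorded. *)
Lemma uprod_perm w1 w2 : perm_eq w1 w2 -> pbw_lt (size w1) (uprod w1 - uprod w2).
Proof.
have swap x w : pbw_lt (size w).+1 (ugen x * uprod w - uprod w * ugen x).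
  elim: w => [|y w IH]; first by rewrite uprod_nil mulr1 mul1r subrr; apply: pbw_lt0.
  rewrite uprod_cons mulrA ucommE mulrDl uscale1M -mulrA -addrA -mulrA -mulrBr.
  apply: pbw_ltD; first by apply/pbw_ltZ/pbw_lt_uprod; rewrite /= ltnS leqnSn.
  exact: (@pbw_ltM 1 _ _ _ (pbw_lt_ugen _ _) IH).
elim: w1 w2 => [|x w1 IH] w2 pw.
  have /perm_nilP -> : perm_eq w2 [::] by rewrite perm_sym.
  by rewrite subrr; apply: pbw_lt0.
have xw2 : x \in w2 by rewrite -(perm_mem pw) mem_head.
case/splitPr: xw2 pw => a b pw.
have pw' : perm_eq w1 (a ++ b).
  by move: pw; rewrite perm_sym -cat_rcons -cats1 -catA perm_catCA perm_cons perm_sym.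
rewrite !uprod_cons uprod_cat uprod_cons.
rewrite (_ : _ - _ = ugen x * (uprod w1 - uprod (a ++ b)) +
                     (ugen x * uprod a - uprod a * ugen x) * uprod b).
  apply: pbw_ltD; first exact: (@pbw_ltM 1 _ _ _ (pbw_lt_ugen _ _) (IH _ pw')).
  have -> : size (x :: w1) = (size a + (size b).+1)%N.
    by rewrite (perm_size pw) size_cat.
  by apply: pbw_ltM; [exact: swap | apply: pbw_lt_uprod].
by rewrite mulrBr mulrBl !mulrA uprod_cat mulrA addrA subrK.
Qed.

Definition vanish_row (m : nat) (x : 'rV[laurent A]_n) :=
  forall a, vanish_below m%:Z (x 0 a).

Lemma tailP m u : tail_ideal m u <->
  exists2 s : seq (U * 'rV[laurent A]_n), (forall t, t \in s -> vanish_row m t.2) &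
    u = \sum_(t <- s) t.1 * Ugen kappa B t.2.
Proof.
split=> [[N [a [x [hx ->]]]]|[s hs ->]].
  exists [seq (a k, x k) | k <- index_enum 'I_N]; last by rewrite big_map.
  by move=> _ /mapP[k _ ->] b; apply: hx.
exists (size s), (fun k => (tnth (in_tuple s) k).1), (fun k => (tnth (in_tuple s) k).2).
split; last by rewrite big_tnth.
by move=> k; apply/hs/mem_tnth.
Qed.

Lemma tail0 m : tail_ideal m (0 : U).
Proof. by apply/tailP; exists [::]; rewrite ?big_nil. Qed.

Lemma tailD m u v : tail_ideal m u -> tail_ideal m v -> tail_ideal m (u + v).
Proof.
move=> /tailP[s hs ->] /tailP[t ht ->]; apply/tailP; exists (s ++ t).
  by move=> x; rewrite mem_cat => /orP[/hs|/ht].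
by rewrite big_cat.
Qed.

Lemma tail_mull m u v : tail_ideal m v -> tail_ideal m (u * v).
Proof.
move=> /tailP[s hs ->]; apply/tailP; exists [seq (u * t.1, t.2) | t <- s].
  by move=> _ /mapP[t ts ->]; exact: (hs t ts).
by rewrite mulr_sumr big_map; apply: eq_bigr => t _; rewrite mulrA.
Qed.

Lemma tailX m u k : (0 < k)%N -> tail_ideal m u -> tail_ideal m (u ^+ k).
Proof. by case: k => // k _; rewrite exprSr; apply: tail_mull. Qed.

Lemma tailZ m r u : tail_ideal m u -> tail_ideal m (r *: u).
Proof. by rewrite -uscale1M; apply: tail_mull. Qed.

Lemma tailN m u : tail_ideal m u -> tail_ideal m (- u).
Proof. by rewrite -scaleN1r; apply: tailZ. Qed.

Lemma tailB m u v : tail_ideal m u -> tail_ideal m v -> tail_ideal m (u - v).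
Proof. by move=> mu mv; apply: tailD => //; apply: tailN. Qed.

Lemma tail_sum m I (s : seq I) (P : pred I) (F : I -> U) :
  (forall i, P i -> tail_ideal m (F i)) -> tail_ideal m (\sum_(i <- s | P i) F i).
Proof. by move=> mF; elim/big_ind: _ => //; [apply: tail0 | apply: tailD]. Qed.

Lemma tail_Ugen m (x : 'rV[laurent A]_n) : vanish_row m x -> tail_ideal m (Ugen kappa B x).
Proof.
move=> mx; apply/tailP; exists [:: (1, x)]; last by rewrite big_seq1 mul1r.
by move=> t; rewrite inE => /eqP ->.
Qed.

Lemma tail_le m k u : (m <= k)%N -> tail_ideal k u -> tail_ideal m u.
Proof.
move=> mk /tailP[s hs ->]; apply/tailP; exists s => // t /hs tk a.
by apply: vanish_le (tk a); rewrite lez_nat.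
Qed.

Lemma completion_tail (u : completion kappa B) m k :
  (m <= k)%N -> tail_ideal m (u k - u m).
Proof.
move=> mk; rewrite -(subnKC mk); elim: (k - m)%N => [|i IH].
  by rewrite addn0 subrr; apply: tail0.
rewrite -(subrK (u (m + i)%N) (u _)) -addrA; apply: tailD => //.
by rewrite addnS; apply: tail_le (cseqP u _); rewrite leq_addr.
Qed.

End Enveloping.

Section Form.
Variables (A : comNzRingType) (n : nat) (B : 'M[A]_n).
Implicit Types w x : 'rV[laurent A]_n.

Lemma lres_lform w x :
  lres (lform B w x) = \sum_c \sum_c' B c c' * (w 0 c * x 0 c') (-1).
Proof.
rewrite /lres /lform !mxE lcoef_sum [RHS]exchange_big; apply: eq_bigr => c' _.
rewrite !mxE mulr_suml lcoef_sum; apply: eq_bigr => c _.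
by rewrite !mxE [w 0 c * lmon _ _]mulrC -mulrA coef_lmonM subr0.
Qed.

Lemma lres_lform_vanish w x (k : int) :
  (forall c, vanish_below (- k) (w 0 c)) -> (forall c, vanish_below k (x 0 c)) ->
  lres (lform B w x) = 0.
Proof.
move=> wk xk; rewrite lres_lform big1// => c _; rewrite big1// => c' _.
by rewrite [X in _ * X](conv_vanish (wk c) (xk c')) ?mulr0//; lia.
Qed.

End Form.

(** * The loop group action and its continuity *)

Section LoopAction.
Variables (A : comNzRingType) (n : nat) (kappa : A) (B : 'M[A]_n).
Variable g : torus n (laurent A).
Local Notation U := (Ukappa kappa B).

Let T_pi := @LH_act_pi A n kappa B g.

Lemma LH_act_Ugen x : LH_act g (Ugen kappa B x : U) =
  Ugen kappa B x + (kappa * lres (lform B (dlog g) x)) *: (1 : U).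
Proof.
rewrite [LHS](env_morph_gen T_pi) [LHS](ugen_split kappa B) /=.
by rewrite add0r.
Qed.

(** Beyond the pole order K of [dlog g] the residue of [dlog g] against t^k h[[t]] is zero, so g
    fixes the generators of the left ideal. This is the continuity of the action. *)
Lemma tail_LH_act : exists K, forall k (u : U), (K <= k)%N ->
  tail_ideal k u -> tail_ideal k (LH_act g u).
Proof.
have [K hK] : exists K : nat, forall c, vanish_below (- K%:Z) (dlog g 0 c).
  have /choice[N hN] c := laurentP (dlog g 0 c).
  exists (\max_c `|N c|%N) => c; apply: vanish_le (hN c).
  by have := leq_bigmax (F := fun c => `|N c|%N) c; lia.
exists K => k u Kk /tailP[s hs ->].
rewrite (env_morph_sum T_pi) big_seq; apply: tail_sum => t ts.
rewrite (env_morphM T_pi) LH_act_Ugen (@lres_lform_vanish _ _ _ _ _ k%:Z) ?mulr0 ?scale0r ?addr0.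
- exact/tail_mull/tail_Ugen/hs.
- by move=> c; apply: vanish_le (hK c); lia.
- exact: hs ts.
Qed.

End LoopAction.

Section BaseChange.
Variables (R A : comNzRingType) (n : nat) (phi : {rmorphism R -> A}).
Variables (kappa : R) (B : 'M[R]_n).
Local Notation U := (Ukappa kappa B).

Let T_pi := @base_change_pi R A n phi kappa B.

Lemma base_change_ugen x : base_change phi (ugen kappa B x) =
  ugen (phi kappa) (map_mx phi B) (hhat_map phi x).
Proof. exact: (env_morph_gen T_pi). Qed.

Lemma base_change_Ugen x : base_change phi (Ugen kappa B x) =
  Ugen (phi kappa) (map_mx phi B) (map_mx (laurent_map phi) x).
Proof. by rewrite [LHS]base_change_ugen /hhat_map /= rmorph0. Qed.

Lemma base_change_uprod w : base_change phi (uprod kappa B w) =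
  uprod (phi kappa) (map_mx phi B) [seq hhat_map phi x | x <- w].
Proof.
rewrite [LHS](env_morph_prod T_pi) /uprod big_map.
by apply: eq_bigr => x _; apply: base_change_ugen.
Qed.

Lemma pbw_lt_base_change j (u : U) : pbw_lt j u -> pbw_lt j (base_change phi u).
Proof.
move=> [s /allP hs ->]; rewrite (env_morph_sum T_pi) big_seq.
apply: pbw_lt_sum => t /hs tj; rewrite (env_morphZ T_pi) -/(base_change _ _).
rewrite base_change_uprod; apply/pbw_ltZ/pbw_lt_uprod.
by rewrite size_map.
Qed.

Lemma tail_base_change m (u : U) : tail_ideal m u -> tail_ideal m (base_change phi u).
Proof.
move=> /tailP[s hs ->]; rewrite (env_morph_sum T_pi) big_seq.
apply: tail_sum => t ts; rewrite (env_morphM T_pi); apply: tail_mull.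
rewrite -/(base_change _ _) base_change_Ugen; apply: tail_Ugen => c.
by rewrite mxE; apply: vanish_below_map; apply: hs ts c.
Qed.

Lemma map_xt p (x : 'rV['F_p]_n) j : map_mx (laurent_map phi) (xt R x j) = xt A x j.
Proof. by apply/rowP => c; rewrite !mxE laurent_map_lmon rmorph_nat. Qed.

Lemma base_change_pcenter p (x : 'rV['F_p]_n) j :
  base_change phi (pcenter_elt kappa B x j) =
  pcenter_elt (phi kappa) (map_mx phi B) x j.
Proof.
rewrite [LHS](env_morphB T_pi) (env_morphX T_pi) (env_morphZ T_pi).
by rewrite -!/(base_change _ _) !base_change_Ugen !map_xt rmorphXn.
Qed.

End BaseChange.

(** * The p-central elements: centrality and invariance *)

Section PCenter.
Variables (p : nat) (A : comNzRingType) (n : nat) (kappa : A) (B : 'M[A]_n).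
Hypothesis hp : p \in [pchar A].
Local Notation U := (Ukappa kappa B).
Implicit Types (x : 'rV['F_p]_n).

Let pp : prime p. Proof. exact: pcharf_prime hp. Qed.

Lemma xt_vanish x j m : m%:Z <= j -> vanish_row m (xt A x j).
Proof.
move=> mj c i im; rewrite mxE /=; case: eqP => // ij; lia.
Qed.

(** A generator has a scalar commutator c with X = x t^j, hence commutator p c X^(p-1) = 0 with X^p;
    and x t^(jp) is central since d(t^(jp)) = 0. *)
Lemma pcenter_central x j (u : U) : u * pcenter_elt kappa B x j = pcenter_elt kappa B x j * u.
Proof.
elim/ugen_ind: u => [y|r|u v IHu IHv|u v IHu IHv].
- rewrite /pcenter_elt mulrBr mulrBl -uscaleAr -uscaleAl; congr (_ - _ *: _).
    have comX k : ugen kappa B y * Ugen kappa B (xt A x j) ^+ k =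
        Ugen kappa B (xt A x j) ^+ k * ugen kappa B y +
        ((hbracket kappa B y (xt A x j, 0)).2 *+ k) *: Ugen kappa B (xt A x j) ^+ k.-1.
      elim: k => [|k IH]; first by rewrite !expr0 mulr1 mul1r mulr0n scale0r addr0.
      rewrite exprS mulrA [ugen _ _ _ * _](ucommE kappa B y) mulrDl uscale1M -mulrA IH.
      rewrite mulrDr mulrA addrC -addrA; congr (_ + _).
      rewrite -uscaleAr mulrS scalerDl addrC; congr (_ + _).
      by case: k {IH} => [|k]; rewrite ?mulr0n ?scale0r// -exprS.
    by rewrite comX -mulr_natr (pcharf0 hp) mulr0 scale0r addr0.
  rewrite [LHS](ucommE kappa B y) (_ : (hbracket _ _ _ _).2 = 0) ?scale0r ?add0r//=.
  rewrite lres_lform big1 ?mulr0 ?oppr0// => c _; rewrite big1// => c' _.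
  rewrite !mxE lderiv_lmon -mulrzr intrM -pmulrn (pcharf0 hp) mulr0 mulr0 lmon0.
  by rewrite mulr0 lcoef0 mulr0.
- by rewrite uscale1M uscaleM1.
- by move: (pcenter_elt _ _ _ _) IHu IHv => z IHu IHv; rewrite mulrDl mulrDr IHu IHv.
- by rewrite -mulrA IHv !mulrA IHu.
Qed.

Lemma pcenter_tail x j m : m%:Z <= j -> tail_ideal m (pcenter_elt kappa B x j).
Proof.
move=> mj; apply: tailB.
  apply: tailX (prime_gt0 pp) (tail_Ugen _ _ _); exact: xt_vanish.
apply/tailZ/tail_Ugen/xt_vanish; have := prime_gt0 pp; nia.
Qed.

Lemma pcenter_pbw_lt x j : pbw_lt p.+1 (pcenter_elt kappa B x j).
Proof.
apply: pbw_ltB.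
  have := @pbw_ltX _ _ kappa B 1 _ p (@pbw_lt_ugen _ _ kappa B 2 (xt A x j, 0) isT).
  by rewrite mul1n.
by apply/pbw_ltZ/pbw_lt_ugen; rewrite ltnS prime_gt0.
Qed.

Lemma upchar_expD r (u : U) : (u + r *: (1 : U)) ^+ p = u ^+ p + r ^+ p *: (1 : U).
Proof.
have scX k : (r *: (1 : U)) ^+ k = r ^+ k *: (1 : U).
  by elim: k => [|k IH]; rewrite ?expr0 ?scale1r// !exprS IH uscale1M scalerA.
rewrite exprDn_comm; last by rewrite /GRing.comm uscale1M uscaleM1.
rewrite -(big_mkord xpredT (fun i => u ^+ (p - i) * (r *: (1 : U)) ^+ i *+ 'C(p, i))).
rewrite big_nat_recr//= big_ltn ?prime_gt0// subnn subn0 !expr0 mulr1 mul1r bin0 binn !mulr1n.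
rewrite scX big_nat big1 ?addr0// => i ip; rewrite umulrn.
suff /dvdnP[q ->] : (p %| 'C(p, i))%N by rewrite natrM (pcharf0 hp) mulr0 scale0r.
by rewrite prime_dvd_bin.
Qed.

Lemma xt_pchar (x : 'rV['F_p]_n) c : ((x 0 c : nat)%:R : A) ^+ p = (x 0 c : nat)%:R.
Proof. by rewrite -(pFrobenius_autE hp) pFrobenius_aut_nat. Qed.

Lemma pcenter_LH_act (g : torus n (laurent A)) x j :
  (forall c d, B c d ^+ p = B c d) ->
  LH_act g (pcenter_elt kappa B x j) = pcenter_elt kappa B x j.
Proof.
move=> hB; have T_pi := @LH_act_pi A n kappa B g.
rewrite [LHS](env_morphB T_pi) (env_morphX T_pi) (env_morphZ T_pi) -!/(LH_act _ _).
rewrite !LH_act_Ugen upchar_expD /= scalerDr scalerA opprD addrACA.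
rewrite /pcenter_elt -[RHS]addr0; congr (_ + _); apply/eqP; rewrite subr_eq0; apply/eqP.
congr (_ *: _); rewrite mulrA -exprSr prednK ?prime_gt0// exprMn; congr (_ * _).
rewrite !lres_lform -(pFrobenius_autE hp) rmorph_sum; apply: eq_bigr => c _.
rewrite rmorph_sum; apply: eq_bigr => d _; rewrite [LHS](pFrobenius_autE hp) exprMn hB.
(* The residue against t^j reads the coefficient of dlog at -j - 1, that against t^(jp) the one at p
   (-j) - 1: the Cartier relation is used at k = -j. *)
have wE k : dlog g 0 c (p%:Z * k - 1) = dlog g 0 c (k - 1) ^+ p.
  by rewrite mxE; apply: dlog_cartier (gmulV (g c)).
move: (dlog g 0 c) wE => w wE; congr (_ * _).
rewrite [xt A x j 0 d]mxE [xt A x (j * _) 0 d]mxE ![w * _]mulrC !coef_lmonM exprMn xt_pchar.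
rewrite (_ : -1 - j = - j - 1); last by rewrite addrC.
rewrite -wE; congr (_ * w _); lia.
Qed.

End PCenter.

(** * The Fock representation *)

Section Monomials.
Variable n : nat.
Local Notation V := ('I_n * int)%type.
Implicit Types (M N : monomial n) (s r : V).

Definition madd M s : monomial n := [fsfun M with s |-> (M s).+1].
Definition msub M s : monomial n := [fsfun M with s |-> (M s).-1].
Definition mono0 : monomial n := [fsfun].

Lemma maddE M s r : madd M s r = (M r + (r == s))%N.
Proof. by rewrite fsfun_withE; case: eqP => [->|_]; rewrite ?addn1 ?addn0. Qed.

Lemma msubE M s r : msub M s r = (M r - (r == s))%N.
Proof. by rewrite fsfun_withE; case: eqP => [->|_]; rewrite ?subn1 ?subn0. Qed.

Lemma mono0E s : mono0 s = 0%N.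
Proof. exact: fsfun0E. Qed.

Lemma mono_eq M N : M =1 N -> M = N.
Proof. by move/fsfunP. Qed.

Lemma maddC M s r : madd (madd M s) r = madd (madd M r) s.
Proof. by apply: mono_eq => t; rewrite !maddE addnAC. Qed.

Lemma msubC M s r : msub (msub M s) r = msub (msub M r) s.
Proof. by apply: mono_eq => t; rewrite !msubE subnAC. Qed.

Lemma maddK M s : msub (madd M s) s = M.
Proof. by apply: mono_eq => t; rewrite msubE maddE addnK. Qed.

Lemma msubK M s : M s != 0%N -> madd (msub M s) s = M.
Proof.
move=> Ms; apply: mono_eq => t; rewrite maddE msubE subnK//.
by case: eqP => // ->; rewrite lt0n.
Qed.

Lemma madd_msub M s r : M r != 0%N -> msub (madd M s) r = madd (msub M r) s.
Proof.
move=> Mr; apply: mono_eq => t; rewrite maddE !msubE maddE addnBAC//.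
by case: eqP => // ->; rewrite lt0n.
Qed.

Lemma sum_finsupp (A : nmodType) M (E : {fset V}) (F : V -> A) :
    (finsupp M `<=` E)%fset -> (forall s, M s = 0%N -> F s = 0) ->
  \sum_(s <- finsupp M) F s = \sum_(s <- E) F s.
Proof.
move=> ME F0; apply: big_fset_incl => // s _ /=.
by rewrite memNfinsupp => /eqP /F0.
Qed.

Lemma mdegreeE M (E : {fset V}) : (finsupp M `<=` E)%fset ->
  mdegree M = (\sum_(s <- E) M s)%N.
Proof.
move=> ME; rewrite /mdegree; apply: big_fset_incl => // s _ /=.
by rewrite memNfinsupp => /eqP.
Qed.

Lemma finsupp_madd M s : (finsupp (madd M s) `<=` s |` finsupp M)%fset.
Proof.
apply/fsubsetP => r; rewrite in_fset1U !mem_finsupp maddE.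
by have [->|rs] := eqVneq r s; rewrite ?addn0.
Qed.

Lemma finsupp_msub M s : (finsupp (msub M s) `<=` finsupp M)%fset.
Proof.
apply/fsubsetP => r; rewrite !mem_finsupp msubE.
by apply: contra_neq => ->; rewrite sub0n.
Qed.

Lemma mdegree_madd M s : mdegree (madd M s) = (mdegree M).+1.
Proof.
rewrite (mdegreeE (finsupp_madd M s)) (@mdegreeE M (s |` finsupp M)%fset); last first.
  exact: fsubsetUr.
rewrite (eq_bigr (fun r => M r + (r == s))%N) => [|r _]; last by rewrite maddE.
rewrite big_split /= -addn1; congr (_ + _)%N.
rewrite (big_fsetD1 s)/= ?fset1U1// eqxx big_seq_cond big1 ?addn0// => r.
by rewrite andbT in_fsetD1 => /andP[/negPf -> _].
Qed.

Lemma mdegree_msub M s : M s != 0%N -> (mdegree (msub M s)).+1 = mdegree M.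
Proof. by move=> Ms; rewrite -(mdegree_madd _ s) msubK. Qed.

Lemma mdegree_mono0 : mdegree mono0 = 0%N.
Proof. by rewrite /mdegree finsupp0 big_seq_fset0. Qed.

(** These are the monomials that survive modulo U t^m h[[t]]. *)
Definition below (m : nat) M := forall s, M s != 0%N -> s.2 < m%:Z.

Lemma below_ex M : exists m, below m M.
Proof.
exists (\max_(s <- finsupp M) (absz s.2).+1) => s.
rewrite -mem_finsupp => sM.
apply: (@lt_le_trans _ _ (absz s.2).+1%:Z); first by lia.
rewrite lez_nat; exact: (@leq_bigmax_seq _ (enum_fset (finsupp M)) xpredT (fun s : V => (absz s.2).+1)).
Qed.

Lemma below_le m k M : (m <= k)%N -> below m M -> below k M.
Proof. by move=> mk hM s /hM; lia. Qed.

End Monomials.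

Section FiniteSums.
Variables (A : nmodType) (n : nat).
Local Notation V := ('I_n * int)%type.
Implicit Types F : V -> A.

Definition fsum F : A := \sum_(s \in [set: V]%classic) F s.

Lemma fsum_seq (E : seq V) F :
  uniq E -> (forall s, s \notin E -> F s = 0) -> fsum F = \sum_(s <- E) F s.
Proof.
move=> uE F0; rewrite /fsum (fsbigE E) => [||//|s _ sE]; last exact: F0.
- by apply: eq_bigl => s; rewrite in_setT.
- by [].
Qed.

Lemma fsumE (E : {fset V}) F :
  (forall s, s \notin E -> F s = 0) -> fsum F = \sum_(s <- E) F s.
Proof. by apply: fsum_seq; apply: fset_uniq. Qed.

Lemma fsum_window (lo : int) (N : nat) F :
    (forall s, ~~ (lo <= s.2 < lo + N%:Z) -> F s = 0) ->
  fsum F = \sum_(k < N) \sum_a F (a, lo + k%:Z).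
Proof.
move=> F0; rewrite (fsum_seq (E := [seq (a, lo + k%:Z) | a <- index_enum 'I_n, k <- iota 0 N])).
- rewrite big_allpairs_dep exchange_big /=.
  by rewrite -[N in iota 0 N]subn0 -/(index_iota 0 N) big_mkord.
- by rewrite allpairs_uniq ?iota_uniq ?index_enum_uniq// => -[a k] [a' k'] _ _ [-> /addrI[->]].
move=> [a i] /allpairsP sE; apply: F0; apply/negP => /= /andP[loi iN].
have [k ik] := le_natP loi; apply: sE; exists (a, k) => /=.
by split; rewrite ?mem_index_enum ?ik// mem_iota; lia.
Qed.

End FiniteSums.

Section Operators.
Variables (A : comNzRingType) (n : nat).
Local Notation V := ('I_n * int)%type.
Local Notation Phi := (monomial n -> A).
Implicit Types (q v : V -> A) (phi psi : Phi) (M : monomial n).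

Definition fin_supp q := exists E : {fset V}, forall s, s \notin E -> q s = 0.

(* Transposes of the multiplication by sum_s q_s X_s and of the derivation
   sum_s v_s d/dX_s on polynomials in the variables X_s. *)
Definition up q phi : Phi := fun M => fsum (fun s => q s * phi (madd M s)).
Definition down v phi : Phi :=
  fun M => \sum_(s <- finsupp M) v s * (M s)%:R * phi (msub M s).

Lemma upE q (E : {fset V}) phi M : (forall s, s \notin E -> q s = 0) ->
  up q phi M = \sum_(s <- E) q s * phi (madd M s).
Proof. by move=> qE; apply: fsumE => s /qE ->; rewrite mul0r. Qed.

Lemma downE v (E : {fset V}) phi M : (finsupp M `<=` E)%fset ->
  down v phi M = \sum_(s <- E) v s * (M s)%:R * phi (msub M s).
Proof. by move=> ME; apply: sum_finsupp => // s ->; rewrite mulr0 mul0r. Qed.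

Lemma up_lin q r phi psi : fin_supp q ->
  up q (fun M => r * phi M + psi M) = fun M => r * up q phi M + up q psi M.
Proof.
move=> [E qE]; apply: funext => M; rewrite !(upE _ _ qE) mulr_sumr -big_split.
by apply: eq_bigr => s _; rewrite mulrDr mulrCA.
Qed.

Lemma down_lin v r phi psi :
  down v (fun M => r * phi M + psi M) = fun M => r * down v phi M + down v psi M.
Proof.
apply: funext => M; rewrite /down mulr_sumr -big_split.
by apply: eq_bigr => s _; rewrite mulrDr mulrCA.
Qed.

Lemma up_linl q q' r phi M : fin_supp q -> fin_supp q' ->
  up (fun s => r * q s + q' s) phi M = r * up q phi M + up q' phi M.
Proof.
move=> [E qE] [E' qE'].
have qU s : s \notin (E `|` E')%fset -> q s = 0.
  by rewrite in_fsetU negb_or => /andP[/qE].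
have qU' s : s \notin (E `|` E')%fset -> q' s = 0.
  by rewrite in_fsetU negb_or => /andP[_ /qE'].
rewrite (@upE _ (E `|` E')%fset) => [|s sE]; last by rewrite qU ?qU' ?mulr0 ?addr0.
rewrite (upE _ _ qU) (upE _ _ qU') mulr_sumr -big_split.
by apply: eq_bigr => s _; rewrite mulrDl mulrA.
Qed.

Lemma down_linl v v' r phi M :
  down (fun s => r * v s + v' s) phi M = r * down v phi M + down v' phi M.
Proof.
rewrite /down mulr_sumr -big_split.
by apply: eq_bigr => s _; rewrite !mulrDl !mulrA.
Qed.

Lemma up_comm q q' phi : fin_supp q -> fin_supp q' ->
  up q (up q' phi) = up q' (up q phi).
Proof.
move=> [E qE] [E' qE']; apply: funext => M; rewrite (upE _ _ qE) (upE _ _ qE').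
under eq_bigr do rewrite (upE _ _ qE') mulr_sumr.
under [RHS]eq_bigr do rewrite (upE _ _ qE) mulr_sumr.
rewrite exchange_big; apply: eq_bigr => s _; apply: eq_bigr => r _.
by rewrite mulrCA maddC.
Qed.

Lemma down_comm v v' phi : down v (down v' phi) = down v' (down v phi).
Proof.
apply: funext => M; rewrite {1}/down [RHS]/down.
under eq_bigr => s _ do rewrite (downE _ _ (finsupp_msub M s)) mulr_sumr.
under [RHS]eq_bigr => s _ do rewrite (downE _ _ (finsupp_msub M s)) mulr_sumr.
rewrite exchange_big; apply: eq_bigr => s _; apply: eq_bigr => r _.
have e : (M r)%:R * (msub M r s)%:R = (M s)%:R * (msub M s r)%:R :> A.
  rewrite -!natrM !msubE; have [->//|rs] := eqVneq r s.
  by rewrite !subn0 mulnC.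
rewrite [msub (msub M s) r]msubC.
transitivity (v r * v' s * phi (msub (msub M r) s) * ((M r)%:R * (msub M r s)%:R)); first by ring.
by rewrite e; ring.
Qed.

(** The transposed canonical commutation relation. The extra term comes from the variable that is
    first added and then removed: its exponent has grown by one, while all other exponents are
    unaffected. *)
Lemma up_down q v phi : fin_supp q ->
  up q (down v phi) = fun M => down v (up q phi) M + fsum (fun s => q s * v s) * phi M.
Proof.
move=> [E0 qE0]; apply: funext => M; pose E := (E0 `|` finsupp M)%fset.
have qE s : s \notin E -> q s = 0 by rewrite in_fsetU negb_or => /andP[/qE0].
have ME : (finsupp M `<=` E)%fset by apply: fsubsetUr.
rewrite (upE _ _ qE) (downE _ _ ME) (@fsumE _ _ E) => [|s /qE ->]; last by rewrite mul0r.
rewrite mulr_suml; under [X in _ = X + _]eq_bigr do rewrite (upE _ _ qE) mulr_sumr.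
rewrite [X in _ = X + _]exchange_big -big_split /=; apply: eq_big_seq => s sE.
have MsE : (finsupp (madd M s) `<=` E)%fset.
  by apply: fsubset_trans (finsupp_madd M s) _; rewrite fsubUset fsub1set sE.
rewrite (downE _ _ MsE) mulr_sumr.
rewrite (eq_bigr (fun r => v r * (M r)%:R * (q s * phi (madd (msub M r) s)) +
    (if r == s then q s * v s * phi M else 0))) => [|r _].
  rewrite big_split; congr (_ + _); rewrite (big_fsetD1 s)//= eqxx big_seq_cond big1 ?addr0// => r.
  by rewrite andbT in_fsetD1 => /andP[/negPf -> _].
rewrite maddE natrD; have [->|rs] := eqVneq r s.
  have -> : (true : nat)%:R = 1 :> A by [].
  rewrite maddK (_ : q s * _ = q s * (v s * (M s)%:R * phi M) + q s * v s * phi M); last by ring.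
  congr (_ + _).
  have [->|Ms] := eqVneq (M s) 0%N; first by rewrite !(mulr0, mul0r).
  by rewrite msubK//; ring.
rewrite addr0 addr0; have [->|Mr] := eqVneq (M r) 0%N; first by rewrite !(mulr0, mul0r).
by rewrite madd_msub// mulrCA.
Qed.

Definition heis r q v phi : Phi := fun M => r * phi M + up q phi M + down v phi M.

Lemma up_heis q r q' v phi M : fin_supp q ->
  up q (heis r q' v phi) M =
  r * up q phi M + (up q (up q' phi) M + up q (down v phi) M).
Proof.
move=> hq; have -> : heis r q' v phi = fun M => r * phi M +
    (1 * up q' phi M + down v phi M).
  by apply: funext => N; rewrite mul1r addrA.
by rewrite !up_lin// mul1r.
Qed.

Lemma down_heis v r q v' phi M : down v (heis r q v' phi) M =
  r * down v phi M + (down v (up q phi) M + down v (down v' phi) M).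
Proof.
have -> : heis r q v' phi = fun M => r * phi M +
    (1 * up q phi M + down v' phi M).
  by apply: funext => N; rewrite mul1r addrA.
by rewrite !down_lin mul1r.
Qed.

Lemma heis_comm r q v r' q' v' phi M : fin_supp q -> fin_supp q' ->
  heis r' q' v' (heis r q v phi) M = heis r q v (heis r' q' v' phi) M +
    (fsum (fun s => q' s * v s) - fsum (fun s => q s * v' s)) * phi M.
Proof.
move=> hq hq'; rewrite {1}/heis [X in _ = X + _]/heis !up_heis// !down_heis.
rewrite (up_down _ _ hq) (up_down _ _ hq') (up_comm _ hq hq') (down_comm v).
rewrite /heis.
ring.
Qed.

Lemma down_heis_comm v r q v' phi : fin_supp q ->
  heis r q v' (down v phi) =
  fun M => down v (heis r q v' phi) M + fsum (fun s => q s * v s) * phi M.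
Proof.
move=> hq; apply: funext => M; rewrite down_heis /heis (up_down _ _ hq) (down_comm v').
ring.
Qed.

(** The filtration dual to the degree: such a functional kills polynomials of degree less than d,
    and therefore does not see [pbw_lt d] ([symb_lt]). *)
Definition deg_ge d phi := forall M, (mdegree M < d)%N -> phi M = 0.

Lemma deg_ge_up q d phi : deg_ge d.+1 phi -> deg_ge d (up q phi).
Proof.
move=> hphi M Md; apply: fsbig1 => s _.
by rewrite hphi ?mulr0// mdegree_madd ltnS.
Qed.

Lemma deg_ge_down v d phi : deg_ge d phi -> deg_ge d.+1 (down v phi).
Proof.
move=> hphi M Md; rewrite /down big_seq big1// => s.
by rewrite mem_finsupp => Ms; rewrite hphi ?mulr0// -ltnS mdegree_msub.
Qed.

Lemma deg_ge_le d e phi : (d <= e)%N -> deg_ge e phi -> deg_ge d phi.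
Proof. by move=> de he M Md; apply/he/(leq_trans Md). Qed.

Definition bounded m phi := forall M, ~ below m M -> phi M = 0.

Definition delta N : Phi := fun M => if M == N then 1 else 0.

Lemma deg_ge_delta N : deg_ge (mdegree N) (delta N).
Proof. by move=> M; rewrite /delta; case: eqP => // ->; rewrite ltnn. Qed.

Lemma bounded_delta m N : below m N -> bounded m (delta N).
Proof. by move=> mN M; rewrite /delta; case: eqP => // ->. Qed.

End Operators.

Section Fock.
Variables (A : comNzRingType) (n : nat) (kappa : A) (B b Q : 'M[A]_n).
Hypotheses (hB : B^T = B) (hQ : Q *m b = 1%:M).
Variable m : nat.
Local Notation U := (Ukappa kappa B).
Local Notation V := ('I_n * int)%type.
Local Notation Phi := (monomial n -> A).
Implicit Types (x y : hhat A n) (s : V) (phi psi : Phi) (w : 'rV[laurent A]_n).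

(* The coordinates of h((t)) in the topological basis b_a t^i, and the truncated ones. *)
Definition crd w s : A := \sum_c w 0 c s.2 * Q c s.1.
Definition crd_lt w s : A := if s.2 < m%:Z then crd w s else 0.

(* The values kappa Res beta(w dt, b_a t^i). *)
Definition dform w s : A := kappa * \sum_c w 0 c (-1 - s.2) * (B *m b^T) c s.1.

(** A polarization: among t^i and t^(-i) only the one of positive exponent acts by a derivative, in
    the variables of index -i, so that each commutator is counted once. Index 0 would contribute
    nothing, as t^0 has zero derivative. *)
Definition dform_neg w s : A :=
  if s.2 < 0 then dform (map_mx (@lderiv A) w) s else 0.

(** Only the multiplication part is truncated at m: t^m h[[t]] then acts by pure derivatives and
    annihilates the polynomial 1. *)
Definition fock x : Phi -> Phi := heis x.2 (crd_lt x.1) (dform_neg x.1).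

Lemma row_vanish w : exists K : nat, forall c, vanish_below (- K%:Z) (w 0 c).
Proof.
have /choice[N hN] c := laurentP (w 0 c).
exists (\max_c `|N c|%N) => c; apply: vanish_le (hN c).
by have := leq_bigmax (F := fun c => `|N c|%N) c; lia.
Qed.

Lemma crd_lt_fin w : fin_supp (crd_lt w).
Proof.
have [K hK] := row_vanish w.
pose E := [seq (a, - K%:Z + k%:Z) | a <- index_enum 'I_n, k <- iota 0 (K + m)].
exists [fset s in E]%fset.
move=> [a i]; rewrite in_fset /= => /negP sE; rewrite /crd_lt /crd /=.
case: ltP => // im; apply: big1 => c _; have [iK|Ki] := ltP i (- K%:Z).
  by rewrite hK ?mul0r.
have [k ik] := le_natP Ki; case: sE; apply/allpairsP; exists (a, k) => /=.
by split; rewrite ?mem_index_enum ?ik// mem_iota; lia.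
Qed.

Lemma crd_lin r w w' s : crd (lmon r 0 *: w + w') s = r * crd w s + crd w' s.
Proof.
rewrite /crd mulr_sumr -big_split; apply: eq_bigr => c _.
by rewrite !mxE lcoefD coef_lmonM subr0 mulrDl mulrA.
Qed.

Lemma crd_lt_lin r w w' s : crd_lt (lmon r 0 *: w + w') s = r * crd_lt w s + crd_lt w' s.
Proof. by rewrite /crd_lt crd_lin; case: ifP; rewrite ?mulr0 ?addr0. Qed.

Lemma dform_lin r w w' s : dform (lmon r 0 *: w + w') s = r * dform w s + dform w' s.
Proof.
rewrite /dform [r * _]mulrCA -mulrDr; congr (_ * _); rewrite mulr_sumr -big_split; apply: eq_bigr => c _.
by rewrite !(mxE _ _ 0 c) lcoefD coef_lmonM subr0 mulrDl mulrA.
Qed.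

Lemma dform_neg_lin r w w' s :
  dform_neg (lmon r 0 *: w + w') s = r * dform_neg w s + dform_neg w' s.
Proof.
rewrite /dform_neg; case: ifP => _; last by rewrite mulr0 addr0.
rewrite -dform_lin; congr dform; apply/rowP => c.
by rewrite !mxE lderivD lderivM lderiv_lmon mulr0z lmon0 mul0r add0r.
Qed.

Lemma fock_linl r x y phi M :
  fock (r *: x + y) phi M = r * fock x phi M + fock y phi M.
Proof.
rewrite /fock /heis.
have -> : crd_lt (r *: x + y).1 = fun s => r * crd_lt x.1 s + crd_lt y.1 s.
  by apply: funext => s; rewrite -crd_lt_lin.
have -> : dform_neg (r *: x + y).1 = fun s => r * dform_neg x.1 s + dform_neg y.1 s.
  by apply: funext => s; rewrite -dform_neg_lin.
rewrite up_linl ?down_linl; [|exact: crd_lt_fin..].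
rewrite -[(r *: x + y).2]/(r * x.2 + y.2); ring.
Qed.

Lemma fock_lin x r phi psi :
  fock x (fun M => r * phi M + psi M) = fun M => r * fock x phi M + fock x psi M.
Proof.
apply: funext => M; rewrite /fock /heis up_lin ?down_lin; last exact: crd_lt_fin.
ring.
Qed.

Lemma fock_scalar r phi : fock (0, r) phi = fun M => r * phi M.
Proof.
have c0 s : crd_lt 0 s = 0.
  by rewrite /crd_lt /crd big1 ?if_same// => c _; rewrite mxE mul0r.
have d0 s : dform_neg 0 s = 0.
  by rewrite /dform_neg /dform big1 ?mulr0 ?if_same// => c _; rewrite !mxE lderiv0 mul0r.
apply: funext => M; rewrite /fock /heis /= [up _ _ _]fsbig1 => [|s _]; last by rewrite c0 mul0r.
by rewrite /down big1 ?addr0// => s _; rewrite d0 !mul0r.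
Qed.

Definition pairing w w' (i : int) : A :=
  kappa * \sum_c \sum_c' B c c' * (w 0 c (-1 - i) * w' 0 c' i).

(** Coordinates in the basis b are contracted with the values of the form on b; the basis cancels
    because Q b = 1. *)
Lemma sum_crd_dform w w' i :
  \sum_a crd w' (a, i) * dform w (a, i) = pairing w w' i.
Proof.
rewrite /pairing; transitivity (kappa * \sum_a (\sum_c' w' 0 c' i * Q c' a) *
    (\sum_c w 0 c (-1 - i) * (B *m b^T) c a)).
  by rewrite mulr_sumr; apply: eq_bigr => a _; rewrite mulrCA.
congr (_ * _).
have e c c' : B c c' = \sum_a Q c' a * (B *m b^T) c a.
  transitivity ((B *m b^T *m Q^T) c c').
    by rewrite -mulmxA -trmx_mul hQ trmx1 mulmx1.
  by rewrite mxE; apply: eq_bigr => a _; rewrite !mxE mulrC.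
under eq_bigr do rewrite big_distrlr /=.
rewrite exchange_big [RHS]exchange_big /=; apply: eq_bigr => c' _.
rewrite exchange_big /=; apply: eq_bigr => c _.
rewrite e mulr_suml; apply: eq_bigr => a _; ring.
Qed.

Lemma lform_sym w w' : lform B w w' = lform B w' w.
Proof.
have e : (w *m map_mx (fun r => lmon r 0) B *m w'^T)^T =
    w' *m map_mx (fun r => lmon r 0) B *m w^T.
  by rewrite !trmx_mul trmxK map_trmx hB mulmxA.
by rewrite /lform -e [RHS]mxE.
Qed.

Lemma lres_pairing w w' (lo : int) (N : nat) :
    (forall c, vanish_below lo (w' 0 c)) -> (forall c, vanish_below (- (lo + N%:Z)) (w 0 c)) ->
  kappa * lres (lform B w w') = \sum_(k < N) pairing w w' (lo + k%:Z).
Proof.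
move=> hw' hw; rewrite -mulr_sumr lres_lform; congr (_ * _).
rewrite [RHS]exchange_big; apply: eq_bigr => c _; rewrite [RHS]exchange_big; apply: eq_bigr => c' _.
rewrite -mulr_sumr; congr (_ * _).
rewrite mulrC [LHS](conv_window (N := N) (hw' c') (hw c)); last by lia.
by apply: eq_bigr => k _; rewrite mulrC.
Qed.

(** The polarization keeps only negative indices in both sums. Integration by parts, which exchanges
    i and -i ([flip]), turns one of them into the positive half of the residue. *)
Lemma fock_comm_scalar x y :
  fsum (fun s => crd_lt y.1 s * dform_neg x.1 s) -
  fsum (fun s => crd_lt x.1 s * dform_neg y.1 s) = (hbracket kappa B x y).2.
Proof.
have [K1 hK1] := row_vanish x.1; have [K2 hK2] := row_vanish y.1.
pose K := maxn K1 K2.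
have hx c : vanish_below (- K%:Z) (x.1 0 c) by apply: vanish_le (hK1 c); rewrite /K; lia.
have hy c : vanish_below (- K%:Z) (y.1 0 c) by apply: vanish_le (hK2 c); rewrite /K; lia.
have win w w' : (forall c, vanish_below (- K%:Z) (w' 0 c)) ->
    fsum (fun s => crd_lt w' s * dform_neg w s) =
    \sum_(k < K) pairing (map_mx (@lderiv A) w) w' (- K%:Z + k%:Z).
  move=> hw'; rewrite (@fsum_window _ _ (- K%:Z) K) => [|s].
    apply: eq_bigr => k _; rewrite -sum_crd_dform; apply: eq_bigr => a _.
    by rewrite /crd_lt /dform_neg /= !ifT//; have := ltn_ord k; lia.
  rewrite negb_and -ltNge -leNgt addNr /dform_neg => /orP[sK|s0].
    rewrite (_ : crd_lt w' s = 0) ?mul0r// /crd_lt /crd.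
    by case: ifP => // _; apply: big1 => c _; rewrite hw' ?mul0r.
  by rewrite ltNge s0 /= mulr0.
rewrite !win//.
have flip w w' i : pairing (map_mx (@lderiv A) w) w' i =
    - pairing (map_mx (@lderiv A) w') w (- i).
  rewrite /pairing -mulrN -sumrN exchange_big; congr (_ * _).
  apply: eq_bigr => c _; rewrite -sumrN; apply: eq_bigr => c' _.
  rewrite -[in LHS]hB !mxE /=.
  rewrite (_ : -1 - i + 1 = - i); last by lia.
  rewrite (_ : -1 - - i + 1 = i); last by lia.
  by rewrite mulrNz; ring.
have -> : (hbracket kappa B x y).2 =
    - (kappa * lres (lform B (map_mx (@lderiv A) y.1) x.1)).
  by rewrite /= lform_sym.
(* The indices run from -K to K: the negative ones form one of the sums, index 0 drops out, and the
   positive ones give the other sum through [flip]. *)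
rewrite (@lres_pairing _ _ (- K%:Z) (K + K.+1))//; last first.
  move=> c i iK; rewrite mxE /= hy ?mul0rz//; lia.
rewrite big_split_ord /= big_ord_recl opprD addrC; congr (_ + _).
rewrite [X in - (X + _)](_ : _ = 0) ?add0r; last first.
  rewrite /= addn0 addNr /pairing big1 ?mulr0// => c _; rewrite big1// => c' _.
  by rewrite mxE /= mulr0z mul0r mulr0.
rewrite (reindex_inj rev_ord_inj) -sumrN; apply: eq_bigr => k _ /=.
rewrite flip; congr (- pairing _ _ _); rewrite /bump /=; have := ltn_ord k; lia.
Qed.

End Fock.

Section FockAction.
Variables (A : comNzRingType) (n : nat) (kappa : A) (B b Q : 'M[A]_n).
Hypotheses (hB : B^T = B) (hQ : Q *m b = 1%:M).
Variable m : nat.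
Local Notation U := (Ukappa kappa B).
Local Notation V := ('I_n * int)%type.
Local Notation Phi := (monomial n -> A).
Local Notation FK := (fock kappa B b Q m).
Local Notation crd_lt := (crd_lt Q m).
Local Notation dform_neg := (dform_neg kappa B b).
Implicit Types (x y : hhat A n) (s : V) (phi psi : Phi) (u v : U).

Lemma fock_bracket x y phi M :
  FK (hbracket kappa B x y) phi M + FK x (FK y phi) M = FK y (FK x phi) M.
Proof.
rewrite [hbracket kappa B x y](_ : _ = (0, (hbracket kappa B x y).2))//.
rewrite fock_scalar -(fock_comm_scalar kappa hB hQ m x y) [LHS]addrC.
rewrite [RHS]heis_comm; [by [] | exact: crd_lt_fin..].
Qed.

(* A right action: the first factor of a product acts first. *)
Fixpoint fock_expr (e : expr A (hhat A n)) : Phi -> Phi :=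
  match e with
  | Gen x => FK x
  | Cst r => fun phi M => r * phi M
  | Add u v => fun phi M => fock_expr u phi M + fock_expr v phi M
  | Mul u v => fun phi => fock_expr v (fock_expr u phi)
  end.

Lemma fock_expr_lin e r phi psi :
  fock_expr e (fun M => r * phi M + psi M) =
  fun M => r * fock_expr e phi M + fock_expr e psi M.
Proof.
elim: e phi psi => [x|c|u IHu v IHv|u IHu v IHv] phi psi /=.
- exact: fock_lin.
- by apply: funext => M; rewrite mulrDr mulrCA.
- by apply: funext => M; rewrite IHu IHv; ring.
- by rewrite IHu IHv.
Qed.

Lemma fock_exprD e phi psi : fock_expr e (fun M => phi M + psi M) =
  fun M => fock_expr e phi M + fock_expr e psi M.
Proof.
have := fock_expr_lin e 1 phi psi.
have -> : (fun M => 1 * phi M + psi M) = (fun M => phi M + psi M).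
  by apply: funext => M; rewrite mul1r.
by move=> ->; apply: funext => M; rewrite mul1r.
Qed.

Lemma fock_expr0 e : fock_expr e (fun=> 0) = fun=> 0.
Proof.
have := fock_expr_lin e (-1) (fun=> 0) (fun=> 0).
have -> : (fun M : monomial n => -1 * 0 + 0) = (fun=> 0 : A).
  by apply: funext => M; rewrite mulr0 addr0.
by move=> ->; apply: funext => M; rewrite mulN1r addNr.
Qed.

Lemma fock_exprZ e r phi : fock_expr e (fun M => r * phi M) = fun M => r * fock_expr e phi M.
Proof.
have := fock_expr_lin e r phi (fun=> 0); rewrite fock_expr0.
have -> : (fun M => r * phi M + 0) = (fun M => r * phi M).
  by apply: funext => M; rewrite addr0.
by move=> ->; apply: funext => M; rewrite addr0.
Qed.

Lemma fock_expr_rel (u v : expr A (hhat A n)) : expr_rel (hbracket kappa B) (hcentral A n) u v ->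
  fock_expr u = fock_expr v.
Proof.
elim=> //= {u v}.
- by move=> u v w _ -> _ ->.
- by move=> u u' v v' _ -> _ ->.
- by move=> u u' v v' _ -> _ ->.
- by move=> u v w; apply: funext => phi; apply: funext => M; rewrite addrA.
- by move=> u v; apply: funext => phi; apply: funext => M; rewrite addrC.
- by move=> u; apply: funext => phi; apply: funext => M; rewrite mul0r add0r.
- move=> u; apply: funext => phi; apply: funext => M.
  by rewrite fock_exprZ mul0r mulN1r addNr.
- by move=> u; apply: funext => phi; rewrite fock_exprZ; apply: funext => M; rewrite mul1r.
- by move=> u v w; apply: funext => phi; rewrite fock_exprD.
- by move=> r s; apply: funext => phi; apply: funext => M; rewrite mulrDl.
- by move=> r s; apply: funext => phi; apply: funext => M; rewrite mulrCA mulrA.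
- by move=> r u; apply: funext => phi; rewrite fock_exprZ.
- move=> x y; apply: funext => phi; apply: funext => M.
  by have := fock_linl kappa B b Q m 1 x y phi M; rewrite scale1r mul1r.
- move=> r x; apply: funext => phi; apply: funext => M.
  have := fock_linl kappa B b Q m r x 0 phi M; rewrite addr0 => ->.
  by rewrite (fock_scalar kappa B b Q m 0 phi) mul0r addr0; exact: (esym (congr1 (fun f => f M) (fock_exprZ (Gen x) r phi))).
- by move=> x y; apply: funext => phi; apply: funext => M; apply: fock_bracket.
- by apply: funext => phi; apply: fock_scalar.
Qed.

Definition act u : Phi -> Phi := fock_expr (env_repr u).

Lemma act_pi e : act (env_pi _ _ e) = fock_expr e.
Proof. exact/fock_expr_rel/env_repr_pi. Qed.

Lemma actD u v phi M : act (u + v) phi M = act u phi M + act v phi M.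
Proof.
elim/env_ind: u => u; elim/env_ind: v => v.
by rewrite [u in act u](_ : _ = env_pi _ _ (Add u v)) ?act_pi// [LHS]env_addE.
Qed.

Lemma actM u v phi : act (u * v) phi = act v (act u phi).
Proof.
elim/env_ind: u => u; elim/env_ind: v => v.
by rewrite [u in act u](_ : _ = env_pi _ _ (Mul u v)) ?act_pi// [LHS]env_mulE.
Qed.

Lemma act_gen x : act (ugen kappa B x) = FK x.
Proof. exact: act_pi. Qed.

Lemma act1 phi : act 1 phi = phi.
Proof. by apply: funext => M; rewrite [act _]act_pi /= mul1r. Qed.

Lemma actZ r u phi M : act (r *: u) phi M = r * act u phi M.
Proof.
elim/env_ind: u => u.
rewrite [u in act u](_ : _ = env_pi _ _ (Mul (Cst r) u)) ?act_pi; last exact: env_mulE.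
by rewrite /= fock_exprZ.
Qed.

(* The coefficients of u.1 in the quotient of U by the left ideal U t^m h[[t]],
   paired with phi. *)
Definition symb u phi : A := act u phi (mono0 n).

Lemma symbD u v phi : symb (u + v) phi = symb u phi + symb v phi.
Proof. exact: actD. Qed.

Lemma symbZ r u phi : symb (r *: u) phi = r * symb u phi.
Proof. exact: actZ. Qed.

Lemma symb0 phi : symb 0 phi = 0.
Proof. by rewrite -(scale0r (0 : U)) symbZ mul0r. Qed.

Lemma symbB u v phi : symb (u - v) phi = symb u phi - symb v phi.
Proof. by rewrite symbD -scaleN1r symbZ mulN1r. Qed.

Lemma symb_sum I (r : seq I) (P : pred I) (F : I -> U) phi :
  symb (\sum_(i <- r | P i) F i) phi = \sum_(i <- r | P i) symb (F i) phi.
Proof. by apply: (big_morph (symb^~ phi)) => [u v|]; [apply: symbD | apply: symb0]. Qed.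

Lemma symb_linr u r phi psi :
  symb u (fun M => r * phi M + psi M) = r * symb u phi + symb u psi.
Proof. by rewrite /symb /act fock_expr_lin. Qed.

Lemma symb_addr u phi psi :
  symb u (fun M => phi M + psi M) = symb u phi + symb u psi.
Proof. by rewrite /symb /act fock_exprD. Qed.

Lemma symb_sumr I (r : seq I) (F : I -> A) (psi : I -> Phi) u :
  symb u (fun M => \sum_(i <- r) F i * psi i M) = \sum_(i <- r) F i * symb u (psi i).
Proof.
elim: r => [|i r IH].
  rewrite big_nil; have -> : (fun M => \sum_(i <- [::]) F i * psi i M) = (fun=> 0).
    by apply: funext => M; rewrite big_nil.
  by rewrite /symb /act fock_expr0.
rewrite big_cons -IH -symb_linr; congr symb; apply: funext => M.
by rewrite big_cons.
Qed.

Lemma symb_gen x u phi : symb (ugen kappa B x * u) phi = symb u (FK x phi).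
Proof. by rewrite /symb actM act_gen. Qed.

Lemma symb1 phi : symb 1 phi = phi (mono0 n).
Proof. by rewrite /symb act1. Qed.

(** The rightmost factor of a product acts last, and its result is evaluated at the empty monomial.
    There [down] has no term, and the truncated coordinates of t^m h[[t]] are zero. *)
Lemma symb_tail u phi : tail_ideal m u -> symb u phi = 0.
Proof.
move=> /tailP[s hs ->]; rewrite symb_sum big_seq big1// => t /hs tm.
rewrite /symb actM act_gen /fock /heis /= mul0r add0r /down finsupp0 big_seq_fset0 addr0.
apply: fsbig1 => s' _; rewrite /crd_lt /crd; case: ifP => [sm|]; last by rewrite mul0r.
by rewrite big1 ?mul0r// => c _; rewrite tm ?mul0r.
Qed.

Lemma deg_ge_fock x d phi : deg_ge d.+1 phi -> deg_ge d (FK x phi).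
Proof.
move=> hphi M Md; have Md' := ltnW Md.
rewrite -[LHS]/(x.2 * phi M + up _ phi M + down _ phi M).
by rewrite (hphi M Md') mulr0 (deg_ge_up _ hphi Md) (deg_ge_down _ (deg_ge_le (leqnSn d) hphi) Md') !addr0.
Qed.

Lemma symb_uprod0 w d phi : (size w < d)%N -> deg_ge d phi ->
  symb (uprod kappa B w) phi = 0.
Proof.
elim: w d phi => [|x w IH] [//|d] phi wd hphi.
  by rewrite uprod_nil symb1 hphi// mdegree_mono0.
by rewrite uprod_cons symb_gen; apply: (IH d) => //; apply: deg_ge_fock.
Qed.

Lemma symb_lt d u phi : pbw_lt d u -> deg_ge d phi -> symb u phi = 0.
Proof.
move=> [s /allP hs ->] hphi; rewrite symb_sum big_seq big1// => t /hs td.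
by rewrite symbZ (symb_uprod0 td)// mulr0.
Qed.

Definition ybase s : 'rV[laurent A]_n := \row_c lmon (b s.1 c) s.2.

Lemma crd_ybase s r : crd Q (ybase s) r = (r == s)%:R.
Proof.
rewrite /crd; under eq_bigr do rewrite mxE /=.
case: r s => [a i] [a' i'] /=; rewrite -pair_eqE /pair_eq /=.
case: eqP => _; last by rewrite andbF big1// => c _; rewrite mul0r.
by rewrite andbT; have := congr1 (fun M : 'M_n => M a' a) (mulmx1C hQ); rewrite !mxE eq_sym => ->.
Qed.

(** The derivative part of the generator pushes phi into degrees that u cannot reach, so only the
    multiplication by X_s remains. *)
Lemma symb_ybase s u d phi : s.2 < m%:Z -> pbw_lt d.+1 u -> deg_ge d.+1 phi ->
  symb (Ugen kappa B (ybase s) * u) phi = symb u (fun M => phi (madd M s)).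
Proof.
move=> sm ud hphi; rewrite symb_gen.
have -> : FK (ybase s, 0) phi =
    fun M => phi (madd M s) + down (dform_neg (ybase s)) phi M.
  apply: funext => M; rewrite /fock /heis /= mul0r add0r; congr (_ + _).
  rewrite (@upE _ _ _ [fset s]%fset) => [|r]; last first.
    by rewrite in_fset1 /crd_lt crd_ybase => /negPf ->; rewrite if_same.
  by rewrite big_seq_fset1 /crd_lt sm crd_ybase eqxx mul1r.
rewrite symb_addr [X in _ + X](symb_lt ud) ?addr0//.
by apply: deg_ge_le (deg_ge_down _ hphi).
Qed.

End FockAction.

Section Level.
Variables (A : comNzRingType) (n : nat) (kappa : A) (B b Q : 'M[A]_n).
Local Notation U := (Ukappa kappa B).
Implicit Types (phi : monomial n -> A).

Lemma not_below_madd m (M : monomial n) s : ~ below m M -> ~ below m (madd M s).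
Proof.
by move=> mM mMs; apply: mM => r Mr; apply: mMs; rewrite maddE addn_eq0 negb_and Mr.
Qed.

Lemma fock_bounded m k x phi : (m <= k)%N -> bounded m phi ->
  fock kappa B b Q k x phi = fock kappa B b Q m x phi /\
  bounded m (fock kappa B b Q m x phi).
Proof.
move=> mk hphi; split.
  apply: funext => M; congr (_ + _ + _); apply: eq_fsbigr => s _; rewrite /crd_lt.
  have [sm|ms] := ltP s.2 m%:Z; first by rewrite ifT// (lt_le_trans sm).
  by rewrite hphi ?mulr0// => /(_ s); rewrite maddE eqxx addn1 => /(_ isT); rewrite ltNge ms.
move=> M mM; rewrite -[LHS]/(x.2 * phi M + up _ phi M + down _ phi M).
rewrite (hphi M mM) mulr0 add0r [up _ _ _]fsbig1 => [|s _].
  rewrite add0r /down big_seq big1// => s _; rewrite /dform_neg.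
  (* A negative index is below every level, so removing such a variable cannot bring a monomial
     below m. *)
  case: ltP => [s0|_]; last by rewrite !mul0r.
  rewrite hphi ?mulr0// => mMs; apply: mM => r Mr.
  have [->|rs] := eqVneq r s; first exact: lt_le_trans s0 _.
  by apply: mMs; rewrite msubE (negPf rs) subn0.
by rewrite hphi ?mulr0//; apply: not_below_madd.
Qed.

(** Going from level m to level k only adds variables of index at least m, which a bounded
    functional ignores; this is what makes coefficients at different levels comparable. *)
Lemma symb_level m k (u : U) phi : (m <= k)%N -> bounded m phi ->
  symb b Q k u phi = symb b Q m u phi.
Proof.
move=> mk hphi; rewrite /symb /act.
suff H e psi : bounded m psi ->
    fock_expr kappa B b Q k e psi = fock_expr kappa B b Q m e psi /\
    bounded m (fock_expr kappa B b Q m e psi).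
  by have [-> _] := H (env_repr u) _ hphi.
elim: e psi => [x|r|e1 IH1 e2 IH2|e1 IH1 e2 IH2] psi hpsi /=.
- exact: fock_bounded.
- by split=> // M /hpsi ->; rewrite mulr0.
- have [e1E e1b] := IH1 _ hpsi; have [e2E e2b] := IH2 _ hpsi.
  by split=> [|M mM]; rewrite ?e1E ?e2E// e1b// e2b// addr0.
have [e1E e1b] := IH1 _ hpsi; have [e2E e2b] := IH2 _ e1b.
by rewrite e1E e2E.
Qed.

End Level.

(** * First-order effect of the loop group on symbols *)

Section FirstOrder.
Variables (A : comNzRingType) (n : nat) (kappa : A) (B b Q : 'M[A]_n).
Hypotheses (hB : B^T = B) (hQ : Q *m b = 1%:M).
Variables (m : nat) (g : torus n (laurent A)) (v : 'I_n * int -> A).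
Hypothesis hv : forall w, kappa * lres (lform B (dlog g) w) =
  fsum (fun s => crd_lt Q m w s * v s).
Local Notation U := (Ukappa kappa B).
Local Notation S := (symb b Q m).
Implicit Types (phi : monomial n -> A).

Let T_pi := @LH_act_pi A n kappa B g.

Lemma LH_act_ugen x : LH_act g (ugen kappa B x) = ugen kappa B x +
  fsum (fun s => crd_lt Q m x.1 s * v s) *: (1 : U).
Proof.
rewrite [LHS](env_morph_gen T_pi) -hv -ugen_scalar -ugenD; congr ugen.
by congr pair; rewrite /= addr0.
Qed.

(** g adds a scalar to each letter. Expanding the product, the words with one letter dropped add up
    to the derivative along v, and words with two or more letters dropped are too short for phi. *)
Lemma symb_LH_act_uprod w d phi : (size w <= d.+1)%N -> deg_ge d phi ->
  S (LH_act g (uprod kappa B w)) phi =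
  S (uprod kappa B w) phi + S (uprod kappa B w) (down v phi).
Proof.
elim: w d phi => [|x w IH] d phi wd hphi.
  rewrite uprod_nil [LH_act _ _](env_morph1 T_pi) !(symb1 kappa hB hQ).
  by rewrite [down _ _ _]big1_seq ?addr0// => s; rewrite finsupp0.
have wd' : (size w <= d.-1.+1)%N by apply: leq_trans (wd : (size w <= d)%N) (leqSpred d).
have hf : deg_ge d.-1 (fock kappa B b Q m x phi).
  by case: d hphi {wd wd'} => [//|d]; apply: deg_ge_fock.
have hphi' := deg_ge_le (leq_pred d) hphi.
rewrite uprod_cons [LH_act _ _](env_morphM T_pi) LH_act_ugen mulrDl uscale1M.
rewrite (symbD hB hQ) (symbZ hB hQ) !(symb_gen hB hQ) -/(LH_act _ _) (IH _ _ wd' hf) (IH _ _ wd' hphi').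
(* This term drops two letters: w has at most d letters, while [down v phi] starts in degree d +
   1. *)
rewrite (symb_uprod0 kappa hB hQ m (wd : (size w < d.+1)%N) (deg_ge_down _ hphi)) addr0 -addrA; congr (_ + _).
rewrite /fock down_heis_comm; last exact: crd_lt_fin.
rewrite addrC -symb_linr; congr symb; apply: funext => M; exact: addrC.
Qed.

Lemma symb_LH_act d (u : U) phi : pbw_lt d.+2 u -> deg_ge d phi ->
  S (LH_act g u) phi = S u phi + S u (down v phi).
Proof.
move=> [s /allP hs ->] hphi; rewrite [LH_act _ _](env_morph_sum T_pi) !(symb_sum hB hQ) -big_split.
rewrite big_seq [RHS]big_seq; apply: eq_bigr => t /hs td.
rewrite (env_morphZ T_pi) !(symbZ hB hQ) -/(LH_act _ _) (symb_LH_act_uprod _ hphi)//.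
by rewrite mulrDr.
Qed.

End FirstOrder.

Section BaseChangeSymbol.
Variables (R A : comNzRingType) (n : nat) (f : {rmorphism R -> A}).
Variables (kappa : R) (B b Q : 'M[R]_n).
Hypotheses (hB : B^T = B) (hQ : Q *m b = 1%:M).
Variable m : nat.
Implicit Types (phi : monomial n -> R).

Lemma rmorph_fsum (F : 'I_n * int -> R) :
  fin_supp F -> f (fsum F) = fsum (f \o F).
Proof.
move=> [E FE]; rewrite (fsumE FE) rmorph_sum (@fsumE _ _ E)// => s /FE /= ->.
exact: rmorph0.
Qed.

Lemma crd_lt_map w s :
  crd_lt (map_mx f Q) m (map_mx (laurent_map f) w) s = f (crd_lt Q m w s).
Proof.
rewrite /crd_lt /crd; case: ifP => _; last by rewrite rmorph0.
by rewrite rmorph_sum; apply: eq_bigr => c _; rewrite rmorphM !mxE.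
Qed.

Lemma dform_neg_map w s :
  dform_neg (f kappa) (map_mx f B) (map_mx f b) (map_mx (laurent_map f) w) s =
  f (dform_neg kappa B b w s).
Proof.
rewrite /dform_neg /dform; case: ifP => _; last by rewrite rmorph0.
rewrite rmorphM rmorph_sum map_trmx -map_mxM; congr (_ * _); apply: eq_bigr => c _.
by rewrite rmorphM [map_mx f _ _ _]mxE !(mxE _ _ 0 c) -laurent_map_lderiv.
Qed.

Lemma fock_map x phi :
  fock (f kappa) (map_mx f B) (map_mx f b) (map_mx f Q) m (hhat_map f x) (f \o phi) =
  f \o fock kappa B b Q m x phi.
Proof.
apply: funext => M /=; rewrite /fock /heis !rmorphD rmorphM; congr (_ + _ + _).
  have [E hE] := crd_lt_fin Q m x.1.
  rewrite /up rmorph_fsum; last by exists E => s /hE ->; rewrite mul0r.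
  by apply: eq_fsbigr => s _; rewrite /= rmorphM crd_lt_map.
rewrite /down rmorph_sum; apply: eq_bigr => s _.
by rewrite !rmorphM rmorph_nat dform_neg_map.
Qed.

Lemma symb_base_change (u : Ukappa kappa B) phi :
  symb (map_mx f b) (map_mx f Q) m (base_change f u) (f \o phi) =
  f (symb b Q m u phi).
Proof.
have hB' : (map_mx f B)^T = map_mx f B by rewrite map_trmx hB.
have hQ' : map_mx f Q *m map_mx f b = 1%:M by rewrite -map_mxM hQ map_mx1.
elim/env_ind: u => e; rewrite base_change_pi /symb !act_pi//.
suff H psi : fock_expr (f kappa) (map_mx f B) (map_mx f b) (map_mx f Q) m
    (expr_map f (hhat_map f) e) (f \o psi) = f \o fock_expr kappa B b Q m e psi.
  by rewrite H.
elim: e psi => [x|r|e1 IH1 e2 IH2|e1 IH1 e2 IH2] psi /=.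
- exact: fock_map.
- by apply: funext => M; rewrite /= rmorphM.
- by apply: funext => M; rewrite /= IH1 IH2 rmorphD.
- by rewrite IH1 IH2.
Qed.

End BaseChangeSymbol.

(** * Leading terms *)

Section Words.
Variable n : nat.
Local Notation V := ('I_n * int)%type.
Implicit Types (M N : monomial n) (s : V) (w : seq V).

Definition mscale k M : monomial n := [fsfun s in finsupp M => (k * M s)%N].

Lemma mscaleE k M s : mscale k M s = (k * M s)%N.
Proof.
rewrite fsfun_fun; case: ifP => // /negbT.
by rewrite memNfinsupp => /eqP ->; rewrite muln0.
Qed.

Definition word M : seq V := flatten [seq nseq (M s) s | s <- finsupp M].

(** For k = 1 this is the monomial of the word; for k = p it is the leading monomial of the
    corresponding product of p-central elements. *)
Definition mono_of k w : monomial n :=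
  foldr (fun s M => iter k (fun N => madd N s) M) (mono0 n) w.

Lemma iter_maddE k M s r : iter k (fun N => madd N s) M r = (M r + k * (r == s))%N.
Proof. by elim: k => [|k IH]; rewrite ?addn0//= maddE IH mulSn addnCA addnC. Qed.

Lemma mono_ofE k w s : mono_of k w s = (k * count_mem s w)%N.
Proof.
elim: w => [|r w IH] /=; first by rewrite mono0E muln0.
by rewrite iter_maddE IH mulnDr addnC eq_sym.
Qed.

Lemma count_word M s : count_mem s (word M) = M s.
Proof.
rewrite /word count_flatten -map_comp.
rewrite (eq_map (g := fun r => (r == s) * M r)%N) => [|r]; last by rewrite /= count_nseq.
rewrite sumnE big_map; have [sM|sM] := boolP (s \in finsupp M).
  rewrite (big_fsetD1 s)//= eqxx mul1n big_seq_cond big1 ?addn0// => r.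
  by rewrite andbT in_fsetD1 => /andP[/negPf -> _].
rewrite big_seq_cond big1 => [|r]; first by move: sM; rewrite memNfinsupp => /eqP.
by rewrite andbT => rM; case: eqP => // rs; rewrite -rs rM in sM.
Qed.

Lemma mem_word M s : s \in word M -> M s != 0%N.
Proof. by rewrite -has_pred1 has_count count_word lt0n. Qed.

Lemma mono_of_word k M : mono_of k (word M) = mscale k M.
Proof. by apply: mono_eq => s; rewrite mono_ofE count_word mscaleE. Qed.

Lemma mdegree_iter k M s : mdegree (iter k (fun N => madd N s) M) = (k + mdegree M)%N.
Proof. by elim: k => //= k IH; rewrite mdegree_madd IH. Qed.

Lemma mdegree_mono_of k w : mdegree (mono_of k w) = (k * size w)%N.
Proof.
elim: w => [|s w IH] /=; first by rewrite mdegree_mono0 muln0.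
by rewrite mdegree_iter IH mulnS.
Qed.

Lemma size_word M : size (word M) = mdegree M.
Proof.
have <- : mono_of 1 (word M) = M by apply: mono_eq => s; rewrite mono_ofE mul1n count_word.
rewrite [in RHS]mdegree_mono_of mul1n; congr (size (word _)).
by apply: mono_eq => s; rewrite mono_ofE mul1n count_word.
Qed.

Lemma mdegree_mscale k M : mdegree (mscale k M) = (k * mdegree M)%N.
Proof. by rewrite -mono_of_word mdegree_mono_of size_word. Qed.

Lemma perm_word w M : mono_of 1 w = M -> perm_eq w (word M).
Proof.
move=> <-; apply/allP => s _ /=; apply/eqP.
by rewrite count_word mono_ofE mul1n.
Qed.

Lemma below_mscale m k M : (0 < k)%N -> below m (mscale k M) <-> below m M.
Proof.
move=> k0; split=> hM s; last by rewrite mscaleE muln_eq0 negb_or => /andP[_ /hM].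
by move=> Ms; apply: hM; rewrite mscaleE muln_eq0 negb_or Ms -lt0n k0.
Qed.

Lemma mscale_inj k M N : (0 < k)%N -> mscale k M = mscale k N -> M = N.
Proof.
move=> k0 e; apply: mono_eq => s; apply/eqP.
by rewrite -(eqn_pmul2l k0) -!mscaleE e.
Qed.

Lemma prod_word (T : pzRingType) (F : V -> T) M :
  \prod_(s <- finsupp M) F s ^+ M s = \prod_(s <- word M) F s.
Proof.
rewrite /word big_flatten big_map; apply: eq_bigr => s _.
by elim: (M s) => [|k IH]; rewrite ?big_nil// exprS IH big_cons.
Qed.

End Words.

Section TopSymbol.
Variables (A : comNzRingType) (n : nat) (kappa : A) (B b Q : 'M[A]_n).
Hypotheses (hB : B^T = B) (hQ : Q *m b = 1%:M).
Variable m : nat.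
Local Notation U := (Ukappa kappa B).
Local Notation V := ('I_n * int)%type.
Local Notation S := (symb b Q m).
Implicit Types (phi : monomial n -> A) (s : V) (w : seq V) (u : U).

Definition ygen s : U := Ugen kappa B (ybase b s).
Definition yprod w : U := \prod_(s <- w) ygen s.

Lemma yprod_uprod w : yprod w = uprod kappa B [seq (ybase b s, 0) | s <- w].
Proof. by rewrite /uprod big_map. Qed.

Lemma pbw_lt_yprod d w : (size w < d)%N -> pbw_lt d (yprod w).
Proof. by move=> wd; rewrite yprod_uprod; apply: pbw_lt_uprod; rewrite size_map. Qed.

Lemma symb_ygenX s u k d phi : s.2 < m%:Z -> pbw_lt d.+1 u -> deg_ge (k + d) phi ->
  S (ygen s ^+ k * u) phi = S u (fun M => phi (iter k (fun N => madd N s) M)).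
Proof.
move=> sm ud; elim: k phi => [|k IH] phi hphi; first by rewrite expr0 mul1r.
rewrite exprS -mulrA (symb_ybase hB hQ (d := (k + d)%N) sm)//.
  rewrite IH => [|M Md]; last by rewrite hphi// mdegree_madd ltnS.
  by congr S; apply: funext => M; rewrite -iterSr.
rewrite -addnS; apply: pbw_ltM => //.
by have := @pbw_ltX _ _ kappa B 1 _ k (@pbw_lt_ugen _ _ kappa B 2 (ybase b s, 0) isT); rewrite mul1n.
Qed.

Lemma symb_yprod w phi : (forall s, s \in w -> s.2 < m%:Z) -> deg_ge (size w) phi ->
  S (yprod w) phi = phi (mono_of 1 w).
Proof.
elim: w phi => [|s w IH] phi hw hphi; first by rewrite /yprod big_nil (symb1 kappa hB hQ).
have sm : s.2 < m%:Z by apply: hw; rewrite mem_head.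
rewrite /yprod big_cons -[ygen s]expr1 (symb_ygenX (d := size w) sm)//.
  rewrite -/(yprod w) IH// => [r rw|M Mw]; first by apply: hw; rewrite in_cons rw orbT.
  by rewrite hphi//= mdegree_madd.
exact: pbw_lt_yprod.
Qed.

(** Degree less than d in the quotient by U t^m h[[t]]. Required at every m, it describes the
    closure of a PBW filtration term. *)
Definition mod_lt d u := exists2 v : U, pbw_lt d v & tail_ideal m (u - v).

Lemma mod_ltD d u v : mod_lt d u -> mod_lt d v -> mod_lt d (u + v).
Proof.
move=> [u' du tu] [v' dv tv]; exists (u' + v'); first exact: pbw_ltD.
by rewrite opprD addrACA; apply: tailD.
Qed.

Lemma mod_ltZ d r u : mod_lt d u -> mod_lt d (r *: u).
Proof.
by move=> [v dv tv]; exists (r *: v); [exact: pbw_ltZ | rewrite -scalerBr; exact: tailZ].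
Qed.

Lemma mod_lt_pbw d u : pbw_lt d u -> mod_lt d u.
Proof. by move=> du; exists u => //; rewrite subrr; apply: tail0. Qed.

Lemma mod_lt_tail d u : tail_ideal m u -> mod_lt d u.
Proof. by move=> tu; exists 0; [exact: pbw_lt0 | rewrite subr0]. Qed.

Definition spanned d u := exists2 t : seq (A * monomial n),
  (forall x, x \in t -> below m x.2 /\ mdegree x.2 = d) &
  mod_lt d (u - \sum_(x <- t) x.1 *: yprod (word x.2)).

Lemma spannedD d u v : spanned d u -> spanned d v -> spanned d (u + v).
Proof.
move=> [s hs su] [t ht tv]; exists (s ++ t).
  by move=> x; rewrite mem_cat => /orP[/hs|/ht].
by rewrite big_cat opprD addrACA; apply: mod_ltD.
Qed.

Lemma spannedZ d r u : spanned d u -> spanned d (r *: u).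
Proof.
move=> [s hs su]; exists [seq (r * x.1, x.2) | x <- s].
  by move=> _ /mapP[x xs ->]; apply: hs xs.
rewrite big_map (eq_bigr (fun x => r *: (x.1 *: yprod (word x.2)))) => [|x _]; last by rewrite scalerA.
by rewrite -scaler_sumr -scalerBr; apply: mod_ltZ.
Qed.

Lemma spanned_mod d u : mod_lt d u -> spanned d u.
Proof. by move=> du; exists [::] => //; rewrite big_nil subr0. Qed.

Lemma spanned_sum d I (r : seq I) (P : pred I) (F : I -> U) :
  (forall i, P i -> spanned d (F i)) -> spanned d (\sum_(i <- r | P i) F i).
Proof.
move=> hF; elim/big_ind: _ => //; last exact: spannedD.
exact/spanned_mod/mod_lt_pbw/pbw_lt0.
Qed.

Lemma crd_expand (w : 'rV[laurent A]_n) : exists E : {fset V}, exists2 r : 'rV[laurent A]_n,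
  vanish_row m r & w = \sum_(s <- E) lmon (crd_lt Q m w s) 0 *: ybase b s + r.
Proof.
have [E hE] := crd_lt_fin Q m w; exists E.
exists (w - \sum_(s <- E) lmon (crd_lt Q m w s) 0 *: ybase b s); last by rewrite subrKC.
move=> c i im; rewrite !mxE lcoefD lcoefN summxE lcoef_sum.
apply/eqP; rewrite subr_eq0; apply/eqP.
transitivity (fsum (fun s => crd_lt Q m w s * ybase b s 0 c i)); last first.
  rewrite (@fsumE _ _ E) => [|s /hE ->]; last by rewrite mul0r.
  by apply: eq_bigr => s _; rewrite !mxE coef_lmonM subr0.
rewrite (@fsum_window _ _ i 1) => [|s si]; last first.
  by rewrite mxE /=; case: eqP => [e|_]; rewrite ?mulr0//; move: si; rewrite -e; lia.
rewrite big_ord1; transitivity (\sum_a \sum_c' w 0 c' i * Q c' a * b a c); last first.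
  by apply: eq_bigr => a _; rewrite addr0 /crd_lt /= im /crd mxE /= eqxx mulr_suml.
rewrite exchange_big /= (bigD1 c)//= [X in _ + X]big1 => [|c' c'c].
  under eq_bigr do rewrite -mulrA.
  rewrite -mulr_sumr; have := congr1 (fun M : 'M_n => M c c) hQ; rewrite !mxE eqxx => ->.
  by rewrite mulr1 addr0.
under eq_bigr do rewrite -mulrA.
rewrite -mulr_sumr; have := congr1 (fun M : 'M_n => M c' c) hQ; rewrite !mxE (negPf c'c) => ->.
by rewrite mulr0.
Qed.

(** The spanning half of PBW, by induction on the letters not yet expanded. A letter is a finite
    combination of b_a t^i with i < m plus a remainder in t^m h[[t]]; the remainder is moved to the
    right end, at the cost of lower degree, and there falls into the left ideal. *)
Lemma spanned_word w (l : seq (hhat A n)) : (forall s, s \in w -> s.2 < m%:Z) ->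
  spanned (size w + size l) (yprod w * uprod kappa B l).
Proof.
elim: l w => [|x l IH] w hw.
  rewrite addn0 uprod_nil mulr1; pose N := mono_of 1 w.
  exists [:: (1, N)].
    move=> _ /[!inE] /eqP -> /=; rewrite mdegree_mono_of mul1n; split=> // s.
    by rewrite mono_ofE mul1n -lt0n -has_count has_pred1 => /hw.
  rewrite big_seq1 scale1r; apply: mod_lt_pbw; rewrite !yprod_uprod.
  have := @uprod_perm _ _ kappa B _ _ (perm_map (fun s => (ybase b s, 0)) (perm_word (erefl N))).
  by rewrite size_map.
have [E [r hr ex]] := crd_expand x.1.
have eg : ugen kappa B x = \sum_(s <- E) crd_lt Q m x.1 s *: ygen s +
    (Ugen kappa B r + x.2 *: (1 : U)).
  rewrite ugen_split addrA; congr (_ + _).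
  under eq_bigr do rewrite -ugenZ.
  rewrite -ugen_sum -ugenD; congr ugen.
  have -> : \sum_(s <- E) crd_lt Q m x.1 s *: ((ybase b s, 0) : hhat A n) =
      (\sum_(s <- E) lmon (crd_lt Q m x.1 s) 0 *: ybase b s, 0).
    by elim/big_rec2: _ => // s y1 y2 _ ->; congr pair; rewrite /= mulr0 addr0.
  by rewrite {1}ex; congr pair; rewrite /= addr0.
rewrite uprod_cons mulrA eg mulrDr mulrDl; apply: spannedD.
  rewrite mulr_sumr mulr_suml; apply: spanned_sum => s _.
  rewrite -uscaleAr -uscaleAl; have [sm|ms] := boolP (s.2 < m%:Z); last first.
    by rewrite /crd_lt (negPf ms) scale0r; apply/spanned_mod/mod_lt_pbw/pbw_lt0.
  apply: spannedZ; have -> : yprod w * ygen s = yprod (rcons w s).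
    by rewrite /yprod -cats1 big_cat big_seq1.
  have -> : (size w + size (x :: l) = size (rcons w s) + size l)%N.
    by rewrite size_rcons addSnnS.
  by apply: IH => r'; rewrite mem_rcons in_cons => /orP[/eqP ->|/hw].
rewrite mulrDr mulrDl; apply/spanned_mod/mod_ltD; last first.
  rewrite -uscaleAr mulr1 -uscaleAl; apply/mod_ltZ/mod_lt_pbw.
  rewrite yprod_uprod -uprod_cat; apply: pbw_lt_uprod.
  by rewrite size_cat size_map /= addnS.
pose w' := [seq (ybase b s, 0 : A) | s <- w].
have p1 : perm_eq (w' ++ (r, 0) :: l) ((w' ++ l) ++ [:: (r, 0)]).
  by rewrite -catA perm_cat2l cats1 -perm_rcons.
have := uprod_perm kappa B p1; rewrite size_cat size_map /= => hlt.
rewrite [X in mod_lt _ X](_ : _ = uprod kappa B (w' ++ (r, 0) :: l) -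
    uprod kappa B ((w' ++ l) ++ [:: (r, 0)]) + uprod kappa B ((w' ++ l) ++ [:: (r, 0)])).
  apply: mod_ltD; first exact: mod_lt_pbw.
  apply: mod_lt_tail; rewrite uprod_cat uprod_cons uprod_nil mulr1.
  exact/tail_mull/tail_Ugen.
by rewrite subrK uprod_cat uprod_cons yprod_uprod mulrA.
Qed.

Lemma pbw_lt_spanned d u : pbw_lt d.+1 u -> spanned d u.
Proof.
move=> [s /allP hs ->]; rewrite big_seq; apply: spanned_sum => t /hs.
rewrite /= ltnS leq_eqVlt => /orP[/eqP td|td]; apply: spannedZ; last first.
  exact/spanned_mod/mod_lt_pbw/pbw_lt_uprod.
have := @spanned_word [::] t.2; rewrite /yprod big_nil mul1r add0n td.
by apply=> s'; rewrite in_nil.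
Qed.

Lemma symb_mod_lt d u phi : mod_lt d u -> deg_ge d phi -> S u phi = 0.
Proof.
move=> [v dv tv] hphi; rewrite -(subrK v u) (symbD hB hQ) (symb_tail hB hQ phi tv) add0r.
exact: symb_lt dv hphi.
Qed.

(** The independence half of PBW: lower terms and tails are invisible to [delta A N], which
    separates ordered monomials of degree d. *)
Lemma symb_spanned d u (t : seq (A * monomial n)) N :
    (forall x, x \in t -> below m x.2 /\ mdegree x.2 = d) ->
    mod_lt d (u - \sum_(x <- t) x.1 *: yprod (word x.2)) -> mdegree N = d ->
  S u (delta A N) = \sum_(x <- t) x.1 * (x.2 == N)%:R.
Proof.
move=> ht hu Nd; have hN : deg_ge d (delta A N) by rewrite -Nd; apply: deg_ge_delta.
rewrite -(subrK (\sum_(x <- t) x.1 *: yprod (word x.2)) u) (symbD hB hQ) (symb_mod_lt hu hN) add0r.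
rewrite (symb_sum hB hQ) big_seq [RHS]big_seq; apply: eq_bigr => x /ht[xm xd].
rewrite (symbZ hB hQ) symb_yprod; first last.
- by rewrite size_word xd.
- by move=> s /mem_word; apply: xm.
rewrite mono_of_word /delta (_ : mscale 1 x.2 = x.2); first by case: eqP.
by apply: mono_eq => s; rewrite mscaleE mul1n.
Qed.

Lemma symb_delta_finite d u : pbw_lt d.+1 u -> exists L : seq (monomial n),
  forall N, mdegree N = d -> S u (delta A N) != 0 -> N \in L.
Proof.
move=> /pbw_lt_spanned[t ht hu]; exists [seq x.2 | x <- t] => N Nd.
rewrite (symb_spanned ht hu Nd); apply: contraR => /mapP NL.
rewrite big_seq big1// => x xt; case: eqP => [e|_]; last by rewrite mulr0.
by case: NL; exists x.
Qed.

(** Spanning gives a top part made of ordered monomials; once repetitions are collected, its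
    coefficients are the values on [delta], all zero. *)
Lemma symb_delta_eq0 d u : pbw_lt d.+1 u ->
  (forall N, below m N -> mdegree N = d -> S u (delta A N) = 0) -> mod_lt d u.
Proof.
move=> /pbw_lt_spanned[t ht hu] h0.
rewrite -(subrK (\sum_(x <- t) x.1 *: yprod (word x.2)) u); apply: mod_ltD => //.
pose L := undup [seq x.2 | x <- t].
have -> : \sum_(x <- t) x.1 *: yprod (word x.2) =
    \sum_(N <- L) (\sum_(x <- t) x.1 * (x.2 == N)%:R) *: yprod (word N).
  under [RHS]eq_bigr do rewrite scaler_suml.
  rewrite exchange_big big_seq [RHS]big_seq; apply: eq_bigr => x xt.
  have xL : x.2 \in L by rewrite mem_undup map_f.
  rewrite (bigD1_seq x.2)//= ?undup_uniq// eqxx mulr1 big1 ?addr0// => N.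
  by rewrite eq_sym => /negPf ->; rewrite mulr0 scale0r.
rewrite big_seq big1; first exact/mod_lt_pbw/pbw_lt0.
move=> N; rewrite mem_undup => /mapP[x xt eN]; have [xm xd] := ht _ xt.
by rewrite -(symb_spanned ht hu) eN// h0 ?scale0r.
Qed.

End TopSymbol.

(** * The prime field and leading terms of the p-central elements *)

Section PrimeField.
Variables (p : nat) (R : comNzRingType).
Hypothesis hp : p \in [pchar R].

Let pp : prime p. Proof. exact: pcharf_prime hp. Qed.

Lemma natr_modp k : (k %% p)%N%:R = k%:R :> R.
Proof.
by rewrite [in RHS](divn_eq k p) natrD natrM (pcharf0 hp) mulr0 add0r.
Qed.

Lemma Fp_natrD (x y : 'F_p) : ((x + y)%R : nat)%:R = (x : nat)%:R + (y : nat)%:R :> R.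
Proof.
rewrite -natrD -[RHS]natr_modp; congr (_ *+ (_ %% _)); exact: Fp_cast.
Qed.

Lemma Fp_natrM (x y : 'F_p) : ((x * y)%R : nat)%:R = (x : nat)%:R * (y : nat)%:R :> R.
Proof.
rewrite -natrM -[RHS]natr_modp; congr (_ *+ (_ %% _)); exact: Fp_cast.
Qed.

Lemma natr_cancel k (x : R) : ~~ (p %| k)%N -> k%:R * x = 0 -> x = 0.
Proof.
move=> pk kx; have k0 : (0 < k)%N by case: k pk {kx}; rewrite ?dvdn0.
have [u v e _] := egcdnP p k0.
have uk : u%:R * k%:R = 1 :> R.
  rewrite -natrM e natrD natrM (pcharf0 hp) mulr0 add0r.
  by rewrite (eqP (_ : coprime k p)) // coprime_sym prime_coprime.
by rewrite -[x]mul1r -uk -mulrA kx mulr0.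
Qed.

Definition basis_mx n (bt : n.-tuple 'rV['F_p]_n) : 'M[R]_n :=
  \matrix_(a, c) (tnth bt a 0 c : nat)%:R.

Lemma basis_mx_inv n (bt : n.-tuple 'rV['F_p]_n) : basis_of fullv bt ->
  exists Q : 'M[R]_n, Q *m basis_mx bt = 1%:M.
Proof.
move=> hb; pose f (x : 'F_p) : R := (x : nat)%:R.
have f0 : f 0 = 0 by [].
exists (\matrix_(c, a) f (coord bt a (delta_mx 0 c))).
apply/matrixP => c c'; rewrite !mxE.
transitivity (f (\sum_a coord bt a (delta_mx 0 c) * tnth bt a 0 c')).
  rewrite (big_morph f Fp_natrD f0); apply: eq_bigr => a _.
  by rewrite !mxE /f Fp_natrM.
have := congr1 (fun v : 'rV_n => v 0 c') (coord_basis hb (memvf (delta_mx 0 c))).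
rewrite mxE summxE eqxx /= => e; transitivity (f (c' == c)%:R).
  by congr f; rewrite e; apply: eq_bigr => a _; rewrite mxE (tnth_nth 0).
by rewrite eq_sym /f; case: (c == c').
Qed.

End PrimeField.

Section CenterWords.
Variables (p : nat) (A : comNzRingType) (n : nat) (kappa : A) (B Q : 'M[A]_n).
Variable bt : n.-tuple 'rV['F_p]_n.
Hypothesis hp : p \in [pchar A].
Hypotheses (hB : B^T = B) (hQ : Q *m basis_mx A bt = 1%:M).
Local Notation U := (Ukappa kappa B).
Local Notation V := ('I_n * int)%type.
Local Notation b := (basis_mx A bt).
Implicit Types (s : V) (w : seq V) (M : monomial n).

Let pp : prime p. Proof. exact: pcharf_prime hp. Qed.

Definition zgen s : U := pcenter_elt kappa B (tnth bt s.1) s.2.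
Definition zprod w : U := \prod_(s <- w) zgen s.

Lemma xt_ybase s : xt A (tnth bt s.1) s.2 = ybase b s.
Proof. by apply/rowP => c; rewrite !mxE. Qed.

Lemma meval_zprod M : meval kappa B bt M = zprod (word M).
Proof. exact: (prod_word zgen). Qed.

Lemma pbw_lt_zprod w : pbw_lt (p * size w).+1 (zprod w).
Proof.
elim: w => [|s w IH].
  by rewrite muln0 /zprod big_nil -(uprod_nil kappa B); apply: pbw_lt_uprod.
rewrite /zprod big_cons mulnS -addnS; apply: pbw_ltM => //.
exact: pcenter_pbw_lt.
Qed.

Lemma pbw_lt_meval M : pbw_lt (p * mdegree M).+1 (meval kappa B bt M).
Proof. by rewrite meval_zprod -size_word; apply: pbw_lt_zprod. Qed.

(** A factor of index at least m lies in the left ideal, and being central it may be moved to the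
    right end. *)
Lemma meval_tail m M : ~ below m M -> tail_ideal m (meval kappa B bt M).
Proof.
move=> mM; have [s Ms ms] : exists2 s, s \in word M & m%:Z <= s.2.
  apply: contrapT => hs; apply: mM => s Ms; rewrite ltNge; apply/negP => ms.
  by apply: hs; exists s => //; rewrite -has_pred1 has_count count_word lt0n.
rewrite meval_zprod; case/splitPr: Ms => w1 w2.
rewrite /zprod big_cat big_cons /=; apply: tail_mull.
by rewrite -[zgen s * _](pcenter_central hp); apply/tail_mull/pcenter_tail.
Qed.

(** The correction kappa^(p-1) x t^(ip) has degree 1 < p, so each factor has leading term X_s^p and
    the leading term of the product is the product of these. *)
Lemma symb_zprod m w phi : (forall s, s \in w -> s.2 < m%:Z) ->
  deg_ge (p * size w) phi -> symb b Q m (zprod w) phi = phi (mono_of p w).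
Proof.
elim: w phi => [|s w IH] phi hw hphi; first by rewrite /zprod big_nil (symb1 kappa hB hQ).
have sm : s.2 < m%:Z by apply: hw; rewrite mem_head.
have := pbw_lt_zprod w; move: hphi; rewrite mulnS => hphi wlt.
rewrite /zprod big_cons -/(zprod w) /zgen /pcenter_elt mulrBl (symbB hB hQ) xt_ybase.
rewrite (symb_ygenX hB hQ sm wlt hphi) -uscaleAl (symbZ hB hQ).
rewrite [X in _ - _ * X](symb_lt hB hQ m (d := (p + p * size w)%N)) ?mulr0 ?subr0//.
  apply: IH => [r rw|M Mw]; first by apply: hw; rewrite in_cons rw orbT.
  by rewrite hphi// mdegree_iter ltn_add2l.
apply: (@pbw_lt_le _ _ _ _ (1 + (p * size w).+1)%N).
  by rewrite addnS -addSn leq_add2r prime_gt1.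
by apply: pbw_ltM wlt; apply: pbw_lt_ugen.
Qed.

Lemma symb_meval m M phi : below m M -> deg_ge (p * mdegree M) phi ->
  symb b Q m (meval kappa B bt M) phi = phi (mscale p M).
Proof.
move=> mM hphi; rewrite meval_zprod symb_zprod ?mono_of_word ?size_word//.
by move=> s /mem_word; apply: mM.
Qed.

Lemma meval_LH_act (g : torus n (laurent A)) M :
  (forall c d, B c d ^+ p = B c d) ->
  LH_act g (meval kappa B bt M) = meval kappa B bt M.
Proof.
move=> hBp; rewrite meval_zprod.
rewrite [LHS](env_morph_prod (@LH_act_pi A n kappa B g)).
by apply: eq_bigr => s _; apply: pcenter_LH_act.
Qed.

End CenterWords.

Lemma base_change_meval p (R A : comNzRingType) n (f : {rmorphism R -> A}) kappa
    (B : 'M[R]_n) (bt : n.-tuple 'rV['F_p]_n) M :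
  base_change f (meval kappa B bt M) = meval (f kappa) (map_mx f B) bt M.
Proof.
rewrite !meval_zprod [LHS](env_morph_prod (@base_change_pi R A n f kappa B)).
by apply: eq_bigr => s _; apply: base_change_pcenter.
Qed.

(** * Invariants *)

Section DlogPairing.
Variables (A : comNzRingType) (n : nat) (kappa : A) (B b Q : 'M[A]_n).
Hypothesis hQ : Q *m b = 1%:M.
Implicit Types w : 'rV[laurent A]_n.

Lemma dform_vanish w (K : nat) s : (forall c, vanish_below (- K%:Z) (w 0 c)) ->
  K%:Z <= s.2 -> dform kappa B b w s = 0.
Proof.
case: s => a i hw /= Ki; rewrite /dform big1 ?mulr0// => c _.
by rewrite hw ?mul0r//=; lia.
Qed.

(** With w = dlog g this identifies the translation vector of g in the variables X_s. Its entries
    vanish at indices at least K, so truncation at a level m >= K loses nothing. *)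
Lemma lres_lform_fsum w w' (K m : nat) :
    (forall c, vanish_below (- K%:Z) (w 0 c)) -> (K <= m)%N ->
  kappa * lres (lform B w w') = fsum (fun s => crd_lt Q m w' s * dform kappa B b w s).
Proof.
move=> hw Km; have [L hL] := row_vanish w'.
rewrite (@lres_pairing _ _ _ _ _ _ (- L%:Z) (L + K)%N)//; last first.
  by move=> c; rewrite PoszD addKr; apply: hw.
rewrite (@fsum_window _ _ (- L%:Z) (L + K)%N) => [|s].
  apply: eq_bigr => k _; rewrite -(@sum_crd_dform _ _ kappa B b Q hQ); apply: eq_bigr => a _.
  by rewrite /crd_lt /= ifT//; have := ltn_ord k; lia.
rewrite negb_and -ltNge -leNgt PoszD addKr => /orP[sL|Ks].
  rewrite /crd_lt /crd; case: ifP; rewrite ?mul0r// big1 ?mul0r// => c _.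
  by rewrite hL ?mul0r.
by rewrite (dform_vanish hw Ks) mulr0.
Qed.

Lemma down_delta (v : 'I_n * int -> A) (E : {fset 'I_n * int}) N :
    (forall s, s \notin E -> v s = 0) ->
  down v (delta A N) =
  fun M => \sum_(s <- E) v s * (N s).+1%:R * delta A (madd N s) M.
Proof.
move=> vE; apply: funext => M; rewrite (@downE _ _ _ (E `|` finsupp M)%fset) ?fsubsetUr//.
rewrite [RHS](big_fset_incl _ (fsubsetUl E (finsupp M))) => [|s _ /vE ->]; last by rewrite !mul0r.
apply: eq_bigr => s _; rewrite /delta; have [->|MN] := eqVneq M (madd N s).
  by rewrite maddK eqxx maddE eqxx addn1.
have [Ms0|Ms] := eqVneq (M s) 0%N; first by rewrite Ms0 !(mulr0, mul0r).
case: eqP => [e|_]; last by rewrite !mulr0.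
by move: MN; rewrite -e msubK// eqxx.
Qed.

End DlogPairing.

Section FirstOrderInvariance.
Variables (R : comNzRingType) (n : nat) (kappa : R) (B b Q : 'M[R]_n).
Hypotheses (hB : B^T = B) (hQ : Q *m b = 1%:M).
Variable u : completion kappa B.
Implicit Types (N M : monomial n).

Definition coef m N := symb b Q m (u m) (delta R N).

Lemma coef_level m k N : (m <= k)%N -> below m N -> coef k N = coef m N.
Proof.
move=> mk mN; rewrite /coef (symb_level b Q _ mk (bounded_delta R mN)).
apply/eqP; rewrite -subr_eq0 -(symbB hB hQ); apply/eqP.
by apply/(symb_tail hB hQ)/completion_tail.
Qed.

Variable d : nat.
Hypothesis hu : LH_invariant u.
Hypothesis hd : forall m, mod_lt m d.+2 (u m).

(* The part of degree d of g.u - u is the derivative of the leading part of u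
   along the translation vector of g. *)
Lemma first_order (A : comNzRingType) (f : {rmorphism R -> A})
    (g : torus n (laurent A)) (E : {fset 'I_n * int}) (m : nat) N :
    mdegree N = d ->
    (forall s, s \notin E -> dform (f kappa) (map_mx f B) (map_mx f b) (dlog g) s = 0) ->
    (forall c, vanish_below (- m%:Z) (dlog g 0 c)) ->
  \sum_(s <- E) dform (f kappa) (map_mx f B) (map_mx f b) (dlog g) s *
     (N s).+1%:R * f (coef m (madd N s)) = 0.
Proof.
move=> Nd hE hg; set v := dform _ _ _ _.
have hB' : (map_mx f B)^T = map_mx f B by rewrite map_trmx hB.
have hQ' : map_mx f Q *m map_mx f b = 1%:M by rewrite -map_mxM hQ map_mx1.
have Tpi := base_change_pi f kappa B.
have Lpi := LH_act_pi (f kappa) (map_mx f B) g.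
have [M0 hM0] := hu f g m.
have [K0 hK0] := tail_LH_act (f kappa) (map_mx f B) g.
(* Invariance at level m holds for representatives past M0, and g preserves the ideal of level k for
   k >= K0; the latter permits replacing u k by an element w of honestly bounded PBW degree. *)
pose k := maxn M0 (maxn K0 m).
have mk : (m <= k)%N by rewrite /k; lia.
have [w wlt wt] := hd k.
pose W := base_change f w.
have tLW : tail_ideal m (LH_act g W - base_change f (u m)).
  have -> : LH_act g W - base_change f (u m) =
      (LH_act g (base_change f (u k)) - base_change f (u m)) -
      LH_act g (base_change f (u k - w)).
    rewrite /W [base_change f (u k - w)](env_morphB Tpi) [LH_act g (_ - _)](env_morphB Lpi).
    by rewrite opprB addrCA addrAC subrr add0r.
  apply: tailB; first by apply: hM0; rewrite /k; lia.
  apply: tail_le mk _; apply: hK0; first by rewrite /k; lia.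
  exact: tail_base_change.
have tW : tail_ideal m (W - base_change f (u m)).
  have -> : W - base_change f (u m) = base_change f (u k - u m) - base_change f (u k - w).
    rewrite [base_change f (u k - w)](env_morphB Tpi) [base_change f (_ - _)](env_morphB Tpi).
    by rewrite opprB addrCA addrAC subrr add0r.
  apply: tailB; apply: tail_base_change; first exact: completion_tail.
  exact: tail_le mk wt.
have Wlt : pbw_lt d.+2 W by apply: pbw_lt_base_change.
have eqS phi (x y : Ukappa (f kappa) (map_mx f B)) : tail_ideal m (x - y) ->
    symb (map_mx f b) (map_mx f Q) m x phi = symb (map_mx f b) (map_mx f Q) m y phi.
  by move=> xy; apply/eqP; rewrite -subr_eq0 -(symbB hB' hQ') (symb_tail hB' hQ').
have hv w' := @lres_lform_fsum _ _ (f kappa) (map_mx f B) _ _ hQ' _ w' m m hg (leqnn m).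
have dN : deg_ge d (delta A N) by rewrite -Nd; apply: deg_ge_delta.
have := symb_LH_act hB' hQ' hv Wlt dN.
rewrite (eqS _ _ _ tLW) !(eqS _ _ _ tW) => /esym/eqP.
rewrite -subr_eq0 addrAC subrr add0r (down_delta _ hE).
rewrite symb_sumr => /eqP e0; rewrite -[RHS]e0.
apply: eq_bigr => s _; congr (_ * _).
rewrite /coef -(symb_base_change f hB hQ); congr symb.
by apply: funext => M; rewrite /delta /=; case: eqP; rewrite ?rmorph1 ?rmorph0.
Qed.

End FirstOrderInvariance.

(** * One-parameter points of the loop group and the gradient of the leading part *)

Section OneParameter.
Variable n : nat.

Definition torus_at (A : comNzRingType) (c : 'I_n) (x : Gm (laurent A)) : torus n (laurent A) :=
  fun c' => if c' == c then x else MkGm (mulr1 1).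

Lemma dlog_torus_at (A : comNzRingType) c (x : Gm (laurent A)) c' :
  dlog (torus_at c x) 0 c' = if c' == c then ginv x * lderiv (gval x) else 0.
Proof.
rewrite mxE /torus_at; case: eqP => _ //=.
by rewrite -[X in lderiv X]/(lmon 1 0) lderiv_lmon mulr0z lmon0 mulr0.
Qed.

Lemma lmon_unit (A : comNzRingType) : lmon (1 : A) 1 * lmon 1 (-1) = 1.
Proof. by rewrite lmon_mul mulr1. Qed.

Variables (A : comNzRingType) (z : A) (e : int) (k : nat).
Hypothesis zk : z ^+ k.+1 = 0.

Lemma one_sub_unit :
  (1 - lmon z e) * (\sum_(j < k.+1) lmon z e ^+ j) = 1 :> laurent A.
Proof.
apply: oppr_inj; rewrite -mulNr opprB -subrX1 lmon_exp zk lmon0.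
by rewrite sub0r.
Qed.

(** Geometric series: dlog(1 - z t^e) is minus the sum over j of e z^(j+1) t^(e(j+1)-1) dt. The
    coefficient at -1 - i is the one that pairs with t^i. *)
Lemma dlog_one_sub i :
  ((\sum_(j < k.+1) lmon z e ^+ j) * lderiv (1 - lmon z e)) (-1 - i) =
  - \sum_(j < k.+1) if - i == e * (j.+1)%:Z then z ^+ j.+1 *~ e else 0.
Proof.
rewrite lderivD lderivN -[X in lderiv X + _]/(lmon 1 0) !lderiv_lmon mulr0z lmon0 add0r.
rewrite mulrN lcoefN mulr_suml lcoef_sum; congr (- _); apply: eq_bigr => j _.
rewrite lmon_exp lmon_mul /= mulrn_int mulrzAr -exprSr.
by congr (if _ then _ else _); apply/eqP/eqP; lia.
Qed.

End OneParameter.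

Lemma sum_pick (R : pzRingType) (s : seq nat) (F : nat -> R) k : uniq s -> k \in s ->
  \sum_(j <- s) F j * (k == j)%:R = F k.
Proof.
move=> us ks; rewrite (bigD1_seq k)//= eqxx mulr1 big1 ?addr0// => j.
by rewrite eq_sym => /negPf ->; rewrite mulr0.
Qed.

Section Gradient.
Variables (R : comNzRingType) (n : nat) (kappa : R) (B b Q H : 'M[R]_n).
Hypotheses (hB : B^T = B) (hQ : Q *m b = 1%:M) (hH : H *m (B *m b^T) = 1%:M).
Hypothesis hkappa : exists kappa', kappa' * kappa = 1.
Variables (u : completion kappa B) (d : nat).
Hypotheses (hu : LH_invariant u) (hd : forall m, mod_lt m d.+2 (u m)).
Implicit Types (N M : monomial n).

(** A point of the c-th factor of the torus moves the variables X_(a, i) for all a at once, in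
    proportion to row c of B b^T; this is the directional derivative that it detects at index i. *)
Definition grad m N (c : 'I_n) (i : int) : R :=
  kappa * \sum_a (B *m b^T) c a * ((N (a, i)).+1%:R * coef b Q u m (madd N (a, i))).

Lemma grad_first_order (A : comNzRingType) (f : {rmorphism R -> A}) c (x : Gm (laurent A))
    (J : seq int) m N : mdegree N = d -> uniq J ->
    (forall i, i \notin J -> (ginv x * lderiv (gval x)) (-1 - i) = 0) ->
    vanish_below (- m%:Z) (ginv x * lderiv (gval x)) ->
  \sum_(i <- J) (ginv x * lderiv (gval x)) (-1 - i) * f (grad m N c i) = 0.
Proof.
move=> Nd uJ hJ hx; set w := ginv x * _ in hJ hx *.
have dE s : dform (f kappa) (map_mx f B) (map_mx f b) (dlog (torus_at c x)) s =
    f kappa * (w (-1 - s.2) * f ((B *m b^T) c s.1)).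
  rewrite /dform (bigD1 c)//= dlog_torus_at eqxx [X in _ + X]big1 ?addr0 => [|c' /negPf c'c].
    by rewrite map_trmx -map_mxM mxE.
  by rewrite dlog_torus_at c'c mul0r.
pose L := [seq (a, i) | a <- index_enum 'I_n, i <- J].
have uL : uniq L by rewrite allpairs_uniq ?index_enum_uniq// => -[? ?] [? ?] _ _ [-> ->].
have LE s : s \notin [fset s in L]%fset ->
    dform (f kappa) (map_mx f B) (map_mx f b) (dlog (torus_at c x)) s = 0.
  rewrite in_fset /= dE => sL; rewrite hJ ?mul0r ?mulr0//.
  apply: contra sL => sJ; apply/allpairsP; exists s.
  by split; rewrite ?mem_index_enum//; case: (s).
have hg c' : vanish_below (- m%:Z) (dlog (torus_at c x) 0 c').
  by move=> i im; rewrite dlog_torus_at; case: eqP => // _; apply: hx.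
have := first_order hB hQ hu hd Nd LE hg.
rewrite (perm_big _ (uniq_perm (fset_uniq _) uL _)) => [|s]; last by rewrite in_fset.
rewrite big_allpairs_dep exchange_big /= => e0; rewrite -[RHS]e0.
apply: eq_bigr => i _; rewrite /grad rmorphM rmorph_sum mulrCA !mulr_sumr.
apply: eq_bigr => a _; rewrite dE /= !rmorphM rmorph_nat; ring.
Qed.

(** Nondegeneracy enters here: letting c vary, [H] inverts B b^T and isolates a single partial
    derivative, and the inverse of kappa removes the common factor. *)
Lemma grad_eq0 m N s : mdegree N = d -> (forall c, grad m N c s.2 = 0) ->
  (N s).+1%:R * coef b Q u m (madd N s) = 0.
Proof.
case: s => a i Nd h0; have [kappa' hk] := hkappa.
pose X a' := (N (a', i)).+1%:R * coef b Q u m (madd N (a', i)).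
transitivity (\sum_a' (H *m (B *m b^T)) a a' * X a').
  rewrite hH (bigD1 a)//= mxE eqxx mul1r big1 ?addr0// => a' /negPf a'a.
  by rewrite mxE eq_sym a'a mul0r.
under eq_bigr do rewrite mxE mulr_suml.
rewrite exchange_big big1 //= => c _.
under eq_bigr do rewrite -mulrA.
rewrite -mulr_sumr -[X in _ * X]mul1r -hk -mulrA.
by have := h0 c; rewrite /grad /= => ->; rewrite !mulr0.
Qed.

(* The nilpotent z separates the indices: the coefficient of z^k singles out the
   derivatives in the variables of index k (or -k). *)
Lemma coef_madd_eq0 m N s : mdegree N = d -> below m (madd N s) ->
  (N s).+1%:R * coef b Q u m (madd N s) = 0.
Proof.
(* The series for dlog(1 - z t^e), e = 1 or -1, is written up to z^(k+1), whose power of t is at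
   worst t^(-k-2); level m' accommodates this pole and leaves the coefficient unchanged. *)
move=> Nd mN; pose k := absz s.2; pose m' := maxn m k.+2.
have mm' : (m <= m')%N by rewrite /m'; lia.
rewrite -(coef_level hB hQ u mm' mN); apply: grad_eq0 => // c.
(* For index 0 the point t is enough: its dlog is dt/t, which pairs with t^0 alone. *)
have [s0|s0] := eqVneq s.2 0.
  pose x := MkGm (lmon_unit R).
  have xE : ginv x * lderiv (gval x) = lmon 1 (-1).
    by rewrite [ginv x]/= [gval x]/= lderiv_lmon lmon_mul mulr1z mulr1.
  have h1 i : i \notin [:: 0 : int] -> (ginv x * lderiv (gval x)) (-1 - i) = 0.
    by rewrite xE inE /= => i0; case: eqP => // e; move: i0; rewrite (_ : i = 0) ?eqxx//; lia.
  have h2 : vanish_below (- m'%:Z) (ginv x * lderiv (gval x)).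
    by move=> i im; rewrite xE /=; case: eqP => // e; move: im; rewrite e /m'; lia.
  have := @grad_first_order R idfun c x [:: 0] m' N Nd isT h1 h2.
  by rewrite big_seq1 xE /= mul1r s0.
have k0 : (0 < k)%N by rewrite /k absz_gt0.
(* dlog(1 - z t^e) pairs with the indices -e j, j > 0, whence the sign opposite to that of s.2. The
   point 1 - z t^(-s.2) would reach this index directly, but with the factor s.2, which may be zero
   in R, whereas e is a unit. *)
pose e : int := if 0 < s.2 then -1 else 1.
have se : s.2 = - e * k%:Z by rewrite /e /k; case: ltP => s2; lia.
pose h : {poly R} := 'X^(k.+1).
have hh : mk_monic h = h by rewrite mk_monic_Xn.
have sh : size (mk_monic h) = k.+2 by rewrite hh size_polyXn.
pose z : {poly %/ h} := 'qX.
have zk : z ^+ k.+1 = 0.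
  rewrite -rmorphXn /=; apply: val_inj; rewrite /= hh.
  by rewrite Pdiv.RingMonic.rmodpp// monicXn.
pose x := MkGm (one_sub_unit e zk).
pose J := [seq - e * j%:Z | j <- iota 1 k].
have e1 : e = 1 \/ e = -1 by rewrite /e; case: ifP; [right|left].
have uJ : uniq J.
  by rewrite map_inj_uniq ?iota_uniq// => i j; case: e1 => ->; lia.
have xE := dlog_one_sub z e k.
have h1 i : i \notin J -> (ginv x * lderiv (gval x)) (-1 - i) = 0.
  move=> iJ; rewrite [LHS]xE big1 ?oppr0// => j _; case: eqP => // ij.
  have [jk|jk] := eqVneq (j : nat) k; first by rewrite jk zk mul0rz.
  have := ltn_ord j => jk'; case/mapP: iJ; exists j.+1; first by rewrite mem_iota; lia.
  by rewrite mulNr -ij opprK.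
have h2 : vanish_below (- m'%:Z) (ginv x * lderiv (gval x)).
  move=> i im; rewrite (_ : i = -1 - (-1 - i)); last by lia.
  rewrite [LHS]xE big1 ?oppr0// => j _; case: eqP => // ij.
  by have := ltn_ord j; move: im ij; rewrite /m'; case: e1 => ->; lia.
have := @grad_first_order {poly %/ h} (qpolyC h) c x J m' N Nd uJ h1 h2.
rewrite big_map.
move=> /(congr1 (fun q : {poly %/ h} => (q : {poly R})`_k)); rewrite poly_of_qpoly_sum coef_sum.
have hw j : (0 < j <= k)%N -> (ginv x * lderiv (gval x)) (-1 - - e * j%:Z) = - (z ^+ j *~ e).
  move=> /andP[j0 jk]; rewrite [LHS]xE; congr (- _).
  have jk' : (j.-1 < k.+1)%N by rewrite prednK//; exact: leqW.
  rewrite (bigD1 (Ordinal jk'))//= prednK// mulNr opprK eqxx big1 ?addr0// => i.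
  rewrite -val_eqE /= => ij; case: eqP => // ee; case/eqP: ij.
  by move: ee; case: e1 => ->; lia.
have hc j : (0 < j <= k)%N ->
    (((ginv x * lderiv (gval x)) (-1 - - e * j%:Z) *
      qpolyC h (grad m' N c (- e * j%:Z)) : {poly %/ h}) : {poly R})`_k =
    - (grad m' N c (- e * j%:Z) *~ e) * (k == j)%:R.
  move=> jk; rewrite (hw j jk); set q := grad _ _ _ _.
  have -> : - (z ^+ j *~ e) * qpolyC h q = - (q *~ e) *: z ^+ j.
    by rewrite -mul_qpolyC rmorphN rmorphMz !mulNr mulrzAl mulrzAl mulrC.
  by rewrite [LHS](coefZ _ (z ^+ j : {poly R}) k) coef_qXn ?sh ?coefXn//; case/andP: jk.
rewrite coef0 big_seq (eq_bigr (fun j => - (grad m' N c (- e * j%:Z) *~ e) * (k == j)%:R)) => [|j]; last first.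
  by rewrite mem_iota => jk; apply: hc; lia.
rewrite -big_seq (@sum_pick _ _ (fun j => - (grad m' N c (- e * j%:Z) *~ e)) k (iota_uniq 1 k)); last by rewrite mem_iota; lia.
rewrite -se; move: (grad _ _ _ _) => q.
case: e1 => ->; rewrite ?mulr1z ?mulrN1z ?opprK// => /eqP.
by rewrite oppr_eq0 => /eqP.
Qed.

End Gradient.

(** * Existence and uniqueness of the expansion *)

Section Expansion.
Variables (p : nat) (R : comNzRingType) (n : nat) (kappa : R) (B Q H : 'M[R]_n).
Variable bt : n.-tuple 'rV['F_p]_n.
Local Notation b := (basis_mx R bt).
Hypothesis hp : p \in [pchar R].
Hypotheses (hB : B^T = B) (hQ : Q *m b = 1%:M) (hH : H *m (B *m b^T) = 1%:M).
Hypothesis hBp : forall c d, B c d ^+ p = B c d.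
Hypothesis hkappa : exists kappa', kappa' * kappa = 1.
Local Notation U := (Ukappa kappa B).
Local Notation Z := (meval kappa B bt).
Implicit Types (M N : monomial n) (u : completion kappa B).

Let pp : prime p. Proof. exact: pcharf_prime hp. Qed.
Let p0 : (0 < p)%N. Proof. exact: prime_gt0 pp. Qed.

Definition mdiv M : monomial n := [fsfun s in finsupp M => (M s %/ p)%N].

Lemma mdivE M s : mdiv M s = (M s %/ p)%N.
Proof.
rewrite fsfun_fun; case: ifP => // /negbT.
by rewrite memNfinsupp => /eqP ->; rewrite div0n.
Qed.

Lemma mscaleK M : mdiv (mscale p M) = M.
Proof. by apply: mono_eq => s; rewrite mdivE mscaleE mulKn. Qed.

(** Differentiating in X_s multiplies the coefficient of M by M s; this product is zero, and M s is
    invertible when p does not divide it. *)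
Lemma coef_pdiv u d m M : LH_invariant u -> (forall k, mod_lt k d.+1 (u k)) ->
  mdegree M = d -> below m M -> coef b Q u m M != 0 -> M = mscale p (mdiv M).
Proof.
move=> hu hd Md mM cM; apply: mono_eq => s; rewrite mscaleE mdivE mulnC divnK//.
apply: contraNT cM => ps; have Ms : M s != 0%N by case: (M s) ps => //; rewrite dvdn0.
have dd : d = d.-1.+1 by rewrite -Md -(mdegree_msub Ms).
have eM := msubK Ms; have Nd : mdegree (msub M s) = d.-1 by rewrite -Md -(mdegree_msub Ms).
have hd' k : mod_lt k d.-1.+2 (u k) by rewrite -dd.
have mM' : below m (madd (msub M s) s) by rewrite eM.
have := coef_madd_eq0 hB hQ hH hkappa hu hd' Nd mM'.
rewrite eM msubE eqxx subn1 prednK ?lt0n// => /(natr_cancel hp ps) ->.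
exact: eqxx.
Qed.

Lemma meval_sum_tail m (c : monomial n -> R) (F G : {fset monomial n}) :
    (G `<=` F)%fset -> (forall M, M \notin G -> c M != 0 -> ~ below m M) ->
  tail_ideal m (\sum_(M <- F) c M *: Z M - \sum_(M <- G) c M *: Z M).
Proof.
move=> GF hG; rewrite (big_fsetID _ (mem G))/=.
have -> : [fset x in F | x \in G]%fset = G.
  by apply/fsetP => M; rewrite !inE /= andbC; case: (boolP (M \in G)) => // /(fsubsetP GF).
rewrite addrAC subrr add0r big_seq; apply: tail_sum => M; rewrite !inE /= => /andP[_ MG].
have [->|cM] := eqVneq (c M) 0; first by rewrite scale0r; apply: tail0.
by apply: tailZ; apply: (meval_tail _ _ _ hp); apply: hG.
Qed.

Definition level M : nat := projT1 (cid (below_ex M)).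

Lemma levelP M : below (level M) M.
Proof. by rewrite /level; case: cid. Qed.

(** The coefficient of X^(pM) in the leading part, read at some level that sees it; it will be the
    coefficient of M in the expansion. A degree d prime to p contributes nothing. *)
Definition lead u d M : R :=
  if (p * mdegree M == d)%N then coef b Q u (level (mscale p M)) (mscale p M) else 0.

Lemma leadE u d m M : (p * mdegree M = d)%N -> below m (mscale p M) ->
  lead u d M = coef b Q u m (mscale p M).
Proof.
move=> Md mM; rewrite /lead Md eqxx; have lM := @levelP (mscale p M).
rewrite -(coef_level hB hQ u (leq_maxl (level (mscale p M)) m) lM).
exact: (coef_level hB hQ u (leq_maxr _ _)).
Qed.

(** At one level the top part is a finite combination of ordered monomials. This serves both to form
    the partial sums [lead_sum] and to prove convergence. *)
Lemma lead_finite u d m : mod_lt m d.+1 (u m) -> exists F : {fset monomial n},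
  forall M, M \in F <-> lead u d M != 0 /\ below m M.
Proof.
move=> [v vd vt]; have [L hL] := symb_delta_finite hB hQ m vd.
exists [fset M in [seq mdiv N | N <- L] | (lead u d M != 0) && `[< below m M >]]%fset.
move=> M; split=> [|[cM mM]].
  by rewrite !inE /= => /andP[_ /andP[-> /asboolP]].
rewrite !inE /= cM asboolT// !andbT -[M]mscaleK; apply: map_f; apply: hL.
  by rewrite mdegree_mscale; apply/eqP; apply: contraNT cM => /negPf h; rewrite /lead h.
have Md : (p * mdegree M = d)%N by apply/eqP; apply: contraNT cM => /negPf h; rewrite /lead h.
have mM' : below m (mscale p M) by apply/below_mscale.
rewrite (leadE u Md mM') in cM.
suff -> : symb b Q m v (delta R (mscale p M)) = coef b Q u m (mscale p M) by [].
rewrite /coef -(subrK v (u m)) (symbD hB hQ) (symb_tail hB hQ _ vt).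
by rewrite add0r.
Qed.

Section Remainder.
Variables (u : completion kappa B) (d : nat).
Hypotheses (hu : LH_invariant u) (hd : forall m, mod_lt m d.+1 (u m)).

Definition lead_supp m : {fset monomial n} := projT1 (cid (lead_finite (hd m))).

Lemma lead_suppP m M : M \in lead_supp m <-> lead u d M != 0 /\ below m M.
Proof. by rewrite /lead_supp; case: cid. Qed.

Definition lead_sum m : U := \sum_(M <- lead_supp m) lead u d M *: Z M.

Lemma lead_sum_tail m (F : {fset monomial n}) : (lead_supp m `<=` F)%fset ->
  tail_ideal m (\sum_(M <- F) lead u d M *: Z M - lead_sum m).
Proof.
by move=> mF; apply: meval_sum_tail => // M /negP MF cM mM; apply/MF/lead_suppP.
Qed.

Lemma lead_supp_le m k : (m <= k)%N -> (lead_supp m `<=` lead_supp k)%fset.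
Proof.
move=> mk; apply/fsubsetP => M /lead_suppP[cM mM].
by apply/lead_suppP; split=> //; apply: below_le mM.
Qed.

Lemma remainder_subproof m :
  tail_ideal m ((u m.+1 - lead_sum m.+1) - (u m - lead_sum m)).
Proof.
rewrite opprD opprK addrACA [- lead_sum _ + _]addrC -[lead_sum m - _]opprB.
by apply: tailB; [apply: cseqP | apply/lead_sum_tail/lead_supp_le].
Qed.

Definition remainder : completion kappa B := Completion remainder_subproof.

(** The subtracted sums are combinations of products of invariant elements, so g fixes them exactly;
    only the passage from level k to level m leaves a tail. *)
Lemma remainder_invariant : LH_invariant remainder.
Proof.
move=> A f g m; have [K hK] := hu f g m; exists (maxn K m) => k.
rewrite geq_max => /andP[Kk mk].
have Tpi := base_change_pi f kappa B.
have Lpi := LH_act_pi (f kappa) (map_mx f B) g.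
have hBp' c d' : map_mx f B c d' ^+ p = map_mx f B c d' by rewrite mxE -rmorphXn hBp.
have fixed m' : LH_act g (base_change f (lead_sum m')) = base_change f (lead_sum m').
  rewrite [base_change _ _](env_morph_sum Tpi) [LHS](env_morph_sum Lpi).
  apply: eq_bigr => M _; rewrite (env_morphZ Tpi) (env_morphZ Lpi) -/(base_change _ _) -/(LH_act _ _).
  by rewrite base_change_meval (meval_LH_act _ _ (rmorph_pchar f hp)).
rewrite [remainder k]/= [remainder m]/= ![base_change f (_ - _)](env_morphB Tpi).
rewrite [LH_act g (_ - _)](env_morphB Lpi) -/(base_change _ _) -!/(LH_act _ _) fixed.
rewrite opprD opprK addrACA [- _ + _]addrC -[base_change f (lead_sum m) - _]opprB.
apply: tailB; first exact: hK.
rewrite -[_ - _](env_morphB Tpi); apply: tail_base_change.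
exact/lead_sum_tail/lead_supp_le.
Qed.

(** By [coef_pdiv] the leading part of u consists of p-th powers, and by [symb_meval] the subtracted
    sum has the same leading part; all top coefficients cancel and [symb_delta_eq0] lowers the
    degree. *)
Lemma remainder_mod_lt m : mod_lt m d (remainder m).
Proof.
have [v vd vt] := hd m; pose w : U := v - lead_sum m.
have lead_deg M : M \in lead_supp m -> (p * mdegree M = d)%N.
  by move=> /lead_suppP[cM _]; apply/eqP; apply: contraNT cM => /negPf h; rewrite /lead h.
have wd : pbw_lt d.+1 w.
  apply: pbw_ltB => //; rewrite /lead_sum big_seq; apply: pbw_lt_sum => M /lead_deg <-.
  exact/pbw_ltZ/pbw_lt_meval.
have [w' wd' wt'] : mod_lt m d w.
  apply: (symb_delta_eq0 hB hQ wd) => N mN Nd.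
  have hN : deg_ge d (delta R N) by rewrite -Nd; apply: deg_ge_delta.
  rewrite (symbB hB hQ) (symb_sum hB hQ).
  have -> : symb b Q m v (delta R N) = coef b Q u m N.
    by rewrite /coef -(subrK v (u m)) (symbD hB hQ) (symb_tail hB hQ _ vt) add0r.
  have zE M : M \in lead_supp m -> symb b Q m (lead u d M *: Z M) (delta R N) =
      lead u d M * delta R N (mscale p M).
    move=> MF; have [_ mM] := (lead_suppP m M).1 MF.
    by rewrite (symbZ hB hQ) (symb_meval kappa hp hB hQ mM)// lead_deg.
  rewrite big_seq (eq_bigr _ zE) -big_seq /delta.
  have [cN|cN] := eqVneq (coef b Q u m N) 0.
    rewrite cN sub0r big_seq big1 ?oppr0// => M MF; case: eqP => [e|_]; last by rewrite mulr0.
    by rewrite (leadE u (lead_deg _ MF) (m := m)) ?e// cN mul0r.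
  have eN := coef_pdiv hu hd Nd mN cN.
  have dN : (p * mdegree (mdiv N) = d)%N by rewrite -mdegree_mscale -eN.
  have lN : lead u d (mdiv N) = coef b Q u m N by rewrite (leadE u dN (m := m)) -?eN.
  have NF : mdiv N \in lead_supp m.
    apply/lead_suppP; rewrite lN; split=> //.
    by apply/(below_mscale m _ p0); rewrite -eN.
  rewrite (big_fsetD1 _ NF)/= lN -eN eqxx mulr1 big_seq big1 ?addr0 ?subrr// => M.
  rewrite in_fsetD1 => /andP[MN _]; case: eqP => [e|_]; last by rewrite mulr0.
  by case/eqP: MN; rewrite -e mscaleK.
exists w' => //; rewrite -(subrK w (remainder m)) -addrA; apply: tailD => //.
by rewrite /w /= opprB addrA subrK.
Qed.

End Remainder.

Lemma expansion_exists d u : LH_invariant u -> (forall m, mod_lt m d (u m)) ->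
  exists c : monomial n -> R,
    [/\ forall M, c M != 0 -> (p * mdegree M < d)%N, converging c & has_sum bt c u].
Proof.
elim: d u => [|d IH] u hu hd.
  (* Degree less than 0 leaves only the empty combination: u is zero at every level. *)
  exists (fun=> 0); split=> [M|N|m]; first by rewrite eqxx.
    by rewrite (_ : [set _ | _]%classic = set0)// -subset0 => M [] /eqP.
  exists fset0 => F _; rewrite big1 ?subr0 => [|M _]; last by rewrite scale0r.
  have [v [s hs ->] vt] := hd m; rewrite (_ : s = [::]) in vt.
    by rewrite big_nil subr0 in vt.
  by case: (s) hs.
have [c [cd cc cs]] := IH _ (remainder_invariant hu hd) (remainder_mod_lt hu hd).
have lead_deg M : lead u d M != 0 -> (p * mdegree M = d)%N.
  by move=> cM; apply/eqP; apply: contraNT cM => /negPf h; rewrite /lead h.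
exists (fun M => c M + lead u d M); split=> [M|N|m].
- have [->|cM _] := eqVneq (c M) 0; first by rewrite add0r => /lead_deg ->.
  exact/ltnW/cd.
(* Monomials with all indices at most N are below any natural number k > N, and at level k the new
   coefficients have finite support. *)
- have [k Nk] : exists k : nat, N < k%:Z by exists (absz N).+1; lia.
  apply: (@sub_finite_set _ _ ([set M | c M != 0 /\ forall s, s \in finsupp M -> s.2 <= N] `|`
      [set` lead_supp hd k])%classic); last first.
    by rewrite finite_setU; split; [exact: cc | exact: finite_fset].
  move=> M /= [cM MN]; have [c0|c0] := eqVneq (c M) 0; last by left.
  right; apply/lead_suppP; split; first by rewrite c0 add0r in cM.
  by move=> s; rewrite -mem_finsupp => /MN sN; apply: le_lt_trans sN Nk.
have [F0 hF0] := cs m; exists (F0 `|` lead_supp hd m)%fset => F.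
rewrite fsubUset => /andP[/hF0 h1 /lead_sum_tail h2].
have := tailB h1 h2; congr tail_ideal.
under [in RHS]eq_bigr do rewrite scalerDl.
rewrite big_split opprB opprD !addrA; congr (_ - _).
by rewrite [X in X + _]addrAC /= subrK.
Qed.

End Expansion.

(** The bound j/p gives a monomial M of largest degree where the families differ. The difference of
    the partial sums lies in U t^m h[[t]] and is tested on the functional that picks X^(pM): terms
    of lower degree die by the PBW filtration, others of equal degree because M -> pM is injective,
    and those not below m because they lie in the left ideal. *)
Lemma expansion_unique (p : nat) (R : comNzRingType) n (kappa : R) (B Q : 'M[R]_n)
    (bt : n.-tuple 'rV['F_p]_n) (u : completion kappa B) (j : nat) c1 c2 :
    p \in [pchar R] -> B^T = B -> Q *m basis_mx R bt = 1%:M ->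
  expansion bt j c1 u -> expansion bt j c2 u -> c1 =1 c2.
Proof.
move=> hp hB hQ [d1 _ s1] [d2 _ s2] M1; apply: contrapT => ne1.
have p0 : (0 < p)%N by apply: prime_gt0 (pcharf_prime hp).
pose c M := c1 M - c2 M.
have cne M : c M != 0 -> (mdegree M * p <= j)%N.
  rewrite /c; have [c10|/d1//] := eqVneq (c1 M) 0.
  by have [c20|/d2//] := eqVneq (c2 M) 0; rewrite c10 c20 subrr eqxx.
pose P k := `[< exists2 M, c M != 0 & mdegree M = k >].
have exP : exists k, P k.
  exists (mdegree M1); apply/asboolP; exists M1 => //.
  by rewrite subr_eq0; apply/eqP.
have leP k : P k -> (k <= j)%N.
  by move=> /asboolP[M /cne h <-]; apply: leq_trans h; rewrite leq_pmulr.
case: (ex_maxnP exP leP) => k /asboolP[M cM Mk] kmax.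
pose m := level M; have mM := @levelP _ M : below m M.
have [F1 h1] := s1 m; have [F2 h2] := s2 m.
pose F := (M |` (F1 `|` F2))%fset.
have F1F : (F1 `<=` F)%fset by apply/fsubsetP => N N1; rewrite !inE N1 /= orbT.
have F2F : (F2 `<=` F)%fset by apply/fsubsetP => N N2; rewrite !inE N2 /= !orbT.
have tF : tail_ideal m (\sum_(N <- F) c N *: meval kappa B bt N).
  have := tailB (h2 F F2F) (h1 F F1F); congr tail_ideal.
  rewrite opprB addrC addrA subrK -sumrB; apply: eq_bigr => N _.
  by rewrite /c scalerBl.
have MF : M \in F by rewrite !inE eqxx.
have := symb_tail hB hQ (delta R (mscale p M)) tF.
rewrite (symb_sum hB hQ) (big_fsetD1 _ MF)/= (symbZ hB hQ).
have dM : deg_ge (p * mdegree M) (delta R (mscale p M)).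
  by rewrite -mdegree_mscale; apply: deg_ge_delta.
rewrite (symb_meval kappa hp hB hQ mM dM) {1}/delta eqxx mulr1 big_seq big1 ?addr0 => [/eqP|N].
  by rewrite (negPf cM).
rewrite in_fsetD1 => /andP[NM _]; rewrite (symbZ hB hQ).
have [->|cN] := eqVneq (c N) 0; first by rewrite mul0r.
have [mN|mN] := EM (below m N); last first.
  by rewrite (symb_tail hB hQ _ (meval_tail kappa B bt hp mN)) mulr0.
have := kmax (mdegree N); rewrite leq_eqVlt => /(_ _)/orP[|/eqP Nk|Nk].
- by apply/asboolP; exists N.
- rewrite (symb_meval kappa hp hB hQ mN) ?Nk -?Mk// /delta; case: eqP => [e|_]; last by rewrite mulr0.
  by case/eqP: NM; apply: mscale_inj e.
rewrite (symb_lt hB hQ m (pbw_lt_meval kappa B bt hp N)) ?mulr0//.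
by apply: deg_ge_le dM; rewrite ltn_pmul2l// Mk.
Qed.

Theorem proposition6p3p2 (p : nat) (R : comUnitRingType) (hp : p \in [pchar R])
    (h2 : (2%:R : R) \is a GRing.unit) (n : nat) (W : torus_rep R n)
    (hW : nondegenerate_trace_form W)
    (kappa : R) (hkappa : kappa \is a GRing.unit) :
  (forall (x : 'rV['F_p]_n) (j : int),
     let z := completion_of (pcenter_elt kappa (gram W) x j) in
     Uhat z /\ LH_invariant z) /\
  (forall b : n.-tuple 'rV['F_p]_n, basis_of fullv b ->
   forall (j : nat) (u : completion kappa (gram W)),
     Utilde_le j u -> LH_invariant u ->
     exists c : monomial n -> R,
       expansion b j c u /\
       forall c' : monomial n -> R, expansion b j c' u -> c' =1 c).
Proof.
have hB := gram_sym W.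
have hBp c d : gram W c d ^+ p = gram W c d by apply: gram_pchar.
split=> [x j z|b hb j u uj uinv].
  split.
    exists p => m; exists (pcenter_elt kappa (gram W) x j); split.
      exact/pbw_leP/pcenter_pbw_lt.
    by rewrite subrr; apply: tail0.
  (* The base-changed element is fixed on the nose, so the limit is attained from the first term
     on. *)
  move=> A f g m; exists 0%N => k _; rewrite /= base_change_pcenter.
  rewrite (pcenter_LH_act _ (rmorph_pchar f hp)) ?subrr; first exact: tail0.
  by move=> c d; rewrite mxE -rmorphXn hBp.
have [Q hQ] := basis_mx_inv hp hb.
(* Since Q is the inverse of b, the inverse of B b^T is Q^T B^(-1). *)
pose H := Q^T *m invmx (gram W).
have hH : H *m (gram W *m (basis_mx R b)^T) = 1%:M.
  by rewrite /H mulmxA mulmxKV// -trmx_mul (mulmx1C hQ) trmx1.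
have hk : exists kappa', kappa' * kappa = 1 by exists kappa^-1; rewrite mulVr.
have ud m : mod_lt m j.+1 (u m).
  by have [v [/pbw_leP vj vt]] := uj m; exists v.
have [c [cd cc cs]] := expansion_exists hp hB hQ hH hBp hk uinv ud.
have ec : expansion b j c u by split=> // M /cd; rewrite mulnC.
exists c; split=> // c' ec' M.
exact: (expansion_unique hp hB hQ ec' ec).
Qed.
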